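(* Let $F=-a^{\mu\nu}\nabla_\mu\nabla_\nu+q$ be a self-adjoint second-order operator with positive definite leading symbol $A(\xi)=a^{\mu\nu}\xi_\mu\xi_\nu$, acting on sections of a tensor-spinor bundle $\mathcal V$ over a compact Riemannian manifold $M$ of dimension $m$ without boundary, where $a^{\mu\nu}=a^{\nu\mu}$ is Hermitian, parallel and built universally from the metric (see context). Let $\mu_i|\xi|^2$, $i=1,\dots,s$, be the distinct eigenvalues of $A(\xi)$ ($\mu_i>0$ constants), and let $(c_{ik})_{1\le i,k\le s}$ be the inverse of the Vandermonde matrix with $(k,j)$ entry $\mu_j^{k-1}$. The leading order heat kernel and resolvent kernel of $F$, determined by the leading symbol, $$U_0(t|x,y)=\int_{\mathbb R^m}\frac{d\xi}{(2\pi)^m}e^{i\xi\cdot(x-y)}\exp[-tA(\xi)],\qquad G_0(\lambda|x,y)=\int_{\mathbb R^m}\frac{d\xi}{(2\pi)^m}e^{i\xi\cdot(x-y)}[A(\xi)-\lambda\,\mathrm{id}_{\mathcal V}]^{-1},$$ are given by $$\begin{aligned}U_0(t|x,y)&=\sum_{1\le i,k\le s}(4\pi t\mu_i)^{-m/2}c_{ik}\,a^{(\mu_1\mu_2}\cdots a^{\mu_{2k-3}\mu_{2k-2})}(-t\mu_i)^{k-1}\,\partial_{\mu_1}\cdots\partial_{\mu_{2k-2}}\Phi_{k-1}\!\left(-\frac{|x-y|^2}{4t\mu_i}\right)\\&=\sum_{1\le i,k\le s}(4\pi t\mu_i)^{-m/2}\,c_{ik}\,(t\mu_iF_0)^{k-1}\,\Phi_{k-1}\!\left(-\frac{|x-y|^2}{4t\mu_i}\right),\end{aligned}$$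 $$G_0(\lambda|x,y)=\sum_{1\le i,k\le s}(4\pi\mu_i)^{-m/2}\,c_{ik}\,(\mu_iF_0)^{k-1}\int_0^\infty dt\,e^{t\lambda}\,t^{-m/2+k-1}\,\Phi_{k-1}\!\left(-\frac{|x-y|^2}{4t\mu_i}\right),$$ where $F_0=-a^{\mu\nu}\partial_\mu\partial_\nu$ and, for integers $n\ge0$, $$\Phi_n(z)=\sum_{k=n}^\infty\frac{\Gamma(m/2-n+k)}{\Gamma(m/2+k)\,k!}\,z^k .$$
   Context: A tensor-spinor bundle is a Hermitian vector bundle associated to a finite-dimensional representation of $\mathrm O(m)$, $\mathrm{SO}(m)$, $\mathrm{Spin}(m)$ or $\mathrm{Pin}(m)$, with the canonical connection $\nabla$ built from the Levi-Civita connection. The coefficient $a$ is a section of $TM\otimes TM\otimes\mathrm{End}(\mathcal V)$ built polynomially by tensor products and contractions from the metric, its inverse, and (where available) the volume form and the fundamental tensor-spinor $\gamma^\mu$; then $\nabla a=0$ and the eigenvalues of $A(\xi)$ have the stated form. $q$ is a smooth Hermitian endomorphism. The formulas are local: one works in normal coordinates about a fixed point, with $g_{\mu\nu}=\delta_{\mu\nu}$ there and $a^{\mu\nu}$ evaluated at that point; $\xi\cdot(x-y)=\xi_\mu(x^\mu-y^\mu)$, $|\cdot|$ is the Euclidean norm, $d\xi$ is Lebesgue measure, $\partial_\mu$ acts on $x$, repeated indices are summed, and parentheses denote total symmetrization of the enclosed indices. $U_0$ ($t>0$) and $G_0$ ($\mathrm{Re}\,\lambda$ negative) are the leading order terms of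 the heat kernel (kernel of $\exp(-tF)$) as $t\to0$ and of the resolvent kernel (kernel of $(F-\lambda)^{-1}$) as $\lambda\to-\infty$, near the diagonal; heat kernel and resolvent are related by the Laplace transform $G(\lambda)=\int_0^\infty dt\,e^{t\lambda}U(t)$.
   Formalization: G_0's Fourier integral, not absolutely convergent for m≥2, is read as a limit of Gaussian-damped integrals, with x≠y if m≥2. For m≥4, k≥2 the printed t-integral diverges at t=0, so (μ_i F_0)^{k-1} is applied to the integral from δ to ∞ and then δ→0. *)

(* Defs.v *)
(* MathComp-Analysis; the complex numbers are [R[i]] over [R : realType]. *)

(* The leading-order kernels of F = - a^{mu nu} nabla_mu nabla_nu + q depend only on
   the leading symbol at the base point, so everything is written in normal
   coordinates there: g_{mu nu} = delta_{mu nu}, the points x, y are in R^m and the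
   fibre is C^N. *)

From HB Require Import structures.
From mathcomp Require Import all_boot all_order all_algebra all_fingroup.
From mathcomp Require Import complex.
From mathcomp Require Import all_classical all_reals all_analysis.

Set Implicit Arguments.
Unset Strict Implicit.
Unset Printing Implicit Defensive.

Import Order.TTheory GRing.Theory Num.Theory numFieldNormedType.Exports.

Local Open Scope classical_set_scope.
Local Open Scope ring_scope.
Local Open Scope complex_scope.

Section tuple_measure.
Context d (T : measurableType d) (R : realType).

Definition cons_tuple n (z : T * n.-tuple T) : n.+1.-tuple T :=
  [tuple of z.1 :: z.2].

Definition uncons_tuple n (p : n.+1.-tuple T) : T * n.-tuple T :=
  (thead p, [tuple of behead p]).

Lemma measurable_cons_tuple n : measurable_fun setT (@cons_tuple n).
Proof. by apply: measurable_cons. Qed.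

Lemma measurable_uncons_tuple n : measurable_fun setT (@uncons_tuple n).
Proof.
apply/measurable_fun_pairP; split; first exact: measurable_tnth.
exact: measurable_behead.
Qed.

Section step.
Variables (n : nat) (mu : {sigma_finite_measure set T -> \bar R}).
Variable nu : {sigma_finite_measure set (n.-tuple T) -> \bar R}.

Definition cons_measure (A : set (n.+1.-tuple T)) : \bar R :=
  pushforward (mu \x nu)%E (@cons_tuple n) A.

HB.instance Definition _ := Measure.copy cons_measure
  (measure_function_pushforward__canonical__measure_function_Measure
    (mu \x nu)%E (@measurable_cons_tuple n)).

Lemma cons_measure_sigma_finite : sigma_finite setT cons_measure.
Proof.
have /sigma_finiteP[F [FT ndF Ffin]] := sigma_finiteT mu.
have /sigma_finiteP[G [GT ndG Gfin]] := sigma_finiteT nu.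
exists (fun i => @uncons_tuple n @^-1` (F i `*` G i)).
  rewrite -preimage_bigcup -[LHS](preimage_setT (@uncons_tuple n)).
  congr (_ @^-1` _); rewrite -setXTT FT GT predeqE => -[x y]; split.
    move=> [/= [i _ Fix] [k _ Gky]]; exists (maxn i k) => //; split.
    - by move: x Fix; exact/subsetPset/ndF/leq_maxl.
    - by move: y Gky; exact/subsetPset/ndG/leq_maxr.
  by move=> [i _ []/= Fix Giy]; split; exists i.
move=> i; have [mF ltF] := Ffin i; have [mG ltG] := Gfin i; split.
  rewrite -[X in measurable X]setTI; apply: measurable_uncons_tuple => //.
  exact: measurableX.
rewrite /cons_measure /pushforward -comp_preimage.
suff -> : @uncons_tuple n \o @cons_tuple n = id.
  by rewrite preimage_id product_measure1E// lte_mul_pinfty// ge0_fin_numE.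
apply/funext => -[x p]; rewrite /uncons_tuple /cons_tuple /=.
by congr pair; apply/val_inj.
Qed.

HB.instance Definition _ := Measure_isSigmaFinite.Build _ _ _ cons_measure
  cons_measure_sigma_finite.

End step.

(* The n-fold product of [mu] on [n.-tuple T], which the library only equips with
   the product sigma-algebra: a point mass for n = 0, and for n.+1 the image of
   [mu \x (n-fold product)] under (x, p) |-> x :: p. *)
Fixpoint tuple_measure (mu : {sigma_finite_measure set T -> \bar R}) (n : nat) :
    {sigma_finite_measure set (n.-tuple T) -> \bar R} :=
  if n is k.+1 then cons_measure mu (tuple_measure mu k) else \d_ ([tuple]).

End tuple_measure.

Section kernels.
Variable R : realType.
Local Notation C := R[i].
Local Notation Re := (@complex.Re R).
Local Notation Im := (@complex.Im R).

Definition lebesgue_Rn (n : nat) :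
    {sigma_finite_measure set (n.-tuple (measurableTypeR R)) -> \bar R} :=
  tuple_measure (@lebesgue_measure R) n.

Definition vec_of_tuple n (p : n.-tuple (measurableTypeR R)) : 'rV[R]_n :=
  \row_j tnth p j.

Definition dotr n (u v : 'rV[R]_n) : R := \sum_j u 0 j * v 0 j.

(* |z|^2 for the Euclidean norm; the library's norm on 'rV is the sup norm. *)
Definition sqnorm n (z : 'rV[R]_n) : R := dotr z z.

Definition cexp (z : C) : C :=
  (expR (Re z))%:C * (cos (Im z) +i* sin (Im z)).

Definition cintegral d (T : measurableType d)
    (mu : {measure set T -> \bar R}) (D : set T) (f : T -> C) : C :=
  (\int[mu]_(x in D) Re (f x)) +i* (\int[mu]_(x in D) Im (f x)).

Section matrix_valued.
Variable N : nat.
Implicit Types (M : 'M[C]_N).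

(* Convergence in 'M[C]_N, i.e. of the real and imaginary parts of the entries. *)
Definition mx_cvg (T : Type) (F : set_system T) (f : T -> 'M[C]_N) (L : 'M[C]_N) :
    Prop :=
  forall i j, (Re (f x i j) @[x --> F] --> Re (L i j)) /\
              (Im (f x i j) @[x --> F] --> Im (L i j)).

Definition mx_integral d (T : measurableType d)
    (mu : {measure set T -> \bar R}) (D : set T) (f : T -> 'M[C]_N) : 'M[C]_N :=
  \matrix_(i, j) cintegral mu D (fun x => f x i j).

Definition mx_exp_partial M (n : nat) : 'M[C]_N :=
  \sum_(0 <= k < n) (k`!%:R)^-1 *: M ^+ k.

Definition mx_exp M : 'M[C]_N :=
  \matrix_(i, j) (limn (fun n => Re (mx_exp_partial M n i j)) +i*
                  limn (fun n => Im (mx_exp_partial M n i j))).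

End matrix_valued.

Section local.
Variables m N : nat.
(* The components a^{mu nu} at the base point, in normal coordinates and in an
   orthonormal frame of the Hermitian fibre. *)
Variable a : 'I_m -> 'I_m -> 'M[C]_N.

(* A(xi) = a^{mu nu} xi_mu xi_nu *)
Definition symbol (xi : 'rV[R]_m) : 'M[C]_N :=
  \sum_mu \sum_nu (xi 0 mu * xi 0 nu)%:C *: a mu nu.

Definition plane_wave (xi z : 'rV[R]_m) : C :=
  cexp ('i * (dotr xi z)%:C) / ((2 * pi) ^+ m)%:C.

Definition heat_kernel0 (t : R) (x y : 'rV[R]_m) : 'M[C]_N :=
  mx_integral (lebesgue_Rn m) setT (fun p =>
    let xi := vec_of_tuple p in
    plane_wave xi (x - y) *: mx_exp (- t%:C *: symbol xi)).

Definition resolvent0_damped (lam : C) (x y : 'rV[R]_m) (eps : R) : 'M[C]_N :=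
  mx_integral (lebesgue_Rn m) setT (fun p =>
    let xi := vec_of_tuple p in
    (plane_wave xi (x - y) * (expR (- (eps * sqnorm xi)))%:C) *:
      invmx (symbol xi - lam%:M)).

(* G_0(lam|x,y) is an oscillatory integral: [A(xi) - lam]^{-1} only decays like
   |xi|^{-2}, so the integral over R^m is absolutely convergent only for m = 1.
   Its value is the limit of the integrals damped by exp(-eps |xi|^2). *)
Definition is_resolvent_kernel0 (lam : C) (x y : 'rV[R]_m) (G : 'M[C]_N) : Prop :=
  mx_cvg 0^'+ (resolvent0_damped lam x y) G.

Definition partial (mu : 'I_m) (f : 'rV[R]_m -> R) : 'rV[R]_m -> R :=
  fun x => 'D_(delta_mx 0 mu) f x.

(* d_{mu_1} ... d_{mu_n} f for s = [:: mu_1; ...; mu_n] *)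
Definition partials (s : seq 'I_m) (f : 'rV[R]_m -> R) : 'rV[R]_m -> R :=
  foldr partial f s.

Definition mx_partial (mu : 'I_m) (f : 'rV[R]_m -> 'M[C]_N) :
    'rV[R]_m -> 'M[C]_N :=
  fun x => \matrix_(i, j) (partial mu (fun x => Re (f x i j)) x +i*
                           partial mu (fun x => Im (f x i j)) x).

(* F_0 = - a^{mu nu} d_mu d_nu *)
Definition F0 (f : 'rV[R]_m -> 'M[C]_N) : 'rV[R]_m -> 'M[C]_N :=
  fun x => - \sum_mu \sum_nu a mu nu *m mx_partial mu (mx_partial nu f) x.

Definition even_slot n (j : 'I_n) : 'I_n.*2.
Proof. by exists j.*2; rewrite ltn_double. Defined.

Definition odd_slot n (j : 'I_n) : 'I_n.*2.
Proof. by exists j.*2.+1; rewrite ltn_Sdouble. Defined.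

(* a^{(mu_1 mu_2} ... a^{mu_{2n-1} mu_{2n})}; the slots are numbered from 0. *)
Definition sym_prod n (J : {ffun 'I_n.*2 -> 'I_m}) : 'M[C]_N :=
  ((n.*2)`!%:R)^-1 *: \sum_(sigma : 'S_(n.*2))
    \prod_(j < n) a (J (sigma (even_slot j))) (J (sigma (odd_slot j))).

(* a^{(mu_1 mu_2} ... a^{mu_{2n-1} mu_{2n})} d_{mu_1} ... d_{mu_{2n}} f *)
Definition sym_contract n (f : 'rV[R]_m -> R) (x : 'rV[R]_m) : 'M[C]_N :=
  \sum_(J : {ffun 'I_n.*2 -> 'I_m})
    (partials [seq J l | l <- enum 'I_n.*2] f x)%:C *: sym_prod J.

End local.

Definition Gamma (x : R) : R :=
  \int[lebesgue_measure]_(t in `]0, +oo[) (t `^ (x - 1) * expR (- t)).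

Definition Phi (m n : nat) (z : R) : R :=
  limn (fun K => \sum_(n <= k < K)
    Gamma (m%:R / 2 - n%:R + k%:R) / (Gamma (m%:R / 2 + k%:R) * k`!%:R) * z ^+ k).

(* x |-> Phi_n(-|x-y|^2 / (4 tau)) *)
Definition profile m (n : nat) (tau : R) (y x : 'rV[R]_m) : R :=
  Phi m n (- (sqnorm (x - y) / (4 * tau))).

(* x |-> int_delta^oo dt e^{t lam} t^{-m/2+n} Phi_n(-|x-y|^2 / (4 t mu)) *)
Definition laplace_profile m (n : nat) (mu : R) (lam : C) (y : 'rV[R]_m)
    (delta : R) (x : 'rV[R]_m) : C :=
  cintegral (@lebesgue_measure R) `]delta, +oo[ (fun t =>
    cexp (t%:C * lam) *
    (t `^ (- (m%:R / 2) + n%:R) * profile n (t * mu) y x)%:C).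

(* (mu F_0)^n int_delta^oo dt e^{t lam} t^{-m/2+n} Phi_n(-|x-y|^2 / (4 t mu)) *)
Definition F0_laplace m N (a : 'I_m -> 'I_m -> 'M[C]_N) (n : nat) (mu : R)
    (lam : C) (y x : 'rV[R]_m) (delta : R) : 'M[C]_N :=
  iter n (fun f z => mu%:C *: F0 a f z)
    (fun z => (laplace_profile n mu lam y delta z)%:M) x.

(* L is the value of (mu F_0)^n int_0^oo dt e^{t lam} t^{-m/2+n} Phi_n.
   For m >= 4 and n >= 1 the integral itself diverges at t = 0, since Phi_n(z) has
   size |z|^(n-1) as z -> -oo; the divergent terms are polynomials of degree < 2n
   in x, which F_0^n annihilates.  The integral is therefore improper at t = 0,
   with the limit taken after F_0^n.  When it does converge (m <= 3 or n = 0), L is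
   moreover F_0^n applied to the integral over the whole half-line. *)
Definition is_F0_laplace m N (a : 'I_m -> 'I_m -> 'M[C]_N) (n : nat) (mu : R)
    (lam : C) (y x : 'rV[R]_m) (L : 'M[C]_N) : Prop :=
  mx_cvg 0^'+ (F0_laplace a n mu lam y x) L /\
  ((m <= 3)%N || (n == 0%N) -> F0_laplace a n mu lam y x 0 = L).

(* Positive definiteness of a Hermitian endomorphism of C^N. *)
Definition posdefmx N (M : 'M[C]_N) : Prop :=
  forall v : 'cV[C]_N, v != 0 -> 0 < ((map_mx Num.conj v)^T *m M *m v) 0 0.

End kernels.

(* Main.v *)
(* A(xi) has the eigenvalues mu_i |xi|^2, so its spectral projections are the sums over k of
   c_ik A(xi)^(k-1) / |xi|^(2k-2).  Hence exp(-tA) and (A - lam)^-1 are combinations of words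
   xi_J |xi|^(-2n), |J| = 2n, times radial functions, and both kernels reduce to integrals of
   xi_J cos(xi.z) |xi|^(-2n) e^(-t|xi|^2).  Such an integral is a 2n-fold derivative in z of
   the integral of r_2n(xi.z) |xi|^(-2n) e^(-t|xi|^2), where r_2n is, up to sign, the cosine
   minus a Taylor polynomial of degree < 2n; by Gaussian moments the latter is a constant times
   t^(n-m/2) Phi_n(-|z|^2/4t).

   For the resolvent one integrates over t.  By Fubini the integral damped by e^(-eps|xi|^2)
   equals, up to the factors e^(-lam eps/mu_i), the same formula with the Laplace integrals cut
   at t = eps/mu_i.  The cut is removed by dominated convergence: away from the diagonal the
   integrand is O(t^(-1/2)) as t -> 0, because without |xi|^(-2n) it is a derivative of a
   Gaussian, and |xi|^(-2n) is restored by n integrations over ]t, +oo[. *)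

Require Import Defs.
From mathcomp Require Import all_boot all_order all_algebra all_fingroup.
From mathcomp Require Import complex.
From mathcomp Require Import all_classical all_reals all_analysis.
From mathcomp Require Import measurable_realfun spectral.
From mathcomp Require Import ring lra.

Set Implicit Arguments.
Unset Strict Implicit.
Unset Printing Implicit Defensive.

Import Order.TTheory GRing.Theory Num.Theory numFieldNormedType.Exports.

Local Open Scope classical_set_scope.
Local Open Scope ring_scope.

(** * Trigonometric remainders and improper integrals *)

(** The obstacle is the factor |xi|^(-2n): it is not integrable at 0 once 2n >= m, so the potentials
    whose derivatives are wanted cannot be built with a plain cosine. Integrands are therefore kept
    in the form xi_J r_q(xi.z) |xi|^(-2n) e^(-t|xi|^2) with |J| + q = 2n. As |r_q(u)| <= |u|^q, they
    are bounded by a constant depending on z times the Gaussian, in every dimension, and each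
    derivative in z moves one unit from q to J. The polynomial removed from the cosine is why Phi_n
    starts at k = n. The price is growth: for q >= 2 the remainder is as large as its polynomial,
    and its integral over t is controlled near t = 0 only for m <= 3. The resolvent formulas are
    therefore differentiated with the cut in place, and the limit is taken when q = 0. Matrices
    never meet analysis. Powers of A(xi), symmetrized contractions and iterates of F_0 are all sums
    over the same words in the non-commuting a^{mu nu}, with scalar coefficients indexed by J, so
    that only these scalars have to be compared. *)

Section real_derivatives.
Context {R : realType}.
Implicit Types (f : R -> R) (x d : R).

Lemma is_derive_derivable f x d : is_derive x 1 f d -> derivable f x 1.
Proof. by case. Qed.

Lemma is_derive_derive1 f x d : is_derive x 1 f d -> derive1 f x = d.
Proof. by move=> [_ <-]; rewrite derive1E. Qed.

Lemma is_derive_continuous f x d : is_derive x 1 f d -> {for x, continuous f}.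
Proof.
by move=> /is_derive_derivable/derivable1_diffP; exact: differentiable_continuous.
Qed.

End real_derivatives.

Section trigonometric_remainders.
Context {R : realType}.
Implicit Types (u : R) (n : nat).

Lemma normr_cos u : `|cos u| <= 1.
Proof. by rewrite ler_norml cos_geN1 cos_le1. Qed.

Lemma normr_sin u : `|sin u| <= 1.
Proof. by rewrite ler_norml sin_geN1 sin_le1. Qed.

(* Up to sign, cosine and sine minus a Taylor polynomial; with these signs [trem n] is
   the derivative of [trem n.+1]. *)
Fixpoint trem n u : R :=
  match n with
  | 0 => cos u
  | 1 => sin u
  | (k.+1).+1 => u ^+ k / k`!%:R - trem k u
  end.

Arguments trem n u : simpl never.

Lemma tremSS n u : trem n.+2 u = u ^+ n / n`!%:R - trem n u.
Proof. by []. Qed.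

Lemma is_derive_monomial n u :
  is_derive u 1 (fun v : R => v ^+ n.+1 / n.+1`!%:R) (u ^+ n / n`!%:R).
Proof.
have H : is_derive u 1 (fun v : R => v ^+ n.+1 / n.+1`!%:R)
    ((n.+1`!%:R)^-1 * (n.+1%:R * u ^+ n)).
  rewrite (_ : (fun v : R => _) = (n.+1`!%:R)^-1 \*: (id ^+ n.+1 : R -> R)).
    by apply: is_derive_eq; rewrite /= /GRing.scale/= mulr1.
  by apply/funext => v; rewrite /= /GRing.scale/= mulrC !fctE.
apply: (is_derive_eq H).
rewrite factS natrM invfM -mulrA mulrCA mulrA (mulrC _ (u ^+ n)).
by rewrite mulrACA (mulrC _ (u ^+ n)) mulVf ?pnatr_eq0// mulr1.
Qed.

Lemma is_derive_trem n u : is_derive u 1 (trem n.+1) (trem n u).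
Proof.
(* The recursion of [trem] descends by two, so the induction carries two consecutive indices. *)
suff [] : is_derive u 1 (trem n.+1) (trem n u) /\
  is_derive u 1 (trem n.+2) (trem n.+1 u) by [].
elim: n => [|n [IH0 IH]]; split.
- exact: is_derive_sin.
- rewrite (_ : trem 2 = cst 1 - cos); last first.
    by apply/funext => v; rewrite tremSS expr0 fact0 invr1 mulr1 !fctE.
  by apply: is_derive_eq; rewrite sub0r opprK.
- exact: IH.
- have H := is_derive_monomial n u.
  rewrite (_ : trem n.+3 = (fun v : R => v ^+ n.+1 / n.+1`!%:R) - trem n.+1)//; exact: is_derive_eq.
Qed.

Lemma trem0 n : trem n.+1 0 = 0.
Proof.
suff [] : trem n.+1 0 = 0 /\ trem n.+2 0 = 0 by [].
elim: n => [|n [IH1 IH2]]; split => //.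
- exact: sin0.
- by rewrite tremSS expr0 fact0 invr1 mulr1 [trem 0 0]cos0 subrr.
- by rewrite tremSS expr0n/= mul0r sub0r IH1 oppr0.
Qed.

Lemma tremN n u : trem n (- u) = (-1) ^+ n * trem n u.
Proof.
suff [] : trem n (- u) = (-1) ^+ n * trem n u /\
  trem n.+1 (- u) = (-1) ^+ n.+1 * trem n.+1 u by [].
elim: n => [|n [IH1 IH2]]; split => //.
- by rewrite expr0 mul1r [LHS]cosN.
- by rewrite expr1 mulN1r [LHS]sinN.
- by rewrite !tremSS IH1 (exprNn u) !exprS !mulN1r opprK mulrBr mulrA.
Qed.

Lemma derivable_trem n u : derivable (trem n) u 1.
Proof.
case: n => [|n]; first exact: derivable_cos.
by have := is_derive_trem n u; move=> [].
Qed.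

Lemma continuous_trem n : continuous (trem n).
Proof.
by move=> u; apply/differentiable_continuous/derivable1_diffP/derivable_trem.
Qed.

Lemma measurable_trem n : measurable_fun setT (trem n).
Proof. apply: continuous_measurable_fun; exact: continuous_trem. Qed.

(** By parity u >= 0 suffices. There the derivative of v^(n+1)/(n+1)! -+ [trem n.+1 v] is
    nonnegative by the bound for n, and the function vanishes at 0; the two signs give the absolute
    value. *)
Lemma trem_le_fact n u : `|trem n u| <= `|u| ^+ n / n`!%:R.
Proof.
suff P (v : R) : 0 <= v -> `|trem n v| <= v ^+ n / n`!%:R.
  have [u0|u0] := leP 0 u; first by rewrite (ger0_norm u0); exact: P.
  rewrite -[u in trem n u]opprK tremN normrM normrX normrN1 expr1n mul1r.
  by rewrite (ltr0_norm u0); apply: P; rewrite oppr_ge0 ltW.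
elim: n v => [|n IH] /= v v0.
  by rewrite expr0 fact0 invr1 mulr1 ler_norml cos_geN1 cos_le1.
have H (e : R) : `|e| = 1 -> e * trem n.+1 v <= v ^+ n.+1 / n.+1`!%:R.
  move=> e1; rewrite -subr_ge0.
  pose f (v : R) : R := v ^+ n.+1 / n.+1`!%:R - e * trem n.+1 v.
  have df (x : R) : is_derive x 1 f (x ^+ n / n`!%:R - e * trem n x).
    have ? := is_derive_monomial n x; have ? := is_derive_trem n x.
    rewrite (_ : f = (fun v : R => v ^+ n.+1 / n.+1`!%:R) - e \*: (trem n.+1))//.
    exact: is_derive_eq.
  have f0 : f 0 = 0.
    by rewrite -[LHS]/(0 ^+ n.+1 / n.+1`!%:R - e * trem n.+1 0) trem0 expr0n/= mul0r mulr0 subrr.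
  suff : f 0 <= f v by rewrite f0.
  apply: (@ger0_derive1_ndecr _ f 0 v) => //.
  - move=> x /[!in_itv]/= /andP[x0 _]; rewrite (is_derive_derive1 (df x)) subr_ge0.
    rewrite (le_trans (ler_norm _))// normrM e1 mul1r IH// ltW//.
  - by apply: derivable_within_continuous => x _; exact: (is_derive_derivable (df x)).
rewrite ler_norml lerNl -mulN1r H ?normrN1//=.
by rewrite -[leLHS]mul1r H ?normr1.
Qed.

Lemma trem_le n u : `|trem n u| <= `|u| ^+ n.
Proof.
apply: (le_trans (trem_le_fact n u)); rewrite ler_piMr ?exprn_ge0//.
by rewrite invf_le1 ?ltr0n ?fact_gt0// ler1n fact_gt0.
Qed.

(** One step of the recursion is undone: at infinity the remainder is only as large as its Taylor
    polynomial, two degrees less than what [trem_le] gives. These two degrees decide the range m <=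
    3 near t = 0. *)
Lemma trem_le2 n u : `|trem n.+2 u| <= 2 * `|u| ^+ n.
Proof.
rewrite tremSS (le_trans (ler_normB _ _))// mulr_natl mulr2n lerD ?trem_le//.
rewrite normrM normrX normfV (ger0_norm (ler0n _ _)) ler_piMr ?exprn_ge0//.
by rewrite invf_le1 ?ltr0n ?fact_gt0// ler1n fact_gt0.
Qed.

End trigonometric_remainders.

Section improper_integrals.
Context {R : realType}.
Local Notation mu := (@lebesgue_measure R).

(** The fundamental theorem is applied on the closed half-lines starting at a + 1/(n+1), and
    monotone convergence lets n grow; [f] may thus be unbounded at [a]. *)
Lemma ge0_FTC2_oy (f F : R -> R) (a l c : R) :
  (forall x, a < x -> 0 <= f x) ->
  (forall x, a < x -> {for x, continuous f}) ->
  (forall x, a < x -> is_derive x 1 F (f x)) ->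
  F x @[x --> a^'+] --> c -> F x @[x --> +oo] --> l ->
  (\int[mu]_(x in `]a, +oo[) (f x)%:E = (l - c)%:E)%E.
Proof.
move=> f0 cf dF Fc Fl.
pose A n : set R := `[a + n.+1%:R^-1, +oo[%classic.
have an n : a < a + n.+1%:R^-1 by rewrite ltrDl invr_gt0.
have UA : `]a, +oo[%classic = \bigcup_n A n.
  apply/seteqP; split => [x|x [n _]] /=; rewrite /A/= !in_itv/= !andbT.
    move=> ax; have xa : 0 < x - a by rewrite subr_gt0.
    exists (Num.truncn (x - a)^-1) => //=; rewrite in_itv/= andbT.
    rewrite -lerBrDl invf_ple ?posrE// ltW// truncnS_gt//.
  by apply: lt_le_trans.
rewrite UA.
have IA n : (\int[mu]_(x in A n) (f x)%:E = (l - F (a + n.+1%:R^-1))%:E)%E.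
  rewrite EFinB; apply: ge0_continuous_FTC2y => //.
  - by move=> x ax; apply/f0/lt_le_trans/ax.
  - apply/continuous_within_itvcyP; split.
      by move=> x ax; apply: cf; rewrite (lt_trans (an n))//; move: ax; rewrite in_itv/= andbT.
    by apply: cvg_at_right_filter; exact: cf.
  - by move=> x ax; have [] := dF x (lt_trans (an n) ax).
  - apply: cvg_at_right_filter; apply: differentiable_continuous.
    by apply/derivable1_diffP; have [] := dF _ (an n).
  - move=> x; rewrite in_itv/= andbT => ax.
    by rewrite derive1E; have [_ ->] := dF x (lt_trans (an n) ax).
have mf : measurable_fun `]a, +oo[ f.
  apply: open_continuous_measurable_fun => //.
  by move=> x; rewrite inE/= in_itv/= andbT; exact: cf.
have : (\int[mu]_(x in A i) (f x)%:E @[i --> \oo] -->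
    \int[mu]_(x in \bigcup_i A i) (f x)%:E)%E.
  apply: ge0_nondecreasing_set_cvg_integral.
  - move=> n k nk; apply/subsetPset => x; rewrite /A/= !in_itv/= !andbT.
    by apply: le_trans; rewrite lerD2l lef_pV2 ?posrE ?ler_nat.
  - by move=> n; exact: measurable_itv.
  - move=> n; apply/measurable_EFinP; apply: measurable_funS mf => //.
    by rewrite UA; exact: bigcup_sup.
  - move=> n x; rewrite /A/= in_itv/= andbT => ax; rewrite lee_fin.
    exact/f0/lt_le_trans/ax.
under eq_fun do rewrite IA.
move=> /cvg_unique; apply => //.
apply: cvg_EFin; first exact: nearW.
apply: cvgB; first exact: cvg_cst.
move/cvg_at_rightP : Fc; apply; split => //.
rewrite -[X in _ --> X]addr0; apply: cvgD; first exact: cvg_cst.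
by have := @cvg_harmonic R.
Qed.

(* The comparison function [h] replaces an integrability hypothesis on [f]. *)
Lemma dominated_FTC2_oy (f F h H : R -> R) (a l c l' c' : R) :
  (forall x, a < x -> `|f x| <= h x) ->
  (forall x, a < x -> {for x, continuous f}) ->
  (forall x, a < x -> {for x, continuous h}) ->
  (forall x, a < x -> is_derive x 1 F (f x)) ->
  (forall x, a < x -> is_derive x 1 H (h x)) ->
  F x @[x --> a^'+] --> c -> F x @[x --> +oo] --> l ->
  H x @[x --> a^'+] --> c' -> H x @[x --> +oo] --> l' ->
  mu.-integrable `]a, +oo[ (EFin \o f) /\
  \int[mu]_(x in `]a, +oo[) f x = l - c.
Proof.
move=> fh cf ch dF dH Fc Fl Hc Hl.
have h0 x : a < x -> 0 <= h x by move=> ax; apply/le_trans/fh.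
have Ih := ge0_FTC2_oy h0 ch dH Hc Hl.
(* Both [h] and [f + h] are nonnegative, since |f| <= h, and have known primitives; [f] is their
   difference. *)
have Ifh : (\int[mu]_(x in `]a, +oo[) (f x + h x)%:E = (l + l' - (c + c'))%:E)%E.
  apply: (@ge0_FTC2_oy _ (F \+ H)).
  - by move=> x ax; have := fh _ ax; rewrite ler_norml lerNl -subr_ge0 opprK addrC => /andP[].
  - by move=> x ax; apply: cvgD; [exact: cf|exact: ch].
  - by move=> x ax; have ? := dF _ ax; have ? := dH _ ax; exact: is_deriveD.
  - exact: cvgD.
  - exact: cvgD.
have mE (g : R -> R) : (forall x, a < x -> {for x, continuous g}) ->
    measurable_fun `]a, +oo[ g.
  move=> cg; apply: open_continuous_measurable_fun => //.
  by move=> x; rewrite inE/= in_itv/= andbT; exact: cg.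
have iE (g : R -> R) I : (forall x, a < x -> {for x, continuous g}) ->
    (forall x, a < x -> 0 <= g x) ->
    (\int[mu]_(x in `]a, +oo[) (g x)%:E = I%:E)%E ->
    mu.-integrable `]a, +oo[ (EFin \o g).
  move=> cg g0 Ig; apply/integrableP; split; first by apply/measurable_EFinP; exact: mE.
  rewrite (_ : integral _ _ _ = I%:E) ?ltry// -Ig; apply: eq_integral => x.
  by rewrite inE/= in_itv/= andbT => ax; rewrite /= ger0_norm// g0.
have ih := iE _ _ ch h0 Ih.
have ifh : mu.-integrable `]a, +oo[ (EFin \o (f \+ h)).
  apply: iE Ifh.
  - by move=> x ax; apply: cvgD; [exact: cf|exact: ch].
  - by move=> x ax; have := fh _ ax; rewrite ler_norml lerNl -subr_ge0 opprK addrC => /andP[].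
have fE : f = (f \+ h) \- h by apply/funext => x; rewrite /= addrK.
split.
  rewrite fE; have -> : (EFin \o ((f \+ h) \- h) = fun x => ((EFin \o (f \+ h)%R) x - (EFin \o h) x)%E) by [].
  exact: integrableB.
rewrite fE RintegralB//= {1}/Rintegral Ifh /= /Rintegral Ih/=.
ring.
Qed.

End improper_integrals.

(** * The Gamma function and exponential bounds *)

Section exponential_bounds.
Context {R : realType}.
Local Notation mu := (@lebesgue_measure R).
Implicit Types (x t c p : R).

Lemma powRN_cvgy x : 0 < x -> t `^ (- x) @[t --> +oo] --> (0 : R).
Proof.
move=> x0; apply/cvgrPdist_lt => e e0.
near=> t.
have t0 : 0 < t by near: t; exact: nbhs_pinfty_gt.
rewrite sub0r normrN ger0_norm ?powR_ge0// powRN.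
rewrite invf_plt ?posrE ?powR_gt0//.
have -> : e^-1 = (e^-1 `^ x^-1) `^ x by rewrite -powRrM mulVf ?gt_eqF// powRr1// invr_ge0 ltW.
apply: gt0_ltr_powR; rewrite ?nnegrE ?powR_ge0 ?(ltW t0)//.
Unshelve. all: end_near. Qed.

Lemma expR_ge_monomial n x : 0 <= x -> x ^+ n / n`!%:R <= expR x.
Proof.
move=> x0; case: n => [|n]; last by apply: le_trans (expR_ge1Dxn n x0); rewrite lerDr.
by rewrite expr0 fact0 invr1 mulr1 -expR0 ler_expR.
Qed.

Lemma powR_expR_bounded c p : 0 < c ->
  exists2 C : R, 0 < C & forall t, 0 <= t -> (1 + t) `^ p * expR (- (c * t)) <= C.
Proof.
move=> c0; pose n := (Num.truncn p).+1.
(* The constant comes from (c(1+t))^n / n! <= e^(c(1+t)), where the integer n exceeds p. *)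
exists (n`!%:R * expR c / c ^+ n) => [|t t0].
  by rewrite !mulr_gt0 ?invr_gt0 ?exprn_gt0 ?expR_gt0// ltr0n fact_gt0.
have t1 : 1 <= 1 + t by rewrite lerDl.
have tn : (1 + t) `^ p <= (1 + t) ^+ n.
  rewrite -powR_mulrn ?(le_trans ler01)//; apply: ler_powR => //.
  exact/ltW/truncnS_gt.
have E := @expR_ge_monomial n (c * (1 + t)) (mulr_ge0 (ltW c0) (le_trans ler01 t1)).
apply: (@le_trans _ _ ((1 + t) ^+ n * expR (- (c * t)))).
  by rewrite ler_wpM2r ?expR_ge0.
rewrite ler_pdivlMr ?exprn_gt0// mulrAC -[leLHS]mulrC mulrC.
rewrite expRN ler_pdivrMr ?expR_gt0// -mulrA -expRD.
rewrite -ler_pdivrMl ?ltr0n ?fact_gt0//.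
have -> : c + c * t = c * (1 + t) by rewrite mulrDr mulr1.
by apply: le_trans E; rewrite exprMn mulrC (mulrC (c ^+ n)).
Qed.

(** The Gamma integrand has no elementary primitive, but t^(x-1)/(1+t^x)^2 has one, behaves like
    t^(x-1) at 0 and is integrable over the half-line for every x > 0. *)
Lemma gamma_comparison x : 0 < x ->
  [/\ forall t, 0 < t -> {for t, continuous (fun t => t `^ (x - 1) / (1 + t `^ x) ^+ 2)},
   forall t, 0 < t -> is_derive t 1 (fun t => - (x^-1 / (1 + t `^ x)))
     (t `^ (x - 1) / (1 + t `^ x) ^+ 2),
   (- (x^-1 / (1 + t `^ x))) @[t --> 0^'+] --> - x^-1 &
   (- (x^-1 / (1 + t `^ x))) @[t --> +oo] --> (0 : R)].
Proof.
move=> x0.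
have p1 t : 0 < 1 + t `^ x by rewrite ltr_pwDl// powR_ge0.
have dp t y : 0 < t -> is_derive t 1 (fun t : R => t `^ y) (y * t `^ (y - 1)).
  exact: is_derive1_powR.
have cp t y : 0 < t -> {for t, continuous (fun t : R => t `^ y)}.
  by move=> t0; exact: (is_derive_continuous (dp t y t0)).
split.
- move=> t t0; apply: cvgM; first exact: cp.
  apply: cvgV; first by rewrite expf_neq0// gt_eqF.
  rewrite expr2; under eq_fun do rewrite expr2.
  by apply: cvgM; (apply: cvgD; [exact: cvg_cst|exact: cp]).
- move=> t t0; have D := dp t x t0.
  have D1 : is_derive t 1 (fun t : R => 1 + t `^ x) (x * t `^ (x - 1)).
    rewrite (_ : (fun t => _) = cst 1 + (fun t : R => t `^ x))//.
    by apply: is_derive_eq; rewrite add0r.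
  have D2 : is_derive t 1 (fun t : R => (1 + t `^ x)^-1)
     (- (1 + t `^ x) ^- 2 *: (x * t `^ (x - 1))).
    by apply: is_deriveV; rewrite gt_eqF.
  rewrite (_ : (fun t => _) = (- x^-1) \*: (fun t : R => (1 + t `^ x)^-1)); last first.
    by apply/funext => u; rewrite /= /GRing.scale/= mulNr.
  apply: (is_derive_eq (is_deriveZ (- x^-1) D2)).
  rewrite /GRing.scale/= mulrA mulrNN mulrACA mulVf ?gt_eqF// mul1r.
  by rewrite mulrC.
- apply: cvgN; rewrite -[X in _ --> X]mulr1; apply: cvgM; first exact: cvg_cst.
  rewrite -[X in _ --> X]invr1; apply: cvgV; first by rewrite oner_eq0.
  rewrite -[X in _ --> X]addr0; apply: cvgD; first exact: cvg_cst.
  exact: powR_cvg0.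
- rewrite -[X in _ --> X]oppr0; apply: cvgN.
  rewrite -[X in _ --> X](mulr0 x^-1); apply: cvgM; first exact: cvg_cst.
  apply: (@squeeze_cvgr _ _ _ _ (cst 0) (fun t : R => t `^ (- x))).
  - near=> t.
    have t0 : 0 < t by near: t; exact: nbhs_pinfty_gt.
    by rewrite invr_ge0 (ltW (p1 _))/= powRN lef_pV2 ?posrE ?powR_gt0 ?lerDr.
  - exact: cvg_cst.
  - exact: powRN_cvgy.
Unshelve. all: end_near. Qed.

(** The spare factor 1 + t lets one comparison function dominate both t^(x-1) e^(-ct) and t^x
    e^(-ct), which occur together in the derivative of t^x e^(-t). *)
Lemma gamma_le_comparison c x : 0 < c -> 0 < x -> exists2 C : R, 0 < C &
  forall t, 0 < t -> (1 + t) * (t `^ (x - 1) * expR (- (c * t))) <=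
    C * (t `^ (x - 1) / (1 + t `^ x) ^+ 2).
Proof.
move=> c0 x0; have [C C0 hC] := powR_expR_bounded (x * 2 + 1) c0.
exists (4 * C) => [|t t0]; first by rewrite mulr_gt0.
have p1 : 0 < 1 + t `^ x by rewrite ltr_pwDl// powR_ge0.
have t1 : 0 < 1 + t by rewrite addr_gt0.
rewrite mulrCA (mulrC (4 * C)) -mulrA ler_wpM2l ?powR_ge0//.
rewrite mulrC ler_pdivlMr ?exprn_gt0//.
have H : (1 + t `^ x) ^+ 2 <= 4 * (1 + t) `^ (x * 2).
  have -> : 4 * (1 + t) `^ (x * 2) = (2 * (1 + t) `^ x) ^+ 2.
    by rewrite powRrM powR_mulrn ?powR_ge0// exprMn -natrX.
  rewrite lerXn2r ?nnegrE ?(ltW p1) ?mulr_ge0 ?powR_ge0// mulr_natl mulr2n lerD//.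
    by rewrite -[leLHS](powRr0 (1 + t)); apply: ler_powR; rewrite ?lerDl ?ltW.
  by apply: ge0_ler_powR; rewrite ?nnegrE ?ltW// ltrDr.
apply: le_trans (_ : expR (- (c * t)) * (1 + t) * (4 * (1 + t) `^ (x * 2)) <= _).
  by rewrite (mulrC (1 + t)) ler_wpM2l// mulr_ge0 ?expR_ge0 ?ltW.
have -> : expR (- (c * t)) * (1 + t) * (4 * (1 + t) `^ (x * 2)) =
  4 * ((1 + t) `^ (x * 2 + 1) * expR (- (c * t))).
  rewrite powRD ?powRr1 ?(ltW t1)//; first ring.
  by apply/implyP => _; rewrite gt_eqF.
by rewrite ler_pM2l// hC// ltW.
Qed.

Lemma continuous_gamma c x t : 0 < t ->
  {for t, continuous (fun t => t `^ (x - 1) * expR (- (c * t)))}.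
Proof.
move=> t0; apply: cvgM.
  exact: (is_derive_continuous (is_derive1_powR (x - 1) t0)).
apply: (@cvg_comp _ _ _ (fun t => - (c * t)) expR); last exact: continuous_expR.
by apply: cvgN; apply: cvgM; [exact: cvg_cst|exact: cvg_id].
Qed.

Lemma measurable_gamma c x : measurable_fun setT (fun t : R => t `^ (x - 1) * expR (- (c * t))).
Proof.
apply: measurable_funM; first exact: measurable_powR.
apply: measurableT_comp => //; apply: measurableT_comp => //; exact: mulrl_measurable.
Qed.

Lemma integrable_gamma c x : 0 < c -> 0 < x ->
  mu.-integrable `]0, +oo[ (EFin \o (fun t => t `^ (x - 1) * expR (- (c * t)))).
Proof.
move=> c0 x0; have [ch dH H0 Hy] := gamma_comparison x0.
have [C C0 hC] := gamma_le_comparison c0 x0.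
have h0 t : 0 < t -> 0 <= t `^ (x - 1) / (1 + t `^ x) ^+ 2.
  by move=> t0; rewrite mulr_ge0 ?powR_ge0// invr_ge0 exprn_ge0// addr_ge0 ?powR_ge0.
have I := ge0_FTC2_oy h0 ch dH H0 Hy.
have J : mu.-integrable `]0, +oo[
    (fun t => (C%:E * (t `^ (x - 1) / (1 + t `^ x) ^+ 2)%:E)%E).
  apply: integrableZl => //; apply/integrableP; split.
    apply/measurable_EFinP; apply: open_continuous_measurable_fun => //.
    by move=> t; rewrite inE/= in_itv/= andbT => t0; exact: ch.
  rewrite (_ : integral _ _ _ = (0 - - x^-1)%:E) ?ltry// -I; apply: eq_integral => t.
  by rewrite inE/= in_itv/= andbT => t0; rewrite /= ger0_norm// h0.
apply: le_integrable J => //.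
  by apply/measurable_EFinP/measurable_funTS; exact: measurable_gamma.
move=> t; rewrite /= in_itv/= andbT => t0; rewrite lee_fin.
have g0 : 0 <= t `^ (x - 1) * expR (- (c * t)) by rewrite mulr_ge0 ?powR_ge0 ?expR_ge0.
rewrite (ger0_norm g0) ger0_norm; last by rewrite mulr_ge0 ?h0 ?ltW.
by apply: le_trans (hC t t0); rewrite ler_peMl// lerDl ltW.
Qed.

(** Integration by parts for Gamma: the integrand is the derivative of t^x e^(-t), which tends to 0
    at both ends. *)
Lemma integral_gamma_derivative x : 0 < x ->
  \int[mu]_(t in `]0, +oo[) (x * (t `^ (x - 1) * expR (- (1 * t))) -
    t `^ (x + 1 - 1) * expR (- (1 * t))) = 0.
Proof.
move=> x0; have [ch dH H0 Hy] := gamma_comparison x0.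
have [C C0 hC] := gamma_le_comparison ltr01 x0.
pose g t : R := t `^ (x - 1) * expR (- (1 * t)).
pose g1 t : R := t `^ (x + 1 - 1) * expR (- (1 * t)).
have tx t : 0 < t -> t `^ x = t * t `^ (x - 1).
  move=> t0; rewrite -{2}(powRr1 (ltW t0)) -powRD ?(gt_eqF t0) ?implybT//.
  by rewrite addrCA subrr addr0.
have [D0 D0p hD] := powR_expR_bounded (x + 1) (@ltr01 R).
(* The integrand is (x - t) t^(x-1) e^(-t), and |x - t| <= (x + 1)(1 + t). *)
pose K : R := (x + 1) * C.
have K0 : 0 <= K by rewrite mulr_ge0 ?addr_ge0 ?ltW.
rewrite -[RHS](subrr 0).
apply: (proj2 (@dominated_FTC2_oy _ _ (fun t => t `^ x * expR (- t))
   (fun t => K * (t `^ (x - 1) / (1 + t `^ x) ^+ 2))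
   (fun t => K * - (x^-1 / (1 + t `^ x))) 0 0 0 (K * 0) (K * - x^-1) _ _ _ _ _ _ _ _ _)).
- move=> t t0; rewrite /g /g1 addrK {1}(tx _ t0).
  rewrite -(mulrA t) -/(g t) -mulrBl normrM.
  have gt0 : 0 <= g t by rewrite mulr_ge0 ?powR_ge0 ?expR_ge0.
  rewrite (ger0_norm gt0) /K -mulrA.
  apply: (@le_trans _ _ ((x + 1) * ((1 + t) * g t))).
    rewrite [leRHS]mulrA; apply: ler_wpM2r => //.
    rewrite (le_trans (ler_normB _ _))// !ger0_norm ?ltW//; nra.
  by rewrite ler_pM2l ?addr_gt0// hC.
- move=> t t0; apply: cvgB; last exact: continuous_gamma.
  by apply: cvgM; [exact: cvg_cst|exact: continuous_gamma].
- by move=> t t0; apply: cvgM; [exact: cvg_cst|exact: ch].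
- move=> t t0; have D := is_derive1_powR x t0.
  have Dn : is_derive t 1 (fun t : R => expR (- t)) (expR (- t) * -1).
    have D3 := is_derive_expR (- t).
    exact: (@is_derive1_comp _ expR -%R).
  rewrite (_ : (fun t => _) = (fun t : R => t `^ x) * (fun t : R => expR (- t)))//.
  apply: is_derive_eq; rewrite /GRing.scale/= /g /g1 addrK mul1r; ring.
- move=> t t0; have D := dH t t0.
  rewrite (_ : (fun t => _) = K \*: (fun t : R => - (x^-1 / (1 + t `^ x))))//.
  exact: is_deriveZ.
- apply: (@squeeze_cvgr _ _ _ _ (cst 0) (fun t : R => t `^ x)).
  + near=> t; rewrite mulr_ge0 ?powR_ge0 ?expR_ge0//= ler_piMr ?powR_ge0//.
    by rewrite -expR0 ler_expR oppr_le0; near: t; exact: nbhs_right_ge.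
  + exact: cvg_cst.
  + exact: powR_cvg0.
- apply: (@squeeze_cvgr _ _ _ _ (cst 0) (fun t : R => D0 * t `^ (-1))).
  + near=> t.
    have t0 : 0 < t by near: t; exact: nbhs_pinfty_gt.
    rewrite mulr_ge0 ?powR_ge0 ?expR_ge0//= powRN (powRr1 (ltW t0)).
    rewrite ler_pdivlMr//; apply: le_trans (hD t (ltW t0)).
    rewrite mul1r mulrAC ler_wpM2r ?expR_ge0//.
    rewrite powRD; last by apply/implyP => _; rewrite gt_eqF ?addr_gt0.
    rewrite powRr1 ?addr_ge0 ?(ltW t0)// ler_pM ?powR_ge0 ?(ltW t0) ?lerDr//.
    by apply: ge0_ler_powR; rewrite ?nnegrE ?addr_ge0 ?lerDr// ?(ltW x0) ?(ltW t0).
  + exact: cvg_cst.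
  + rewrite -[X in _ --> X](mulr0 D0); apply: cvgM; first exact: cvg_cst.
    exact: powRN_cvgy.
- by apply: cvgM; [exact: cvg_cst|exact: H0].
- by apply: cvgM; [exact: cvg_cst|exact: Hy].
Unshelve. all: end_near. Qed.

Lemma GammaS x : 0 < x -> Gamma (x + 1) = x * Gamma x.
Proof.
move=> x0.
have ig := integrable_gamma ltr01 x0.
have ig1 := integrable_gamma ltr01 (addr_gt0 x0 ltr01).
have := integral_gamma_derivative x0.
rewrite RintegralB//=; last exact: (integrableZl _ x ig).
rewrite RintegralZl// => /eqP; rewrite subr_eq0 => /eqP E.
transitivity (\int[mu]_(t in `]0, +oo[) (t `^ (x + 1 - 1) * expR (- (1 * t)))).
  by apply: eq_Rintegral => t _; rewrite mul1r.
by rewrite -E; congr (_ * _); apply: eq_Rintegral => t _; rewrite mul1r.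
Qed.

Lemma Gamma_gt0 x : 0 < x -> 0 < Gamma x.
Proof.
move=> x0.
have ig : mu.-integrable `]0, +oo[ (EFin \o (fun t => t `^ (x - 1) * expR (- t))).
  by have := integrable_gamma ltr01 x0; congr (_.-integrable _ _); apply/funext => t /=; rewrite mul1r.
have h0 t : 0 <= t `^ (x - 1) * expR (- t) by rewrite mulr_ge0 ?powR_ge0 ?expR_ge0.
rewrite lt_neqAle Rintegral_ge0 ?andbT; last by move=> t _.
apply/eqP => E.
(* A lower bound of the integrand on [1, 2]; the minimum covers both signs of x - 1. *)
pose c : R := Num.min (1 `^ (x - 1)) (2 `^ (x - 1)) * expR (- 2).
have c0 : 0 < c by rewrite mulr_gt0 ?expR_gt0// lt_min !powR_gt0.
suff : c <= Gamma x by rewrite -E leNgt c0.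
have -> : c = \int[mu]_(t in `[1, 2]) c.
  rewrite Rintegral_cst//= lebesgue_measure_itv/= lte_fin ltr1n/=.
  by rewrite (_ : 2 - 1 = 1 :> R) ?mulr1//; ring.
apply: (@le_trans _ _ (\int[mu]_(t in `[1, 2]) (t `^ (x - 1) * expR (- t)))).
  apply: le_Rintegral => //.
  - apply/integrableP; split; first exact/measurable_EFinP.
    rewrite /= integral_cst//= lebesgue_measure_itv/= lte_fin ltr1n/=.
    by rewrite -EFinD -EFinM ltry.
  - apply: integrableS ig => //; apply: subset_itv; rewrite bnd_simp//.
  - move=> t; rewrite /= in_itv/= => /andP[t1 t2].
    apply: ler_pM; rewrite ?le_min ?powR_ge0 ?expR_ge0//; last by rewrite ler_expR lerN2.
    have [x1|x1] := leP 1 x.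
      rewrite ge_min; apply/orP; left.
      apply: ge0_ler_powR; rewrite ?nnegrE ?subr_ge0// (le_trans ler01)//.
    rewrite ge_min; apply/orP; right.
    rewrite -(opprB 1 x) !powRN lef_pV2 ?posrE ?powR_gt0//; last exact: lt_le_trans t1.
    apply: ge0_ler_powR => //; rewrite ?nnegrE ?subr_ge0//; first exact: ltW.
    exact: le_trans t1.
rewrite /Rintegral fine_le//.
- apply: integrable_fin_num => //; apply: integrableS ig => //; apply: subset_itv; rewrite bnd_simp//.
- exact: integrable_fin_num.
apply: ge0_subset_integral => //.
- by apply/measurable_EFinP; have /integrableP[/measurable_EFinP] := ig.
- by move=> t _; rewrite lee_fin.
- by apply: subset_itv; rewrite bnd_simp//.
Qed.

Lemma integral_powR_tail p t : 1 < p -> 0 < t ->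
  (\int[mu]_(s in `]t, +oo[) (s `^ (- p))%:E = (t `^ (1 - p) / (p - 1))%:E)%E.
Proof.
move=> p1 t0.
have p0 : 0 < p - 1 by rewrite subr_gt0.
have D (s : R) : 0 < s -> is_derive s 1 (fun s : R => - (s `^ (- (p - 1)) / (p - 1))) (s `^ (- p)).
  move=> s0; have D := is_derive1_powR (- (p - 1)) s0.
  rewrite (_ : (fun s => _) = (- (p - 1)^-1) \*: (fun s : R => s `^ (- (p - 1)))); last first.
    by apply/funext => u; rewrite /= /GRing.scale/= mulrC mulNr.
  apply: is_derive_eq; rewrite /GRing.scale/= mulrA mulrNN mulVf ?gt_eqF// mul1r.
  by congr (_ `^ _); ring.
have -> : t `^ (1 - p) / (p - 1) = 0 - (- (t `^ (- (p - 1)) / (p - 1))).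
  by rewrite sub0r opprK opprB.
apply: (@ge0_FTC2_oy _ _ (fun s => - (s `^ (- (p - 1)) / (p - 1)))).
- by move=> s _; exact: powR_ge0.
- move=> s ts; have s0 := lt_trans t0 ts.
  exact: (is_derive_continuous (is_derive1_powR (- p) s0)).
- by move=> s ts; apply: D; exact: lt_trans ts.
- apply: cvg_at_right_filter; exact: (is_derive_continuous (D t t0)).
- rewrite -[X in _ --> X]oppr0; apply: cvgN.
  rewrite -[X in _ --> X](mul0r (p - 1)^-1); apply: cvgM; last exact: cvg_cst.
  exact: powRN_cvgy.
Qed.

End exponential_bounds.

(** * Gaussian integrals *)

Section integration_on_tuples.
Context {R : realType}.
Local Notation mu := (@lebesgue_measure R).
Local Notation E n := (n.-tuple (measurableTypeR R)).
Local Notation consT := (@Defs.cons_tuple _ (measurableTypeR R) _).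

Lemma ge0_integral_Rn0 (f : E 0 -> \bar R) :
  measurable_fun setT f ->
  (\int[lebesgue_Rn R 0]_p f p = f [tuple])%E.
Proof. by move=> mf; rewrite integral_dirac// diracT mul1e. Qed.

Lemma ge0_integral_RnS n (f : E n.+1 -> \bar R) :
  measurable_fun setT f -> (forall p, 0 <= f p)%E ->
  (\int[lebesgue_Rn R n.+1]_p f p =
   \int[mu]_x \int[lebesgue_Rn R n]_p f (consT (x, p)))%E.
Proof.
move=> mf f0.
transitivity (\int[pushforward (mu \x lebesgue_Rn R n)
  (@Defs.cons_tuple _ (measurableTypeR R) n)]_p f p)%E; first by [].
rewrite ge0_integral_pushforward//; last exact: measurable_cons_tuple.
rewrite preimage_setT fubini_tonelli1//; last by move=> z; exact: f0.
by apply: measurableT_comp => //; exact: measurable_cons_tuple.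
Qed.

Definition tuple_opp n (p : E n) : E n := [tuple of map -%R p].

Lemma tnth_tuple_opp n (p : E n) j : tnth (tuple_opp p) j = - tnth p j.
Proof. by rewrite tnth_map. Qed.

Lemma tuple_opp_cons n x (p : E n) :
  tuple_opp (consT (x, p)) = consT (- x, tuple_opp p).
Proof. exact/val_inj. Qed.

Lemma measurable_oppR : measurable_fun setT (-%R : measurableTypeR R -> measurableTypeR R).
Proof. exact: oppr_measurable. Qed.

Lemma measurable_tuple_opp n : measurable_fun setT (@tuple_opp n).
Proof.
apply/measurable_fun_tnthP => i.
rewrite (_ : _ \o _ = -%R \o (fun p : E n => tnth p i)); last first.
  by apply/funext => p /=; rewrite tnth_map.
by apply: measurableT_comp; [exact: measurable_oppR|exact: measurable_tnth].
Qed.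

Lemma ge0_integral_opp (f : measurableTypeR R -> \bar R) :
  measurable_fun setT f -> (forall x, 0 <= f x)%E ->
  (\int[mu]_x f (- (x : R))%R = \int[mu]_x f x)%E.
Proof.
move=> mf f0.
transitivity (\int[pushforward mu (-%R : measurableTypeR R -> measurableTypeR R)]_x f x)%E.
  by rewrite ge0_integral_pushforward//; exact: measurable_oppR.
apply: eq_measure_integral => A mA _; exact: lebesgue_measureN.
Qed.

Lemma ge0_integral_tuple_opp n (f : E n -> \bar R) :
  measurable_fun setT f -> (forall p, 0 <= f p)%E ->
  (\int[lebesgue_Rn R n]_p f (tuple_opp p) = \int[lebesgue_Rn R n]_p f p)%E.
Proof.
elim: n f => [|n IH] f mf f0.
  rewrite !ge0_integral_Rn0//; first by congr f; exact/val_inj.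
  by apply: measurableT_comp => //; exact: measurable_tuple_opp.
have mc (x : measurableTypeR R) : measurable_fun setT (fun p : E n => f (consT (x, p))).
  apply: measurableT_comp => //; apply: (measurableT_comp (@measurable_cons_tuple _ _ n)).
  exact: pair1_measurable.
rewrite (ge0_integral_RnS mf f0) ge0_integral_RnS; last first.
  by move=> p; exact: f0.
  by apply: (measurableT_comp mf); exact: measurable_tuple_opp.
under eq_integral => x _.
  under eq_integral do rewrite tuple_opp_cons.
  rewrite (IH (fun q => f (consT ((- (x : R))%R, q)))) //; over.
apply: (ge0_integral_opp (f := fun x => (\int[lebesgue_Rn R n]_p f (consT (x, p)))%E)).
  apply: (@measurable_fun_fubini_tonelli_F _ _ _ _ _ (lebesgue_Rn R n) (fun z => f (consT z))) => //.
  by apply: measurableT_comp => //; exact: measurable_cons_tuple.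
by move=> x; exact: integral_ge0.
Qed.

(** Reflection exchanges the positive and negative parts, whose integrals therefore agree; if they
    are infinite, [fine] sends their difference to 0 as well. *)
Lemma Rintegral_odd n (f : E n -> R) :
  measurable_fun setT f -> (forall p, f (tuple_opp p) = - f p) ->
  \int[lebesgue_Rn R n]_p f p = 0.
Proof.
move=> mf of_.
have mF : measurable_fun setT (EFin \o f) by exact/measurable_EFinP.
have H : (\int[lebesgue_Rn R n]_p ((EFin \o f)^\+ p) =
          \int[lebesgue_Rn R n]_p ((EFin \o f)^\- p))%E.
  rewrite -ge0_integral_tuple_opp//; last exact: measurable_funepos.
  by apply: eq_integral => p _; rewrite funeposE funenegE /= of_ EFinN.
rewrite /Rintegral integralE H.
by case: (integral _ _ _) => [r| |]//=; rewrite subrr.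
Qed.

Definition dott n (w : 'rV[R]_n) (p : E n) : R := dotr (vec_of_tuple p) w.
Definition sqt n (p : E n) : R := sqnorm (vec_of_tuple p).

Lemma sqnorm_ge0 n (w : 'rV[R]_n) : 0 <= sqnorm w.
Proof. by apply: sumr_ge0 => j _; rewrite -expr2 sqr_ge0. Qed.

Lemma sqnorm_eq0 n (w : 'rV[R]_n) : (sqnorm w == 0) = (w == 0).
Proof.
apply/eqP/eqP => [w0|->]; last by rewrite /sqnorm /dotr big1// => j _; rewrite mxE mulr0.
apply/rowP => j; rewrite mxE; apply/eqP; rewrite -[_ == 0]sqrf_eq0 expr2.
move/eqP: w0; rewrite psumr_eq0; last by move=> i _; rewrite -expr2 sqr_ge0.
by move=> /allP/(_ j); rewrite mem_index_enum => /(_ isT).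
Qed.

Lemma dottE n (w : 'rV[R]_n) (p : E n) : dott w p = \sum_j tnth p j * w 0 j.
Proof. by apply: eq_bigr => j _; rewrite mxE. Qed.

Lemma sqtE n (p : E n) : sqt p = \sum_j tnth p j ^+ 2.
Proof. by apply: eq_bigr => j _; rewrite mxE expr2. Qed.

Lemma measurable_tnthR n j : measurable_fun setT (fun p : E n => tnth p j : R).
Proof. exact: measurable_tnth. Qed.

Lemma measurable_dott n (w : 'rV[R]_n) : measurable_fun setT (dott w).
Proof.
rewrite (_ : dott w = fun p => \sum_j tnth p j * w 0 j); last first.
  by apply/funext => p; exact: dottE.
apply: measurable_sum => j; apply: measurable_funM => //; exact: measurable_tnthR.
Qed.

Lemma measurable_sqt n : measurable_fun setT (@sqt n).
Proof.
rewrite (_ : @sqt n = fun p => \sum_j tnth p j ^+ 2); last first.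
  by apply/funext => p; exact: sqtE.
apply: measurable_sum => j; apply: measurable_funX; exact: measurable_tnthR.
Qed.

Lemma sqt_ge0 n (p : E n) : 0 <= sqt p.
Proof. by rewrite sqtE sumr_ge0// => j _; exact: sqr_ge0. Qed.

Lemma tnth_cons_tuple n x (p : E n) :
  (tnth (consT (x, p)) ord0 = x) * (forall j, tnth (consT (x, p)) (lift ord0 j) = tnth p j).
Proof. by split=> [|j]; rewrite /Defs.cons_tuple; [rewrite tnth0|rewrite tnthS]. Qed.

Lemma dott_cons n x (p : E n) (w : 'rV[R]_n.+1) :
  dott w (consT (x, p)) = x * w 0 0 + dott (\row_j w 0 (lift ord0 j)) p.
Proof.
rewrite !dottE big_ord_recl tnth_cons_tuple; congr (_ + _).
by apply: eq_bigr => j _; rewrite tnth_cons_tuple mxE.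
Qed.

Lemma sqt_cons n x (p : E n) : sqt (consT (x, p)) = x ^+ 2 + sqt p.
Proof.
rewrite !sqtE big_ord_recl tnth_cons_tuple; congr (_ + _).
by apply: eq_bigr => j _; rewrite tnth_cons_tuple.
Qed.

Lemma dott_opp n (w : 'rV[R]_n) p : dott w (tuple_opp p) = - dott w p.
Proof.
by rewrite !dottE -sumrN; apply: eq_bigr => j _; rewrite tnth_tuple_opp mulNr.
Qed.

Lemma sqt_opp n (p : E n) : sqt (tuple_opp p) = sqt p.
Proof. by rewrite !sqtE; apply: eq_bigr => j _; rewrite tnth_tuple_opp sqrrN. Qed.

Lemma integral_gauss1 (s w : R) : 0 < s ->
  (\int[mu]_x (expR (x * w - s * x ^+ 2))%:E =
   (Num.sqrt (pi / s) * expR (w ^+ 2 / (4 * s)))%:E)%E.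
Proof.
(* Completing the square: up to a constant factor the integrand is the normal density of mean w/(2s)
   and variance 1/(2s). *)
move=> s0; pose sig := Num.sqrt ((2 * s)^-1).
have s2 : 0 < (2 * s)^-1 by rewrite invr_gt0 mulr_gt0.
have sig2 : sig ^+ 2 = (2 * s)^-1 by rewrite sqr_sqrtr// ltW.
have sig0 : sig != 0 by rewrite gt_eqF// sqrtr_gt0.
have nE x : normal_pdf (w / (2 * s)) sig x = normal_peak sig * normal_fun (w / (2 * s)) sig x.
  by rewrite normal_pdfE.
have K0 : 0 <= normal_peak sig * expR (- (w ^+ 2 / (4 * s))).
  by rewrite mulr_ge0 ?normal_peak_ge0 ?expR_ge0.
have : (\int[mu]_x (expR (x * w - s * x ^+ 2))%:E *
    (normal_peak sig * expR (- (w ^+ 2 / (4 * s))))%:E = 1)%E.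
  rewrite -ge0_integralZr//; last first.
    apply/measurable_EFinP; apply: measurableT_comp => //; apply: measurable_funB.
      first [exact: mulrr_measurable|exact: mulrl_measurable].
    by apply: measurable_funM => //; exact: measurable_funX.
  rewrite -(integral_normal_pdf (w / (2 * s)) sig); apply: eq_integral => x _.
  rewrite nE /normal_fun sig2.
  rewrite (_ : - (x - w / (2 * s)) ^+ 2 / ((2 * s)^-1 *+ 2) =
     (x * w - s * x ^+ 2) - w ^+ 2 / (4 * s)); last first.
    by rewrite -mulr_natl; field; rewrite gt_eqF.
  by rewrite -EFinM (expRD (_ - _)) mulrCA.
rewrite /normal_peak sig2.
have -> : (2 * s)^-1 * pi *+ 2 = pi / s by rewrite -mulr_natl; field; rewrite gt_eqF.
have q0 : 0 < Num.sqrt (pi / s) by rewrite sqrtr_gt0 divr_gt0// pi_gt0.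
(* Infinite values are excluded because the product with a positive constant is 1. *)
case: (integral _ _ _) => [r| |] /=.
- rewrite -EFinM => -[] H; congr (_%:E); move: H => H.
  rewrite -[RHS]mul1r -[X in X * _]H expRN mulrA -[RHS]mulrA.
  by field; rewrite !gt_eqF ?expR_gt0.
- by rewrite gt0_mulye// lte_fin mulr_gt0 ?invr_gt0 ?expR_gt0.
- by rewrite gt0_mulNye// lte_fin mulr_gt0 ?invr_gt0 ?expR_gt0.
Qed.

Lemma integral_gauss n (s : R) (w : 'rV[R]_n) : 0 < s ->
  (\int[lebesgue_Rn R n]_p (expR (dott w p - s * sqt p))%:E =
   ((pi / s) `^ (n%:R / 2) * expR (sqnorm w / (4 * s)))%:E)%E.
Proof.
move=> s0; have ps0 : 0 < pi / s by rewrite divr_gt0 ?pi_gt0.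
have mf k (v : 'rV[R]_k) : measurable_fun setT (fun p => (expR (dott v p - s * sqt p))%:E).
  apply/measurable_EFinP; apply: measurableT_comp => //; apply: measurable_funB.
    exact: measurable_dott.
  by apply: measurable_funM => //; exact: measurable_sqt.
elim: n w => [|n IH] w.
  rewrite ge0_integral_Rn0// dottE sqtE /sqnorm /dotr !big_ord0 mulr0 subrr mul0r expR0.
  by rewrite !mul0r powRr0 expR0 mulr1.
rewrite ge0_integral_RnS//.
pose v : 'rV[R]_n := \row_j w 0 (lift ord0 j).
pose c : R := (pi / s) `^ (n%:R / 2) * expR (sqnorm v / (4 * s)).
have c0 : 0 <= c by rewrite mulr_ge0 ?powR_ge0 ?expR_ge0.
transitivity (\int[mu]_x ((expR (x * w 0 0 - s * x ^+ 2))%:E * c%:E))%E.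
  apply: eq_integral => x _.
  transitivity (\int[lebesgue_Rn R n]_p ((expR (x * w 0 0 - s * x ^+ 2))%:E *
      (expR (dott v p - s * sqt p))%:E))%E.
    apply: eq_integral => p _; rewrite -EFinM -expRD dott_cons sqt_cons -/v.
    by congr (expR _)%:E; ring.
  rewrite ge0_integralZl//; do ?[exact: mf|by rewrite lee_fin expR_ge0|by move=> ? _; rewrite lee_fin expR_ge0].
  by congr (_ * _)%E; exact: IH.
rewrite ge0_integralZr//; last first.
  apply/measurable_EFinP; apply: measurableT_comp => //; apply: measurable_funB.
    exact: mulrr_measurable.
  by apply: measurable_funM => //; exact: measurable_funX.
rewrite integral_gauss1// -EFinM; congr (_%:E); rewrite /c.
rewrite mulrACA -expRD; congr (_ * expR _).
  rewrite -powR12_sqrt ?(ltW ps0)// -powRD; last by rewrite gt_eqF ?implybT.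
  by congr (_ `^ _); rewrite -natr1; field.
rewrite -mulrDl; congr (_ * _); rewrite /sqnorm /dotr big_ord_recl -expr2; congr (_ + _).
by apply: eq_bigr => j _; rewrite !mxE.
Qed.

End integration_on_tuples.

(** * Even Gaussian moments by comparison of power series *)

Section power_series.
Context {R : realType}.
Implicit Types (d a : nat -> R) (x v : R).

Lemma geometric_tail v n N : 0 <= v -> v <= 2^-1 ->
  \sum_(n <= j < n + N) v ^+ j <= 2 * v ^+ n.
Proof.
move=> v0 v2; elim: N n => [|N IH] n.
  by rewrite addn0 big_geq// mulr_ge0// exprn_ge0.
rewrite -addSnnS big_ltn; last by rewrite addSn ltnS leq_addr.
apply: le_trans (lerD (lexx _) (IH n.+1)) _.
rewrite exprS; have := exprn_ge0 n v0.
have := ler_wpM2l (ler0n R 2) v2; rewrite mulfV ?pnatr_eq0// => H.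
nra.
Qed.

(** Convergence at v = 1 bounds the coefficients by some K. If the earlier ones vanish, |d_n| v^n is
    at most the tail 2K v^(n+1), and v can be made arbitrarily small. *)
Lemma pseries_uniq d :
  (forall v, 0 <= v <= 1 -> series (fun j => d j * v ^+ j) n @[n --> \oo] --> (0 : R)) ->
  forall n, d n = 0.
Proof.
move=> H.
have [K K0 dK] : exists2 K : R, 0 < K & forall j, `|d j| <= K.
  have /cvgP/cvg_series_cvg_0 : series d n @[n --> \oo] --> (0 : R).
    have := H 1; rewrite ler01 lexx => /(_ isT).
    by rewrite (_ : (fun j => d j * 1 ^+ j) = d)//; apply/funext => j; rewrite expr1n mulr1.
  move=> /cvgP/cvg_seq_bounded [K [_ KP]].
  exists (`|K| + 1) => [|j]; first by rewrite ltr_pwDr.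
  by apply: KP => //; rewrite ltr_pwDr// ler_norm.
elim/ltn_ind => n IH.
apply/eqP; rewrite -normr_eq0 eq_le normr_ge0 andbT.
suff S v : 0 < v -> v <= 2^-1 -> `|d n| <= 2 * K * v.
  apply/ler_addgt0Pl => e e0; rewrite addr0.
  have m0 : 0 < Num.min 2^-1 (e / (2 * K)).
    by rewrite lt_min invr_gt0 ltr0n/= divr_gt0// mulr_gt0.
  apply: (le_trans (S _ m0 _)); first by rewrite ge_min lexx.
  by rewrite mulrC -ler_pdivlMr ?mulr_gt0// ge_min lexx orbT.
move=> v0 v2.
have v1 : v <= 1 by apply: (le_trans v2); rewrite invf_le1// ler1n.
have vn0 : 0 < v ^+ n by rewrite exprn_gt0.
have E N : `|series (fun j => d j * v ^+ j) (n.+1 + N)%N - d n * v ^+ n| <=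
    2 * K * v ^+ n.+1.
  rewrite /series/= (big_cat_nat (n := n.+1))//=; last exact: leq_addr.
  rewrite big_nat_recr//= big_nat big1 ?add0r; last first.
    by move=> j /andP[_ jn]; rewrite IH// mul0r.
  rewrite addrAC subrr add0r (le_trans (ler_norm_sum _ _ _))//.
  apply: (@le_trans _ _ (\sum_(n.+1 <= j < n.+1 + N) K * v ^+ j)).
    apply: ler_sum => j _; rewrite normrM normrX (ger0_norm (ltW v0)).
    by rewrite ler_wpM2r ?exprn_ge0// ltW.
  by rewrite -mulr_sumr -mulrA mulrCA ler_pM2l// geometric_tail// ltW.
suff : `|d n * v ^+ n| <= 2 * K * v ^+ n.+1.
  by rewrite exprS normrM (ger0_norm (ltW vn0)) mulrA ler_pM2r.
apply/ler_addgt0Pl => e e0.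
have /cvgrPdist_le/(_ _ e0)[M _ HM] := H v (introT andP (conj (ltW v0) v1)).
have := HM (n.+1 + M)%N (leq_addl _ _); rewrite /= sub0r normrN => HS.
rewrite -[d n * v ^+ n](subKr (series (fun j => d j * v ^+ j) (n.+1 + M)%N)).
by rewrite (le_trans (ler_normB _ _))// lerD.
Qed.

Lemma series_cosh x :
  series (fun j => x ^+ j.*2 / j.*2`!%:R) n @[n --> \oo] --> (expR x + expR (- x)) / 2.
Proof.
have E N : series (fun j => x ^+ j.*2 / j.*2`!%:R) N =
    (series (exp_coeff x) N.*2 + series (exp_coeff (- x)) N.*2) / 2.
  rewrite /series/=; elim: N => [|N IH]; first by rewrite !big_geq// addr0 mul0r.
  rewrite big_nat_recr//= IH doubleS !big_nat_recr//= /exp_coeff /=.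
  have -> : (- x) ^+ N.*2 = x ^+ N.*2 by rewrite exprNn -mul2n exprM sqrrN expr1n expr1n mul1r.
  have -> : (- x) ^+ N.*2.+1 = - x ^+ N.*2.+1.
    by rewrite exprNn exprS -mul2n exprM sqrrN expr1n expr1n mulr1 mulN1r.
  by rewrite mulNr; field; rewrite ?pnatr_eq0 -?lt0n ?fact_gt0.
under eq_fun do rewrite E.
have D : N.*2 @[N --> \oo] --> \oo.
  move=> A [M _ MA]; exists M => // N /= MN; apply: MA => /=.
  by rewrite (leq_trans MN)// -addnn leq_addr.
have S y : series (exp_coeff y) N.*2 @[N --> \oo] --> expR y.
  apply: (@cvg_comp _ _ _ (fun N => N.*2) (series (exp_coeff y)) _ _ _ D).
  exact: is_cvg_series_exp_coeff.
by apply: cvgM; [apply: cvgD; exact: S|exact: cvg_cst].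
Qed.

Lemma series_nneseries (f : nat -> R) (L : R) : (forall n, 0 <= f n) ->
  (\sum_(n <oo) (f n)%:E = L%:E)%E -> series f n @[n --> \oo] --> L.
Proof.
move=> f0 fL.
have : (\sum_(0 <= i < n) (f i)%:E)%E @[n --> \oo] --> (\sum_(n <oo) (f n)%:E)%E.
  by apply: is_cvg_nneseries => n _ _; rewrite lee_fin.
rewrite fL (_ : (fun n => _) = (fun n => (series f n)%:E)); last first.
  by apply/funext => n; rewrite /series/= sumEFin.
by move=> /fine_cvg; exact.
Qed.

End power_series.

Section gaussian_domination.
Context {R : realType} {m : nat}.
Local Notation mu := (@lebesgue_measure R).
Local Notation E := (m.-tuple (measurableTypeR R)).
Local Notation lam := (lebesgue_Rn R m).

Lemma measurable_gauss (s : R) : measurable_fun setT (fun p : E => expR (- (s * sqt p))).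
Proof.
apply: measurableT_comp => //; apply: measurableT_comp => //.
by apply: measurable_funM => //; exact: measurable_sqt.
Qed.

Lemma integral_gauss0 (s : R) : 0 < s ->
  (\int[lam]_p (expR (- (s * sqt p)))%:E = ((pi / s) `^ (m%:R / 2))%:E)%E.
Proof.
move=> s0; have := @integral_gauss R m s 0 s0.
have -> : sqnorm (0 : 'rV[R]_m) = 0 by rewrite /sqnorm /dotr big1// => j _; rewrite mxE mul0r.
rewrite mul0r expR0 mulr1 => <-; apply: eq_integral => p _.
by rewrite dottE big1 ?sub0r// => j _; rewrite mxE mulr0.
Qed.

Lemma integrable_gauss (s : R) : 0 < s ->
  lam.-integrable setT (EFin \o (fun p => expR (- (s * sqt p)))).
Proof.
move=> s0; apply/integrableP; split; first by apply/measurable_EFinP; exact: measurable_gauss.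
rewrite (_ : integral _ _ _ = ((pi / s) `^ (m%:R / 2))%:E) ?ltry//.
rewrite -integral_gauss0//; apply: eq_integral => p _.
by rewrite /= ger0_norm// expR_ge0.
Qed.

Lemma integrable_gauss_dom (s C : R) k (f : E -> R) : 0 < s -> measurable_fun setT f ->
  (forall p, `|f p| <= C * (sqt p ^+ k * expR (- (s * sqt p)))) ->
  lam.-integrable setT (EFin \o f).
Proof.
move=> s0 mf fC; have s2 : 0 < s / 2 by rewrite divr_gt0.
(* Half of the exponential pays for the polynomial: (s|xi|^2/2)^k / k! <= e^(s|xi|^2/2). *)
pose D := `|C| * (k`!%:R / (s / 2) ^+ k).
have J : lam.-integrable setT (fun p => (D%:E * (EFin \o (fun p => expR (- (s / 2 * sqt p)))) p)%E).
  by apply: integrableZl => //; exact: integrable_gauss.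
apply: le_integrable J => //; first exact/measurable_EFinP.
move=> p _; have G : 0 <= D * expR (- (s / 2 * sqt p)).
  by rewrite mulr_ge0 ?expR_ge0// mulr_ge0// divr_ge0// exprn_ge0// ltW.
rewrite /= lee_fin (ger0_norm G); apply: (le_trans (fC p)); rewrite /D -mulrA.
apply: (@le_trans _ _ (`|C| * (sqt p ^+ k * expR (- (s * sqt p))))).
  by rewrite ler_wpM2r ?ler_norm// mulr_ge0 ?expR_ge0 ?exprn_ge0 ?sqt_ge0.
rewrite ler_wpM2l//.
have -> : - (s * sqt p) = - (s / 2 * sqt p) - s / 2 * sqt p by field.
rewrite expRD mulrCA mulrC ler_wpM2r ?expR_ge0//.
have := expR_ge_monomial k (mulr_ge0 (ltW s2) (sqt_ge0 p)).
rewrite expRN ler_pdivrMr ?expR_gt0// exprMn => H.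
rewrite ler_pdivrMr ?expR_gt0// mulrAC ler_pdivlMr ?exprn_gt0//.
by rewrite mulrC (mulrC _ (expR _)).
Qed.

(** Stands in for the Euclidean norm of [w] in estimates: |xi.w| <= [l1norm w] |xi| follows
    coordinate by coordinate, and constants do not matter. *)
Definition l1norm (w : 'rV[R]_m) : R := \sum_j `|w 0 j|.

Lemma l1norm_ge0 w : 0 <= l1norm w. Proof. exact: sumr_ge0. Qed.

Lemma tnth_le (p : E) j : `|tnth p j| <= Num.sqrt (sqt p).
Proof.
rewrite -sqrtr_sqr ler_wsqrtr// sqtE (bigD1 j)//= lerDl.
by apply: sumr_ge0 => i _; exact: sqr_ge0.
Qed.

Lemma dott_le (w : 'rV[R]_m) (p : E) : `|dott w p| <= l1norm w * Num.sqrt (sqt p).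
Proof.
rewrite dottE (le_trans (ler_norm_sum _ _ _))// /l1norm mulr_suml ler_sum// => j _.
by rewrite normrM mulrC ler_wpM2l// tnth_le.
Qed.

Lemma dottX2_le (w : 'rV[R]_m) (p : E) k :
  `|dott w p| ^+ k.*2 <= l1norm w ^+ k.*2 * sqt p ^+ k.
Proof.
rewrite -[X in _ * X ^+ _](sqr_sqrtr (sqt_ge0 p)) -exprM mul2n -exprMn lerXn2r ?nnegrE ?dott_le//.
by rewrite mulr_ge0 ?l1norm_ge0 ?sqrtr_ge0.
Qed.

(** Generating function: cosh(u xi.w) is the sum of v^k (xi.w)^(2k)/(2k)! with v = u^2. Its terms
    are nonnegative, so sum and integral commute, and completing the square evaluates the integral
    as a constant times e^(v|w|^2/(4s)). Coefficients in v are then compared. *)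
Lemma integral_gauss_moment (s : R) (w : 'rV[R]_m) j : 0 < s ->
  (\int[lam]_p (dott w p ^+ j.*2 * expR (- (s * sqt p)))%:E =
   ((pi / s) `^ (m%:R / 2) * (j.*2`!%:R / j`!%:R * (sqnorm w / (4 * s)) ^+ j))%:E)%E.
Proof.
move=> s0.
have mX k : measurable_fun setT (fun p : E => dott w p ^+ k.*2 * expR (- (s * sqt p))).
  apply: measurable_funM; last exact: measurable_gauss.
  by apply: measurable_funX; exact: measurable_dott.
have X0 k p : 0 <= dott w p ^+ k.*2 by rewrite -mul2n exprM exprn_ge0// sqr_ge0.
have iX k : lam.-integrable setT (EFin \o (fun p => dott w p ^+ k.*2 * expR (- (s * sqt p)))).
  apply: (@integrable_gauss_dom s (l1norm w ^+ k.*2) k) => // p.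
  rewrite normrM normrX (ger0_norm (expR_ge0 _)) mulrA ler_wpM2r ?expR_ge0//.
  exact: dottX2_le.
pose M k : R := \int[lam]_p (dott w p ^+ k.*2 * expR (- (s * sqt p))).
have ME k : (\int[lam]_p (dott w p ^+ k.*2 * expR (- (s * sqt p)))%:E = (M k)%:E)%E.
  by rewrite fineK//; apply: integrable_fin_num => //; exact: iX.
have M0 k : 0 <= M k by apply: Rintegral_ge0 => p _; rewrite mulr_ge0 ?expR_ge0.
pose C : R := (pi / s) `^ (m%:R / 2).
pose c := sqnorm w / (4 * s).
have gen v : 0 <= v <= 1 ->
    series (fun k => M k / k.*2`!%:R * v ^+ k) n @[n --> \oo] --> C * expR (v * c).
  move=> /andP[v0 v1]; pose u := Num.sqrt v.
  have uv k : u ^+ k.*2 = v ^+ k by rewrite -mul2n exprM sqr_sqrtr.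
  apply: series_nneseries => [k|]; first by rewrite !mulr_ge0 ?invr_ge0 ?exprn_ge0.
  transitivity (\sum_(k <oo) \int[lam]_p
      ((u * dott w p) ^+ k.*2 / k.*2`!%:R * expR (- (s * sqt p)))%:E)%E.
    apply: eq_eseriesr => k _.
    have -> : M k / k.*2`!%:R * v ^+ k = (v ^+ k / k.*2`!%:R) * M k by ring.
    rewrite EFinM -ME -ge0_integralZl//; last 3 first.
    - exact/measurable_EFinP.
    - by move=> p _; rewrite lee_fin mulr_ge0 ?expR_ge0.
    - by rewrite lee_fin mulr_ge0 ?invr_ge0 ?exprn_ge0.
    by apply: eq_integral => p _; rewrite -EFinM exprMn uv; congr (_%:E); ring.
  rewrite -integral_nneseries//; last 2 first.
  - move=> k; apply/measurable_EFinP; apply: measurable_funM; last exact: measurable_gauss.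
    apply: measurable_funM => //; apply: measurable_funX; apply: measurable_funM => //.
    exact: measurable_dott.
  - move=> k p _; rewrite lee_fin mulr_ge0 ?expR_ge0// mulr_ge0 ?invr_ge0//.
    by rewrite -mul2n exprM exprn_ge0// sqr_ge0.
  transitivity (\int[lam]_p
     ((expR (dott (u *: w) p - s * sqt p))%:E * (2^-1)%:E +
      (expR (dott (- u *: w) p - s * sqt p))%:E * (2^-1)%:E))%E.
    apply: eq_integral => p _.
    apply/cvg_lim => //.
    rewrite (_ : (fun n => _) = (fun n => (series (fun k => (u * dott w p) ^+ k.*2 / k.*2`!%:R) n *
        expR (- (s * sqt p)))%:E)); last first.
      by apply/funext => n; rewrite sumEFin /series/= mulr_suml.
    apply: cvg_EFin; first exact: nearW.
    have ud (e : R) : dott (e *: w) p = e * dott w p.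
      by rewrite !dottE mulr_sumr; apply: eq_bigr => j' _; rewrite mxE; ring.
    rewrite [X in _ --> X](_ : _ = (expR (u * dott w p) + expR (- (u * dott w p))) / 2 *
        expR (- (s * sqt p))); last first.
      rewrite /= !ud (expRD (u * _)) (expRD (- u * _)) mulNr; ring.
    by apply: cvgM; [exact: series_cosh|exact: cvg_cst].
  have mE (z : 'rV[R]_m) : measurable_fun setT (fun p : E => (expR (dott z p - s * sqt p))%:E).
    apply/measurable_EFinP; apply: measurableT_comp => //; apply: measurable_funB.
      exact: measurable_dott.
    by apply: measurable_funM => //; exact: measurable_sqt.
  have e0 (z : 'rV[R]_m) (p : E) : (0 <= (expR (dott z p - s * sqt p))%:E)%E.
    by rewrite lee_fin expR_ge0.
  have sn (e : R) : e ^+ 2 = v -> sqnorm (e *: w) / (4 * s) = v * c.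
    move=> ev; rewrite /c mulrA; congr (_ / _); rewrite /sqnorm /dotr -ev mulr_sumr.
    by apply: eq_bigr => j' _; rewrite mxE; ring.
  rewrite ge0_integralD//; do ?[by move=> p _; rewrite mule_ge0// lee_fin invr_ge0
    | by apply: emeasurable_funM => //; exact: mE].
  rewrite !ge0_integralZr//; try by rewrite lee_fin invr_ge0.
  rewrite !integral_gauss// !sn ?sqrrN ?sqr_sqrtr//.
  by rewrite -!EFinM -EFinD -/C //; congr (_%:E); field.
have uni := @pseries_uniq _ (fun k => M k / k.*2`!%:R - C * (c ^+ k / k`!%:R)).
rewrite ?ME; congr (_%:E).
have f0 k : (k`!%:R : R) != 0 by rewrite pnatr_eq0 -lt0n fact_gt0.
have H' : M j / j.*2`!%:R = C * (c ^+ j / j`!%:R).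
  apply/eqP; rewrite -subr_eq0; apply/eqP; apply: uni => v v01.
  rewrite (_ : series _ = (fun n => series (fun k => M k / k.*2`!%:R * v ^+ k) n -
      C * series (exp_coeff (v * c)) n)); last first.
    apply/funext => n; rewrite /series/= mulr_sumr -sumrB; apply: eq_bigr => k _.
    have vc : (v * c) ^+ k = v ^+ k * c ^+ k by rewrite exprMn.
    rewrite /exp_coeff/= vc mulrBl; congr (_ - _).
    by rewrite -[LHS]mulrA (mulrC (_ / _) (v ^+ k)) (mulrA (v ^+ k)).
  rewrite -[X in _ --> X](subrr (C * expR (v * c))); apply: cvgB; first exact: gen.
  by apply: cvgM; [exact: cvg_cst|exact: is_cvg_series_exp_coeff].
by rewrite -[LHS](divfK (f0 j.*2)) H' -/C -/c; ring.
Qed.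

End gaussian_domination.

(** * Inverse powers of |xi|^2 by integration over t *)

Section fubini_restricted.
Context {R : realType} {m : nat}.
Local Notation mu := (@lebesgue_measure R).
Local Notation E := (m.-tuple (measurableTypeR R)).
Local Notation lam := (lebesgue_Rn R m).

Lemma measurable_slice1 (d : measure_display) (T : measurableType d)
    (f : measurableTypeR R * E -> T) s :
  measurable_fun setT f -> measurable_fun setT (fun p => f (s, p)).
Proof. by move=> mf; apply: (measurableT_comp mf); exact: pair1_measurable. Qed.

Lemma measurable_slice2 (d : measure_display) (T : measurableType d)
    (f : measurableTypeR R * E -> T) p :
  measurable_fun setT f -> measurable_fun setT (fun s => f (s, p)).
Proof. by move=> mf; apply: (measurableT_comp mf); exact: pair2_measurable. Qed.

Lemma measurable_indic_fst (D : set (measurableTypeR R)) : measurable D ->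
  measurable_fun setT (fun z : measurableTypeR R * E => (\1_D z.1 : R)%:E).
Proof.
move=> mD; apply/measurable_EFinP.
have mI : measurable_fun setT (\1_D : measurableTypeR R -> R) by exact: measurable_indic.
exact: (measurableT_comp mI measurable_fst).
Qed.

Lemma ge0_fubini_restrict (D : set (measurableTypeR R)) (f : measurableTypeR R * E -> \bar R) :
  measurable D -> measurable_fun setT f -> (forall z, 0 <= f z)%E ->
  (\int[lam]_p \int[mu]_(s in D) f (s, p) = \int[mu]_(s in D) \int[lam]_p f (s, p))%E.
Proof.
move=> mD mf f0.
pose g z := (f z * (\1_D z.1)%:E)%E.
have mg : measurable_fun setT g.
  by apply: emeasurable_funM => //; exact: measurable_indic_fst.
have g0 z : (0 <= g z)%E by rewrite mule_ge0// lee_fin.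
transitivity (\int[lam]_p \int[mu]_s g (s, p))%E.
  by apply: eq_integral => p _; rewrite integral_mkcond epatch_indic.
rewrite -(@fubini_tonelli _ _ _ _ _ mu lam g mg g0) [RHS]integral_mkcond epatch_indic.
apply: eq_integral => s _; rewrite /g /= ge0_integralZr//.
exact: measurable_slice1.
Qed.

Lemma fubini_restrict (D : set (measurableTypeR R)) (F : measurableTypeR R * E -> R) :
  measurable D -> measurable_fun setT F ->
  (forall s, D s -> lam.-integrable setT (fun p => (F (s, p))%:E)) ->
  (forall p, mu.-integrable D (fun s => (F (s, p))%:E)) ->
  (\int[lam]_p \int[mu]_(s in D) `|F (s, p)|%:E < +oo)%E ->
  mu.-integrable D (fun s => (\int[lam]_p F (s, p))%:E) /\
  \int[lam]_p (\int[mu]_(s in D) F (s, p)) = \int[mu]_(s in D) (\int[lam]_p F (s, p)).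
Proof.
move=> mD mF i1 i2 fin.
(* The restriction to [D] becomes an indicator factor, so that the integrand lives on the whole
   product. *)
pose g z : \bar R := ((F z)%:E * (\1_D z.1)%:E)%E.
have mg : measurable_fun setT g.
  by apply: emeasurable_funM; [exact/measurable_EFinP|exact: measurable_indic_fst].
have gE s p : g (s, p) = ((fun s => (F (s, p))%:E) \_ D) s by rewrite epatch_indic.
have ig : (mu \x lam)%E.-integrable setT g.
  apply/integrable21ltyP; first exact: mg.
  rewrite (_ : integral _ _ _ = (\int[lam]_p \int[mu]_(s in D) `|F (s, p)|%:E)%E); first exact: fin.
  apply: eq_integral => p _; rewrite [RHS]integral_mkcond; apply: eq_integral => s _.
  by rewrite gE /patch; case: ifPn => //; rewrite abse0.
have gs s : (\int[lam]_p g (s, p) = ((fun s => (\int[lam]_p F (s, p))%:E) \_ D) s)%E.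
  rewrite /patch; case: ifPn => sD.
    rewrite fineK; last by apply: integrable_fin_num => //; apply: i1; rewrite inE in sD.
    by apply: eq_integral => p _; rewrite gE /patch sD.
  by apply: integral0_eq => p _; rewrite gE /patch (negbTE sD).
split.
  have := integrable_fubini_F ig; rewrite /fubini_F => ifu.
  apply/(integrable_mkcond _ mD).
  by apply: eq_integrable ifu => // s _; exact: gs.
have := Fubini ig.
under eq_integral do rewrite gs.
rewrite -integral_mkcond => FE.
rewrite /Rintegral; congr fine; rewrite FE; apply: eq_integral => p _.
rewrite fineK; last exact: integrable_fin_num.
by rewrite [LHS]integral_mkcond; apply: eq_integral => s _; rewrite gE.
Qed.

End fubini_restricted.

Section moments.
Context {R : realType} {m : nat}.
Local Notation mu := (@lebesgue_measure R).
Local Notation E := (m.-tuple (measurableTypeR R)).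
Local Notation lam := (lebesgue_Rn R m).
Hypothesis m_gt0 : (0 < m)%N.

(** For k > 0 the value at the origin is 0, by the convention for the inverse of 0. *)
Definition gw k (t : R) (p : E) : R := sqt p ^- k * expR (- (t * sqt p)).

Lemma gw_ge0 k t p : 0 <= gw k t p.
Proof. by rewrite mulr_ge0 ?expR_ge0 ?invr_ge0 ?exprn_ge0 ?sqt_ge0. Qed.

Lemma measurable_sqtX k : measurable_fun setT (fun p : E => sqt p ^- k).
Proof.
rewrite (_ : (fun p => _) = (fun p => sqt p `^ (- k%:R))).
  apply: (@measurableT_comp _ _ _ _ _ _ (fun x : R => x `^ (- k%:R))).
    exact: measurable_powR.
  exact: measurable_sqt.
by apply/funext => p; rewrite powRN powR_mulrn// sqt_ge0.
Qed.

Lemma measurable_gw k t : measurable_fun setT (gw k t).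
Proof. by apply: measurable_funM; [exact: measurable_sqtX|exact: measurable_gauss]. Qed.

Lemma measurable_gw2 k : measurable_fun setT (fun z : measurableTypeR R * E => gw k z.1 z.2).
Proof.
apply: measurable_funM.
  by apply: (measurableT_comp (measurable_sqtX k)); exact: measurable_snd.
apply: measurableT_comp => //; apply: measurableT_comp => //; apply: measurable_funM.
  exact: measurable_fst.
by apply: (measurableT_comp (@measurable_sqt _ _)); exact: measurable_snd.
Qed.

Lemma sqt_eq0 (p : E) : sqt p = 0 -> forall j, tnth p j = 0.
Proof.
by move=> /eqP; rewrite sqnorm_eq0 => /eqP/rowP p0 j; have := p0 j; rewrite !mxE.
Qed.

Lemma integral_expR_tail (c t : R) : 0 < c ->
  (\int[mu]_(s in `]t, +oo[) (expR (- (s * c)))%:E = (c^-1 * expR (- (t * c)))%:E)%E.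
Proof.
move=> c0.
have D (s : R) : is_derive s 1 (fun s : R => - c^-1 * expR (- (s * c))) (expR (- (s * c))).
  have D1 : is_derive s 1 (fun s : R => - (s * c)) (- c).
    rewrite (_ : (fun s => _) = (- c) \*: (id : R -> R)); last first.
      by apply/funext => u; rewrite /= /GRing.scale/= mulrC mulNr.
    by apply: is_derive_eq; rewrite /GRing.scale/= mulr1.
  have D2 : is_derive s 1 (fun s : R => expR (- (s * c))) (expR (- (s * c)) * - c).
    exact: (@is_derive1_comp _ expR (fun s => - (s * c))).
  rewrite (_ : (fun s => _) = (- c^-1) \*: (fun s : R => expR (- (s * c))))//.
  by apply: is_derive_eq; rewrite /GRing.scale/= mulrC -mulrA mulrNN mulfV ?gt_eqF// mulr1.
have -> : c^-1 * expR (- (t * c)) = 0 - (- c^-1 * expR (- (t * c))).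
  by rewrite sub0r mulNr opprK.
apply: (@ge0_FTC2_oy _ _ (fun s => - c^-1 * expR (- (s * c)))).
- by move=> s _; exact: expR_ge0.
- move=> s _; apply: (@cvg_comp _ _ _ (fun s => - (s * c)) expR); last exact: continuous_expR.
  by apply: cvgN; apply: cvgM; [exact: cvg_id|exact: cvg_cst].
- apply: cvg_at_right_filter; exact: (is_derive_continuous (D t)).
- rewrite -[X in _ --> X](mulr0 (- c^-1)); apply: cvgM; first exact: cvg_cst.
  apply: (@cvg_comp _ _ _ (fun s => s * c) (fun y => expR (- y))); last exact: cvgr_expR.
  exact: (gt0_cvgMly c0).
Qed.

(** Integrating e^(-s|xi|^2) over s > t produces one factor |xi|^(-2); all inverse powers arise this
    way. At the origin the integral diverges for k = 0, hence the vanishing of [a] there. *)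
Lemma integral_gw_tail k t (a : E -> R) : (forall p, sqt p = 0 -> a p = 0) ->
  (forall p, 0 <= a p) -> forall p,
  (\int[mu]_(s in `]t, +oo[) (a p * gw k s p)%:E = (a p * gw k.+1 t p)%:E)%E.
Proof.
move=> a0 age0 p; have [s0|s0] := eqVneq (sqt p) 0.
  by rewrite a0// mul0r integral0_eq// => s _; rewrite mul0r.
have sp : 0 < sqt p by rewrite lt_neqAle eq_sym s0 sqt_ge0.
transitivity (\int[mu]_(s in `]t, +oo[) ((a p * sqt p ^- k)%:E * (expR (- (s * sqt p)))%:E))%E.
  by apply: eq_integral => s _; rewrite -EFinM mulrA.
rewrite ge0_integralZl//; do ?[by rewrite lee_fin mulr_ge0// invr_ge0 exprn_ge0// ltW
  |by move=> s _; rewrite lee_fin expR_ge0]; last first.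
  apply/measurable_EFinP; apply: measurable_funTS.
  apply: measurableT_comp => //; apply: measurableT_comp => //.
  exact: mulrr_measurable.
by rewrite integral_expR_tail// -EFinM /gw exprSr invfM; congr (_%:E); ring.
Qed.

Lemma integral_gw_step k (t q K : R) (a : E -> R) :
  measurable_fun setT a -> (forall p, sqt p = 0 -> a p = 0) -> (forall p, 0 <= a p) ->
  0 < t -> 1 < q -> 0 <= K ->
  (forall s, t < s -> (\int[lam]_p (a p * gw k s p)%:E = (K * s `^ (- q))%:E)%E) ->
  (\int[lam]_p (a p * gw k.+1 t p)%:E = (K * (t `^ (1 - q) / (q - 1)))%:E)%E.
Proof.
move=> ma a0 age0 t0 q1 K0 aK.
transitivity (\int[lam]_p \int[mu]_(s in `]t, +oo[) (a p * gw k s p)%:E)%E.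
  by apply: eq_integral => p _; rewrite integral_gw_tail.
rewrite (@ge0_fubini_restrict _ _ _ (fun z => (a z.2 * gw k z.1 z.2)%:E)); last 3 first.
- exact: measurable_itv.
- apply/measurable_EFinP; apply: measurable_funM; last exact: measurable_gw2.
  by apply: (measurableT_comp ma); exact: measurable_snd.
- by move=> z; rewrite lee_fin mulr_ge0 ?gw_ge0.
transitivity (\int[mu]_(s in `]t, +oo[) (K%:E * (s `^ (- q))%:E))%E.
  by apply: eq_integral => s; rewrite inE/= in_itv/= andbT => ts; rewrite aK.
rewrite ge0_integralZl//; first last.
- by move=> s _; rewrite lee_fin powR_ge0.
- by apply/measurable_EFinP; apply: measurable_funTS; exact: measurable_powR.
by rewrite integral_powR_tail.
Qed.

(** Starting from the Gaussian moments, each new inverse power integrates s^(-q) over the tail and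
    divides by q - 1, which the functional equation turns into a shift of Gamma. The bound k <= j
    keeps q > 1 at every step. *)
Lemma integral_gw_moment k j (t : R) (w : 'rV[R]_m) : (k <= j)%N -> 0 < t ->
  (\int[lam]_p (dott w p ^+ j.*2 * gw k t p)%:E =
   (pi `^ (m%:R / 2) * ((sqnorm w / 4) ^+ j * (j.*2`!%:R / j`!%:R)) *
    (t `^ (- (m%:R / 2 + j%:R - k%:R)) * (Gamma (m%:R / 2 + j%:R - k%:R) / Gamma (m%:R / 2 + j%:R))))%:E)%E.
Proof.
have m2 : 0 < m%:R / 2 :> R by rewrite divr_gt0// ltr0n.
have G0 i : 0 < Gamma (m%:R / 2 + i%:R : R) by apply: Gamma_gt0; rewrite ltr_pwDl.
elim: k t => [|k IH] t kj t0.
  transitivity (\int[lam]_p (dott w p ^+ j.*2 * expR (- (t * sqt p)))%:E)%E.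
    by apply: eq_integral => p _; rewrite /gw expr0 invr1 mul1r.
  rewrite integral_gauss_moment// subr0 mulfV ?gt_eqF// mulr1; congr (_%:E).
  rewrite opprD powRD; last by rewrite (gt_eqF t0) implybT.
  rewrite !powRN powR_mulrn ?(ltW t0)// powRM ?pi_ge0 ?invr_ge0 ?(ltW t0)//.
  rewrite -[t^-1]powR_inv1 ?(ltW t0)// -powRrM mulN1r powRN.
  have f0 : (j`!%:R : R) != 0 by rewrite pnatr_eq0 -lt0n fact_gt0.
  have -> : sqnorm w / (4 * t) = sqnorm w / 4 * t^-1 by rewrite invfM mulrA.
  by rewrite exprMn exprVn; ring.
pose q : R := m%:R / 2 + j%:R - k%:R.
have q1 : 1 < q.
  have : (k%:R + 1 : R) <= j%:R by rewrite natr1 ler_nat.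
  rewrite /q; lra.
have q10 : 0 < q - 1 by rewrite subr_gt0.
have -> : m%:R / 2 + j%:R - k.+1%:R = q - 1 :> R by rewrite /q -natr1; ring.
pose K := pi `^ (m%:R / 2) * ((sqnorm w / 4) ^+ j * (j.*2`!%:R / j`!%:R)) *
  (Gamma q / Gamma (m%:R / 2 + j%:R)).
have sn0 : 0 <= sqnorm w by rewrite /sqnorm /dotr sumr_ge0// => i _; rewrite -expr2 sqr_ge0.
have K0 : 0 <= K.
  apply: mulr_ge0; last by apply: divr_ge0; apply: ltW => //; apply: Gamma_gt0; exact: lt_trans q1.
  by apply: mulr_ge0; [exact: powR_ge0|apply: mulr_ge0; [apply: exprn_ge0|]; exact: divr_ge0].
rewrite (@integral_gw_step k t q K (fun p => dott w p ^+ j.*2) _ _ _ t0 q1 K0).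
- have H (P T Gq G x : R) : x != 0 -> G != 0 -> P * (x * Gq / G) * (T / x) = P * (T * (Gq / G)).
    by move=> x0 G_0; field; rewrite x0 G_0.
  have -> : 1 - q = - (q - 1) by rewrite [RHS]opprB.
  rewrite /K -[in Gamma q](subrK 1 q) GammaS// H//; first exact: lt0r_neq0.
  exact: lt0r_neq0 (G0 j).
- by apply: measurable_funX; exact: measurable_dott.
- move=> p /sqt_eq0 p0; rewrite dottE big1 ?expr0n; last by move=> i _; rewrite p0 mul0r.
  by rewrite double_eq0 (gtn_eqF (leq_ltn_trans (leq0n k) kj)).
- by move=> p; rewrite -mul2n exprM exprn_ge0// sqr_ge0.
- move=> s ts; rewrite IH ?(lt_trans t0)// 1?ltnW// -/q /K; congr (_%:E); ring.
Qed.

(** Integer shifts are monotone although Gamma is not on [1, 2]: each multiplies by a number at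
    least 1. *)
Lemma Gamma_le_addn (x : R) n : 1 <= x -> Gamma x <= Gamma (x + n%:R).
Proof.
move=> x1; elim: n => [|n IH]; first by rewrite addr0.
have xn : 1 <= x + n%:R by rewrite ler_wpDr.
have xn0 : 0 < x + n%:R by exact: lt_le_trans xn.
rewrite -natr1 addrA GammaS//; apply: le_trans IH _.
by rewrite ler_peMl// ltW// Gamma_gt0.
Qed.

End moments.

(** * Oscillatory integrals and Phi *)

Section remainder_integrals.
Context {R : realType} {m : nat}.
Local Notation mu := (@lebesgue_measure R).
Local Notation E := (m.-tuple (measurableTypeR R)).
Local Notation lam := (lebesgue_Rn R m).
Implicit Types (J : seq 'I_m) (w : 'rV[R]_m) (t : R) (p : E).

Definition mon J p : R := \prod_(j <- J) tnth p j.

Definition core J q n t w p : R := mon J p * trem q (dott w p) * gw n t p.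

Definition osc J q n t w : R := \int[lam]_p core J q n t w p.

Lemma mon_le J p : `|mon J p| <= Num.sqrt (sqt p) ^+ size J.
Proof.
rewrite /mon; elim: J => [|j J IH]; first by rewrite big_nil normr1 expr0.
by rewrite big_cons normrM /= exprS ler_pM// tnth_le.
Qed.

Lemma measurable_mon J : measurable_fun setT (mon J).
Proof.
rewrite (_ : mon J = fun p => mon J p)//; elim: J => [|j J IH].
  rewrite (_ : (fun p => _) = cst (1 : R))//.
  by apply/funext => p; rewrite /mon big_nil.
rewrite (_ : (fun p => _) = (fun p => tnth p j * mon J p)); last first.
  by apply/funext => p; rewrite /mon big_cons.
by apply: measurable_funM => //; exact: measurable_tnthR.
Qed.

Lemma mon_opp J p : mon J (tuple_opp p) = (-1) ^+ size J * mon J p.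
Proof.
rewrite /mon; elim: J => [|j J IH]; first by rewrite !big_nil mul1r.
by rewrite !big_cons IH tnth_tuple_opp /= exprS; ring.
Qed.

Lemma mon_cons j J p : mon (j :: J) p = tnth p j * mon J p.
Proof. by rewrite /mon big_cons. Qed.

Lemma mon_trem_le J q p w :
  `|mon J p * trem q (dott w p)| <= l1norm w ^+ q * Num.sqrt (sqt p) ^+ (size J + q).
Proof.
rewrite normrM exprD mulrCA; apply: ler_pM => //; first exact: mon_le.
rewrite -exprMn; apply: le_trans (trem_le _ _) _.
by rewrite lerXn2r ?nnegrE ?dott_le// mulr_ge0 ?l1norm_ge0 ?sqrtr_ge0.
Qed.

(** Equality away from the origin; at the origin the left side is 0 for n > 0. *)
Lemma sqt_gw_le n t p : sqt p ^+ n * gw n t p <= expR (- (t * sqt p)).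
Proof.
rewrite /gw mulrA ler_piMl ?expR_ge0//.
have [->|p0] := eqVneq (sqt p ^+ n) 0; first by rewrite mul0r ler01.
by rewrite mulfV.
Qed.

Lemma core_le J q n t w p : (size J + q = n.*2)%N ->
  `|core J q n t w p| <= l1norm w ^+ q * expR (- (t * sqt p)).
Proof.
move=> Jq; rewrite /core normrM (ger0_norm (gw_ge0 _ _ _)).
apply: le_trans (ler_wpM2r (gw_ge0 n t p) (mon_trem_le J q p w)) _.
rewrite Jq -mul2n exprM sqr_sqrtr ?sqt_ge0// -mulrA.
by apply: ler_wpM2l; [rewrite exprn_ge0 ?l1norm_ge0|exact: sqt_gw_le].
Qed.

Lemma measurable_core2 J q n w :
  measurable_fun setT (fun z : measurableTypeR R * E => core J q n z.1 w z.2).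
Proof.
apply: measurable_funM; last exact: measurable_gw2.
apply: measurable_funM.
  by apply: (measurableT_comp (measurable_mon J)); exact: measurable_snd.
apply: (measurableT_comp (measurable_trem q)).
by apply: (measurableT_comp (measurable_dott w)); exact: measurable_snd.
Qed.

Lemma measurable_core J q n t w : measurable_fun setT (core J q n t w).
Proof.
apply: measurable_funM; last exact: measurable_gw.
apply: measurable_funM; first exact: measurable_mon.
by apply: (measurableT_comp (measurable_trem q)); exact: measurable_dott.
Qed.

(** Parity makes the bounding power of |xi| an integer power of [sqt]; the excess of |J| + q over 2n
    is a polynomial factor against the Gaussian. *)
Lemma integrable_core J q n t w : (n.*2 <= size J + q)%N -> ~~ odd (size J + q) -> 0 < t ->
  lam.-integrable setT (EFin \o core J q n t w).
Proof.
move=> Jq od t0; pose N := (size J + q)./2.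
have NE : (size J + q = N.*2)%N by rewrite /N -[LHS]odd_double_half (negbTE od).
have nN : (n <= N)%N by rewrite -leq_double -NE.
apply: (@integrable_gauss_dom _ _ t (l1norm w ^+ q) (N - n)) => //; first exact: measurable_core.
move=> p; rewrite /core normrM (ger0_norm (gw_ge0 _ _ _)).
apply: le_trans (ler_wpM2r (gw_ge0 n t p) (mon_trem_le J q p w)) _.
rewrite NE -mul2n exprM sqr_sqrtr ?sqt_ge0// -mulrA.
apply: ler_wpM2l; first by rewrite exprn_ge0 ?l1norm_ge0.
rewrite -{1}(subnK nN) exprD -mulrA.
by apply: ler_wpM2l; [rewrite exprn_ge0 ?sqt_ge0|exact: sqt_gw_le].
Qed.

Lemma le_normr_osc J q n t w : (size J + q = n.*2)%N -> 0 < t ->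
  `|osc J q n t w| <= l1norm w ^+ q * (pi / t) `^ (m%:R / 2).
Proof.
move=> Jq t0; have ic : lam.-integrable setT (EFin \o core J q n t w).
  by apply: integrable_core => //; rewrite Jq ?odd_double.
apply: le_trans (le_normr_Rintegral _ ic) _ => //.
have -> : l1norm w ^+ q * (pi / t) `^ (m%:R / 2) =
    \int[lam]_p (l1norm w ^+ q * expR (- (t * sqt p))).
  rewrite RintegralZl//; last exact: integrable_gauss.
  by rewrite /Rintegral integral_gauss0.
apply: le_Rintegral => //.
- exact: (integrable_norm ic).
- exact: (integrableZl _ _ (integrable_gauss t0)).
- by move=> p _; exact: core_le.
Qed.

Hypothesis m_gt0 : (0 < m)%N.

(** One step of the recursion of [trem] splits off (xi.w)^(2K)/(2K)!, and the moment formula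
    identifies its integral with the K-th term of Phi_n. *)
Lemma osc_moment_step K n t w : (n <= K)%N -> 0 < t ->
  (-1) ^+ K * osc [::] K.*2 n t w =
  pi `^ (m%:R / 2) * t `^ (n%:R - m%:R / 2) *
    (Gamma (m%:R / 2 - n%:R + K%:R) / (Gamma (m%:R / 2 + K%:R) * K`!%:R) *
     (- (sqnorm w / (4 * t))) ^+ K) + (-1) ^+ K.+1 * osc [::] K.+1.*2 n t w.
Proof.
move=> nK t0.
have i1 : lam.-integrable setT (EFin \o core [::] K.*2 n t w).
  by apply: integrable_core => //=; rewrite add0n ?odd_double// leq_double.
have i2 : lam.-integrable setT (EFin \o core [::] K.+1.*2 n t w).
  apply: integrable_core; rewrite ?add0n ?odd_double//.
  by rewrite leq_double (leq_trans nK).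
have E0 : osc [::] K.*2 n t w + osc [::] K.+1.*2 n t w =
    (K.*2`!%:R)^-1 * fine (\int[lam]_p (dott w p ^+ K.*2 * gw n t p)%:E)%E.
  rewrite /osc -RintegralD//.
  have i3 : lam.-integrable setT (fun p => (dott w p ^+ K.*2 * gw n t p)%:E).
    apply/integrableP; split.
      apply/measurable_EFinP; apply: measurable_funM; last exact: measurable_gw.
      by apply: measurable_funX; exact: measurable_dott.
    rewrite (_ : integral _ _ _ = (\int[lam]_p (dott w p ^+ K.*2 * gw n t p)%:E)%E).
      by rewrite integral_gw_moment// ltry.
    apply: eq_integral => p _; rewrite /= ger0_norm// mulr_ge0 ?gw_ge0//.
    by rewrite -mul2n exprM exprn_ge0// sqr_ge0.
  rewrite -[fine _]/(\int[lam]_p (dott w p ^+ K.*2 * gw n t p)) -RintegralZl//.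
  apply: eq_Rintegral => p _.
  by rewrite /core /mon big_nil !mul1r doubleS tremSS -mulrDl addrC subrK; ring.
rewrite integral_gw_moment//= in E0.
have E1 : osc [::] K.*2 n t w = pi `^ (m%:R / 2) * t `^ (n%:R - m%:R / 2) *
    (Gamma (m%:R / 2 - n%:R + K%:R) / (Gamma (m%:R / 2 + K%:R) * K`!%:R) *
     (sqnorm w / (4 * t)) ^+ K) - osc [::] K.+1.*2 n t w.
  apply/eqP; rewrite eq_sym subr_eq eq_sym E0; apply/eqP.
  have -> : - (m%:R / 2 + K%:R - n%:R) = (n%:R - m%:R / 2) + - K%:R :> R by ring.
  rewrite powRD; last by rewrite (gt_eqF t0) implybT.
  rewrite powRN powR_mulrn ?(ltW t0)//.
  have -> : m%:R / 2 + K%:R - n%:R = m%:R / 2 - n%:R + K%:R :> R by ring.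
  have exE : (sqnorm w / (4 * t)) ^+ K = (sqnorm w / 4) ^+ K / t ^+ K.
    by rewrite -exprVn -exprMn invfM mulrA.
  rewrite exE.
  have f1 : (K.*2`!%:R : R) != 0 by rewrite pnatr_eq0 -lt0n fact_gt0.
  have f2 : (K`!%:R : R) != 0 by rewrite pnatr_eq0 -lt0n fact_gt0.
  have f3 : Gamma (m%:R / 2 + K%:R : R) != 0.
    by rewrite gt_eqF// Gamma_gt0// ltr_pwDl// divr_gt0// ltr0n.
  have f4 : t ^+ K != 0 by rewrite expf_neq0// gt_eqF.
  move: (Gamma _) (Gamma _) (_ `^ _) (_ `^ _) (_ ^+ _) (t ^+ K) f1 f2 f3 f4.
  move: (K.*2`!%:R : R) (K`!%:R : R) => F1 F2 *.
  by field; do !(apply/andP; split).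
rewrite E1 exprS (exprNn (sqnorm w / (4 * t))); ring.
Qed.

(** Iterating [osc_moment_step] from K = n leaves partial sums of Phi_n plus the integral with
    remainder index 2K, and the latter is dominated by the terms of an exponential series. *)
Lemma Phi_osc n t w : 0 < t ->
  (-1) ^+ n * osc [::] n.*2 n t w =
  pi `^ (m%:R / 2) * t `^ (n%:R - m%:R / 2) * Phi m n (- (sqnorm w / (4 * t))).
Proof.
move=> t0.
pose z := - (sqnorm w / (4 * t)).
pose term K : R := Gamma (m%:R / 2 - n%:R + K%:R) / (Gamma (m%:R / 2 + K%:R) * K`!%:R) * z ^+ K.
pose P : R := pi `^ (m%:R / 2) * t `^ (n%:R - m%:R / 2).
have P0 : 0 < P by rewrite mulr_gt0 ?powR_gt0 ?pi_gt0.
pose S K := (-1) ^+ K * osc [::] K.*2 n t w.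
have E K : (n <= K)%N -> S n = P * \sum_(n <= k < K) term k + S K.
  elim: K => [|K IH]; first by rewrite leqn0 => /eqP ->; rewrite big_geq// mulr0 add0r.
  rewrite leq_eqVlt => /predU1P[<-|]; first by rewrite big_geq// mulr0 add0r.
  rewrite ltnS => nK; rewrite IH// {1}/S osc_moment_step// big_nat_recr//= mulrDr.
  by rewrite -[in RHS]addrA.
have z0 : 0 <= sqnorm w / (4 * t).
  rewrite divr_ge0// ?mulr_ge0 ?(ltW t0)//.
  by rewrite /sqnorm /dotr sumr_ge0// => i _; rewrite -expr2 sqr_ge0.
have i3 K : (n <= K)%N -> lam.-integrable setT (fun p => (dott w p ^+ K.*2 * gw n t p)%:E).
  move=> nK; apply/integrableP; split.
    apply/measurable_EFinP; apply: measurable_funM; last exact: measurable_gw.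
    by apply: measurable_funX; exact: measurable_dott.
  rewrite (_ : integral _ _ _ = (\int[lam]_p (dott w p ^+ K.*2 * gw n t p)%:E)%E).
    by rewrite integral_gw_moment// ltry.
  apply: eq_integral => p _; rewrite /= ger0_norm// mulr_ge0 ?gw_ge0//.
  by rewrite -mul2n exprM exprn_ge0// sqr_ge0.
(* The shift by 2 keeps the argument m/2 + K - n of Gamma above 1, where adding n does not decrease
   Gamma; the quotient of Gammas is then at most 1. *)
have SK K : (n + 2 <= K)%N -> `|S K| <= P * exp_coeff (sqnorm w / (4 * t)) K.
  move=> nK; have nK' : (n <= K)%N by rewrite (leq_trans _ nK)// leq_addr.
  rewrite /S normrM normrX normrN1 expr1n mul1r.
  have i1 : lam.-integrable setT (EFin \o core [::] K.*2 n t w).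
    by apply: integrable_core; rewrite ?add0n ?odd_double// leq_double.
  apply: le_trans (le_normr_Rintegral _ i1) _ => //.
  have i4 := integrableZl measurableT ((K.*2`!%:R)^-1 : R) (i3 K nK').
  apply: (@le_trans _ _ (\int[lam]_p ((K.*2`!%:R)^-1 * (dott w p ^+ K.*2 * gw n t p)))).
    apply: le_Rintegral => //; first exact: (integrable_norm i1).
    move=> p _; rewrite /core /mon big_nil mul1r normrM (ger0_norm (gw_ge0 _ _ _)) [leRHS]mulrA.
    apply: ler_wpM2r; first exact: gw_ge0.
    apply: le_trans (trem_le_fact _ _) _.
    rewrite mulrC -normrX ger0_norm//.
    by rewrite -mul2n exprM exprn_ge0// sqr_ge0.
  rewrite RintegralZl//; last exact: i3.
  rewrite /Rintegral integral_gw_moment//= /exp_coeff/=.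
  have -> : - (m%:R / 2 + K%:R - n%:R) = (n%:R - m%:R / 2) + - K%:R :> R by ring.
  rewrite powRD; last by rewrite (gt_eqF t0) implybT.
  rewrite powRN powR_mulrn ?(ltW t0)//.
  have exE : (sqnorm w / (4 * t)) ^+ K = (sqnorm w / 4) ^+ K / t ^+ K.
    by rewrite -exprVn -exprMn invfM mulrA.
  rewrite exE.
  have f1 : (K.*2`!%:R : R) != 0 by rewrite pnatr_eq0 -lt0n fact_gt0.
  have f2 : (K`!%:R : R) != 0 by rewrite pnatr_eq0 -lt0n fact_gt0.
  have G0 : 0 < Gamma (m%:R / 2 + K%:R : R).
    by rewrite Gamma_gt0// ltr_pwDl// divr_gt0// ltr0n.
  have G1 : Gamma (m%:R / 2 + K%:R - n%:R : R) / Gamma (m%:R / 2 + K%:R) <= 1.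
    rewrite ler_pdivrMr// mul1r -[X in _ <= Gamma X](subrK n%:R).
    apply: Gamma_le_addn.
    have : (n%:R + 2 : R) <= K%:R by rewrite -natrD ler_nat.
    have : 0 <= m%:R :> R by []. 
    lra.
  set x := Gamma _ / _ in G1 *.
  rewrite (_ : (K.*2`!%:R)^-1 * _ = P * ((sqnorm w / 4) ^+ K / t ^+ K / K`!%:R) * x).
    rewrite ler_piMr// mulr_ge0 ?(ltW P0)// !mulr_ge0 ?invr_ge0 ?exprn_ge0 ?(ltW t0)//.
    rewrite /sqnorm /dotr mulr_ge0// sumr_ge0// => i _; rewrite -expr2 sqr_ge0//.
  have f4 : t ^+ K != 0 by rewrite expf_neq0// gt_eqF.
  rewrite /P; move: x (_ `^ _) (_ `^ _) (_ ^+ _) (t ^+ K) f1 f2 f4 {G0 G1}.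
  move: (K.*2`!%:R : R) (K`!%:R : R) => F1 F2 *.
  by field; do !(apply/andP; split).
have S0 : S K @[K --> \oo] --> (0 : R).
  apply/norm_cvg0P; apply: (@squeeze_cvgr _ _ _ _ (cst 0) (fun K => P * exp_coeff (sqnorm w / (4 * t)) K)).
  - near=> K; rewrite normr_ge0/= SK//.
    by near: K; exact: nbhs_infty_ge.
  - exact: cvg_cst.
  - rewrite -[X in _ --> X](mulr0 P); apply: cvgM; first exact: cvg_cst.
    by apply: cvg_series_cvg_0; exact: is_cvg_series_exp_coeff.
have C : (\sum_(n <= k < K) term k) @[K --> \oo] --> S n / P.
  have : (S n - S K) / P @[K --> \oo] --> (S n - 0) / P.
    by apply: cvgM; [apply: cvgB => //; exact: cvg_cst|exact: cvg_cst].
  rewrite subr0; apply: cvg_trans; apply: near_eq_cvg.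
  near=> K; rewrite (E K); last by near: K; exact: nbhs_infty_ge.
  by rewrite addrK mulrC mulKf// gt_eqF.
have -> : Phi m n (- (sqnorm w / (4 * t))) = S n / P by apply/cvg_lim.
by rewrite -/(S n) -/P mulrC divfK// gt_eqF.
Unshelve. all: end_near. Qed.

End remainder_integrals.

Local Open Scope complex_scope.

(** * Spectral decomposition of the symbol *)

Lemma cvg_sumr (R : realType) (T : Type) (F : set_system T) {FF : Filter F} (I : Type)
    (r : seq I) (f : I -> T -> R) (l : I -> R) :
  (forall i, f i x @[x --> F] --> l i) ->
  (\sum_(i <- r) f i x) @[x --> F] --> \sum_(i <- r) l i.
Proof.
move=> fl; elim: r => [|i r IH].
  by rewrite big_nil; under eq_fun do rewrite big_nil; exact: cvg_cst.
by rewrite big_cons; under eq_fun do rewrite big_cons; exact: cvgD.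
Qed.

Section spectral_projections.
Context {R : realType} {N s : nat}.
Local Notation C := R[i].
Variable mu : 'rV[R]_s.
Hypothesis mu_distinct : forall i j, mu 0 i = mu 0 j -> i = j.
Local Notation c := (invmx (Vandermonde s mu)).

Lemma Vandermonde_unit : Vandermonde s mu \in unitmx.
Proof.
rewrite unitmxE det_Vandermonde unitfE; apply/prodf_neq0 => i _.
apply/prodf_neq0 => j ij; rewrite subr_eq0; apply/eqP => /mu_distinct ji.
by rewrite ji ltnn in ij.
Qed.

Lemma sum_inv_Vandermonde i j : \sum_k c i k * mu 0 j ^+ k = (i == j)%:R.
Proof.
have := mulVmx Vandermonde_unit => /matrixP/(_ i j); rewrite !mxE => <-.
by apply: eq_bigr => k _; rewrite !mxE.
Qed.

Lemma sum_inv_Vandermonde0 (k : 'I_s) : \sum_i c i k = (k == 0%N :> nat)%:R.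
Proof.
have s0 : (0 < s)%N by apply: leq_ltn_trans (ltn_ord k).
have := mulmxV Vandermonde_unit => /matrixP/(_ (Ordinal s0) k); rewrite !mxE eq_sym => <-.
by apply: eq_bigr => i _; rewrite !mxE expr0 mul1r.
Qed.

Variables (A : 'M[C]_N) (r : R).

(** Lagrange interpolation: by the choice of [c], the polynomial with coefficients c_ik / r^k is 1
    at mu_i r and 0 at the other mu_j r, so this is the spectral projection of [A]. The exponent k
    is counted from 0. *)
Definition sproj (i : 'I_s) : 'M[C]_N := \sum_(k < s) (c i k / r ^+ k)%:C *: A ^+ k.

Lemma sproj_diag (U : 'M[C]_N) (d : 'rV[C]_N) (sg : 'I_N -> 'I_s) :
  U \in unitmx -> A = invmx U *m diag_mx d *m U -> r != 0 ->
  (forall j, d 0 j = (mu 0 (sg j) * r)%:C) ->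
  forall i, sproj i = invmx U *m diag_mx (\row_j (i == sg j)%:R) *m U.
Proof.
move=> Uu AE r0 dE i.
have AX k : A ^+ k = invmx U *m diag_mx (\row_j d 0 j ^+ k) *m U.
  elim: k => [|k IH].
    rewrite expr0 (_ : \row_j _ = const_mx 1) ?diag_const_mx ?mulmx1 ?mulVmx//.
    by apply/rowP => j; rewrite !mxE expr0.
  rewrite exprS IH {1}AE -[LHS]/(_ *m _) !mulmxA; congr (_ *m _).
  rewrite mulmxK// -!mulmxA; congr (_ *m _).
  rewrite mulmx_diag; congr diag_mx.
  by apply/rowP => j; rewrite !mxE exprS.
rewrite /sproj; under eq_bigr do rewrite AX scalemxAl scalemxAr.
rewrite -mulmx_suml -mulmx_sumr; congr (_ *m _ *m _).
apply/matrixP => a b; rewrite summxE !mxE.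
under eq_bigr do rewrite !mxE.
have [->|ab] := eqVneq a b; last by rewrite mulr0n big1// => k _; rewrite mulr0n mulr0.
rewrite mulr1n -[RHS](rmorph_nat (real_complex R)) -sum_inv_Vandermonde rmorph_sum/=.
apply: eq_bigr => k _; rewrite mulr1n dE -rmorphXn -rmorphM/= exprMn.
by congr (_%:C); rewrite (mulrC (mu 0 _ ^+ k)) mulrA divfK ?expf_neq0.
Qed.

Lemma sum_sproj_herm :
  A \is hermsymmx -> r != 0 ->
  (forall z, eigenvalue A z -> exists i, z = (mu 0 i * r)%:C) ->
  \sum_i sproj i = 1%:M /\ forall i, A *m sproj i = (mu 0 i * r)%:C *: sproj i.
Proof.
move=> hA r0 eA.
pose U := spectralmx A; pose d := spectral_diag A.
have Uu : U \in unitmx by exact: spectral_unit.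
have /orthomx_spectralP AE := hermitian_normalmx hA.
(* Row j of the invertible matrix [U] is nonzero and is a left eigenvector for the j-th diagonal
   entry. *)
have dj j : exists i, d 0 j = (mu 0 i * r)%:C.
  apply: eA; apply/eigenvalueP; exists (row j U).
    rewrite {1}AE -/U -/d -row_mul !mulmxA mulmxV// mul1mx row_mul row_diag_mx.
    by rewrite -scalemxAl -rowE.
  apply/eqP => rU0; have := row_free_unit U; rewrite Uu => /row_freeP [V UV].
  have : row j (U *m V) = 0 by rewrite row_mul rU0 mul0mx.
  rewrite UV => /rowP/(_ j); rewrite !mxE eqxx => /eqP; by rewrite oner_eq0.
have [sg sgE] := choice dj.
have spE := sproj_diag Uu AE r0 sgE.
split.
  under eq_bigr do rewrite spE.
  rewrite -mulmx_suml -mulmx_sumr (_ : \sum_i _ = 1%:M) ?mulmx1 ?mulVmx//.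
  apply/matrixP => a b; rewrite summxE; under eq_bigr do rewrite !mxE.
  rewrite mxE; have [->|ab] := eqVneq a b; last by rewrite big1// => k _; rewrite mulr0n.
  rewrite (bigD1 (sg b))//= eqxx mulr1n big1 ?addr0// => i /negbTE ->.
  by rewrite mulr1n.
move=> i; rewrite spE {1}AE -/U -/d !mulmxA (mulmxK Uu).
rewrite scalemxAl; congr (_ *m _); rewrite -mulmxA scalemxAr; congr (_ *m _).
rewrite mulmx_diag -linearZ/=; congr diag_mx; apply/rowP => j; rewrite !mxE.
by have [->|] := eqVneq i (sg j); rewrite ?mulr0// mulr1 sgE mulr1.
Qed.

(** The case xi = 0: the convention for the inverse of 0 leaves the terms k = 0 only, and the
    corresponding inverse Vandermonde coefficients add up to 1. The spectral formulas thus hold at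
    every momentum, the origin included. *)
Lemma sum_sproj0 : (0 < s)%N -> A = 0 -> r = 0 ->
  \sum_i sproj i = 1%:M /\ forall i, A *m sproj i = (mu 0 i * r)%:C *: sproj i.
Proof.
move=> s0 A0 r0; split=> [|i]; last by rewrite A0 r0 mul0mx mulr0 scale0r.
rewrite /sproj exchange_big/= (bigD1 (Ordinal s0))//= [X in _ + X]big1 ?addr0.
  rewrite -scaler_suml -rmorph_sum/= expr0.
  under eq_bigr do rewrite divr1.
  by rewrite sum_inv_Vandermonde0/= scale1r.
move=> k k0; apply: big1 => i _.
have kn0 : (k : nat) != 0%N by apply: contraNneq k0 => k0; apply/eqP/val_inj.
by rewrite A0 expr0n (negbTE kn0) scaler0.
Qed.

Hypothesis sum_sproj : \sum_i sproj i = 1%:M.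
Hypothesis mul_sproj : forall i, A *m sproj i = (mu 0 i * r)%:C *: sproj i.

Lemma expr_sproj k : A ^+ k = \sum_i (mu 0 i * r)%:C ^+ k *: sproj i.
Proof.
elim: k => [|k IH].
  by rewrite expr0 -[LHS]sum_sproj; apply: eq_bigr => i _; rewrite expr0 scale1r.
rewrite exprS IH -[LHS]/(_ *m _) mulmx_sumr; apply: eq_bigr => i _.
by rewrite -scalemxAr mul_sproj scalerA exprSr.
Qed.

Lemma invmx_sproj (lam : C) : (forall i, (mu 0 i * r)%:C - lam != 0) ->
  invmx (A - lam%:M) = \sum_i ((mu 0 i * r)%:C - lam)^-1 *: sproj i.
Proof.
move=> h; have E : (A - lam%:M) *m (\sum_i ((mu 0 i * r)%:C - lam)^-1 *: sproj i) = 1%:M.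
  rewrite mulmx_sumr -sum_sproj; apply: eq_bigr => i _.
  rewrite -scalemxAr mulmxBl mul_sproj mul_scalar_mx -scalerBl scalerA mulVf ?scale1r//.
have [u _] := mulmx1_unit E.
by rewrite -[RHS](mulKmx u) E mulmx1.
Qed.

Lemma mx_exp_sproj (t : R) :
  mx_exp (- t%:C *: A) = \sum_i (expR (- (t * (mu 0 i * r))))%:C *: sproj i.
Proof.
have E n : mx_exp_partial (- t%:C *: A) n =
    \sum_i (series (exp_coeff (- (t * (mu 0 i * r)))) n)%:C *: sproj i.
  rewrite /mx_exp_partial /series/=.
  under eq_bigr => k _.
    have -> : (- t%:C *: A) ^+ k = (- t%:C) ^+ k *: A ^+ k.
      elim: k => [|k IH]; first by rewrite !expr0 scale1r.
      by rewrite !exprS IH -[LHS]/(_ *m _) -scalemxAl -scalemxAr scalerA.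
    rewrite expr_sproj !scaler_sumr; over.
  rewrite exchange_big/=; apply: eq_bigr => i _; rewrite rmorph_sum/= scaler_suml.
  apply: eq_bigr => k _; rewrite !scalerA; congr (_ *: _).
  rewrite /exp_coeff/= -mulrN -!rmorphXn/= -rmorphN/= -!rmorphXn/= mulrC -(rmorph_nat (real_complex R)) -fmorphV/= -!rmorphM/=.
  congr (_%:C); rewrite mulrCA [RHS]mulrC; congr (_ * _); rewrite -exprMn.
  by congr (_ ^+ _); ring.
apply/matrixP => a b; rewrite mxE summxE.
have reM (x : R) (z : C) : complex.Re (x%:C * z) = x * complex.Re z.
  by case: z => z1 z2; rewrite /= mul0r subr0.
have imM (x : R) (z : C) : complex.Im (x%:C * z) = x * complex.Im z.
  by case: z => z1 z2; rewrite /= mul0r addr0.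
have reS (F : 'I_s -> C) : complex.Re (\sum_i F i) = \sum_i complex.Re (F i).
  by rewrite raddf_sum.
have imS (F : 'I_s -> C) : complex.Im (\sum_i F i) = \sum_i complex.Im (F i).
  by rewrite raddf_sum.
(* [g] stands for the real or the imaginary part; being additive and real-homogeneous, both pass
   through the spectral sum. *)
have L (g : C -> R) : (forall x z, g (x%:C * z) = x * g z) ->
   (forall F : 'I_s -> C, g (\sum_i F i) = \sum_i g (F i)) ->
   limn (fun n => g (mx_exp_partial (- t%:C *: A) n a b)) =
   g (\sum_i ((expR (- (t * (mu 0 i * r))))%:C *: sproj i) a b).
  move=> gM gS; apply/cvg_lim => //.
  under eq_fun do rewrite E summxE gS.
  rewrite gS; apply: (@cvg_sumr _ _ _ _ _ _ (fun i n => g (((series (exp_coeff (- (t * (mu 0 i * r)))) n)%:C *: sproj i) a b))) => i.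
  under eq_fun do rewrite mxE gM.
  rewrite mxE gM; apply: cvgM; last exact: cvg_cst.
  exact: is_cvg_series_exp_coeff.
rewrite (L _ reM reS) (L _ imM imS).
by case: (\sum_i _).
Qed.

End spectral_projections.

(** * Expansion into words of non-commuting coefficients *)

Section words.
Context {R : realType} {m N : nat}.
Local Notation C := R[i].
Variable a : 'I_m -> 'I_m -> 'M[C]_N.

(* The expansion of a k-fold product of the operator with symbol [a] into words of length 2k. *)
Fixpoint words k : seq (seq 'I_m * 'M[C]_N) :=
  if k is k'.+1 then
    [seq (p.1 :: p.2 :: w.1, a p.1 p.2 *m w.2) | p <- enum {: 'I_m * 'I_m}, w <- words k']
  else [:: ([::], 1%:M)].

(** The common shape of A(xi)^k, of the symmetrized contraction and of F_0^k up to sign; they differ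
    in the scalar coefficients [D] alone. *)
Definition wsum k (D : seq 'I_m -> C) : 'M[C]_N := \sum_(w <- words k) D w.1 *: w.2.

Lemma size_words k w : w \in words k -> size w.1 = k.*2.
Proof.
elim: k w => [|k IH] w /=; first by rewrite inE => /eqP ->.
by move=> /allpairsP[[p v] [_ /= /IH sv ->]] /=; rewrite sv doubleS.
Qed.

Lemma wsum0 D : wsum 0 D = (D [::])%:M.
Proof. by rewrite /wsum big_seq1 /= scalemx1. Qed.

Lemma wsumS k D : wsum k.+1 D =
  \sum_mu \sum_nu a mu nu *m wsum k (fun J => D (mu :: nu :: J)).
Proof.
rewrite /wsum /= big_allpairs_dep big_enum/= pair_big/=; apply: eq_bigr => p _.
by rewrite mulmx_sumr; apply: eq_bigr => w _ /=; rewrite scalemxAr.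
Qed.

Lemma eq_wsum k D D' : (forall J, size J = k.*2 -> D J = D' J) -> wsum k D = wsum k D'.
Proof. by move=> DD; rewrite /wsum; apply: eq_big_seq => w /size_words/DD ->. Qed.

Lemma wsumZ k c D : wsum k (fun J => c * D J) = c *: wsum k D.
Proof. by rewrite /wsum scaler_sumr; apply: eq_bigr => w _; rewrite scalerA. Qed.

Lemma symbol_expr (xi : 'rV[R]_m) k :
  symbol a xi ^+ k = wsum k (fun J => (\prod_(j <- J) xi 0 j)%:C).
Proof.
elim: k => [|k IH]; first by rewrite wsum0 big_nil expr0.
rewrite wsumS exprS IH -[LHS]/(_ *m _) mulmx_suml; apply: eq_bigr => i _.
rewrite mulmx_suml; apply: eq_bigr => j _.
rewrite -scalemxAl scalemxAr -wsumZ; congr (_ *m _); apply: eq_wsum => J _.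
by rewrite !big_cons -rmorphM mulrA.
Qed.

Definition ffun_cons n (x : 'I_m) (J : {ffun 'I_n -> 'I_m}) : {ffun 'I_n.+1 -> 'I_m} :=
  [ffun i => oapp J x (unlift ord0 i)].

Lemma ffun_cons0 n x (J : {ffun 'I_n -> 'I_m}) : ffun_cons x J ord0 = x.
Proof. by rewrite ffunE unlift_none. Qed.

Lemma ffun_consS n x (J : {ffun 'I_n -> 'I_m}) i : ffun_cons x J (lift ord0 i) = J i.
Proof. by rewrite ffunE liftK. Qed.

Lemma map_ffun_cons n x (J : {ffun 'I_n -> 'I_m}) :
  [seq ffun_cons x J l | l <- enum 'I_n.+1] = x :: [seq J l | l <- enum 'I_n].
Proof.
rewrite enum_ordSl /= ffun_cons0 -map_comp; congr (_ :: _).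
by apply: eq_map => l /=; rewrite ffun_consS.
Qed.

Lemma sum_ffun_cons (V : zmodType) n (F : {ffun 'I_n.+1 -> 'I_m} -> V) :
  \sum_J F J = \sum_x \sum_J F (ffun_cons x J).
Proof.
rewrite pair_big/= (reindex (fun p : 'I_m * {ffun 'I_n -> 'I_m} => ffun_cons p.1 p.2))//.
exists (fun J : {ffun 'I_n.+1 -> 'I_m} => (J ord0, [ffun i : 'I_n => J (lift ord0 i)])) => [[x J] _|J _] /=.
  by rewrite ffun_cons0; congr pair; apply/ffunP => i; rewrite ffunE ffun_consS.
apply/ffunP => i; case: (unliftP ord0 i) => [j|] ->; last by rewrite ffun_cons0.
by rewrite ffun_consS ffunE.
Qed.

Lemma sumr_finType (V : nmodType) (T : finType) (x : V) : \sum_(i : T) x = x *+ #|T|.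
Proof. by rewrite -sumr_const; apply: eq_bigl. Qed.

Lemma sum_words n D :
  \sum_(J : {ffun 'I_n.*2 -> 'I_m}) D [seq J l | l <- enum 'I_n.*2] *:
    (\prod_(j < n) a (J (even_slot j)) (J (odd_slot j)) : 'M[C]_N) = wsum n D.
Proof.
elim: n D => [|n IH] D.
  rewrite wsum0 (eq_bigr (fun _ => (D [::])%:M)); last first.
    move=> J _; rewrite big_ord0 -scalemx1; congr (D _ *: _).
    by apply: size0nil; rewrite size_map size_enum_ord.
  by rewrite sumr_finType card_ffun !card_ord double0 expn0 mulr1n.
rewrite wsumS (sum_ffun_cons (n := n.*2.+1)); apply: eq_bigr => x _.
rewrite sum_ffun_cons; apply: eq_bigr => y _.
rewrite -IH mulmx_sumr; apply: eq_bigr => J _.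
rewrite !map_ffun_cons -scalemxAr; congr (_ *: _).
rewrite big_ord_recl -[RHS]/(_ * _); congr (_ * _).
  congr (a _ _).
    by rewrite (_ : even_slot ord0 = ord0) ?ffun_cons0//; exact: val_inj.
  rewrite (_ : odd_slot ord0 = lift ord0 ord0); last exact: val_inj.
  by rewrite ffun_consS ffun_cons0.
apply: eq_bigr => j _; congr (a _ _).
  rewrite (_ : even_slot (lift ord0 j) = lift ord0 (lift ord0 (even_slot j))); last exact: val_inj.
  by rewrite !ffun_consS.
rewrite (_ : odd_slot (lift ord0 j) = lift ord0 (lift ord0 (odd_slot j))); last exact: val_inj.
by rewrite !ffun_consS.
Qed.

(** For a symmetric coefficient every permutation of the slots can be moved onto J and reindexed
    away, so the symmetrization averages (2n)! equal sums. *)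
Lemma sum_sym_prod n D : (forall J J', perm_eq J J' -> D J = D J') ->
  \sum_(J : {ffun 'I_n.*2 -> 'I_m}) D [seq J l | l <- enum 'I_n.*2] *: sym_prod a J = wsum n D.
Proof.
move=> Dp; rewrite -sum_words /sym_prod.
under eq_bigr do rewrite scalerA mulrC -scalerA scaler_sumr.
rewrite -scaler_sumr exchange_big/=.
rewrite (eq_bigr (fun _ => \sum_(J : {ffun 'I_n.*2 -> 'I_m}) D [seq J l | l <- enum 'I_n.*2] *:
    (\prod_(j < n) a (J (even_slot j)) (J (odd_slot j)) : 'M[C]_N))).
  rewrite [X in _ *: X](sumr_finType {perm 'I_n.*2}) card_Sn.
  move: (\sum_J _) => V; rewrite -(scaler_nat _ V) scalerA mulVf ?scale1r//.
move=> sg _; rewrite [RHS](reindex (fun J : {ffun 'I_n.*2 -> 'I_m} => [ffun i => J (sg i)]))/=; last first.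
  exists (fun J : {ffun 'I_n.*2 -> 'I_m} => [ffun i => J ((sg^-1)%g i)]) => J _; apply/ffunP => i.
    by rewrite !ffunE permKV.
  by rewrite !ffunE permK.
apply: eq_bigr => J _; congr (_ *: _); last by apply: eq_bigr => j _; rewrite !ffunE.
apply: Dp; rewrite [X in perm_eq _ X](eq_map (g := J \o sg)); last by move=> l /=; rewrite ffunE.
rewrite map_comp perm_sym perm_map//; apply: uniq_perm.
- by rewrite map_inj_uniq ?enum_uniq//; exact: perm_inj.
- exact: enum_uniq.
- move=> i; rewrite mem_enum; apply/mapP; exists ((sg^-1)%g i); first by rewrite mem_enum.
  by rewrite permKV.
Qed.

End words.

(** * Iterated partial derivatives and F0 *)

Section directional.
Context {R : realType} {m : nat}.
Implicit Types (F : 'rV[R]_m -> R) (x v : 'rV[R]_m).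

Lemma is_derive_cvg F x v d :
  (h^-1 *: (F (h *: v + x) - F x) @[h --> 0^'] --> d) -> is_derive x v F d.
Proof.
move=> h; split; first by apply/cvg_ex; exists d.
exact: cvg_lim.
Qed.

Lemma cvg_is_derive F x v d : is_derive x v F d ->
  (h^-1 *: (F (h *: v + x) - F x) @[h --> 0^'] --> d).
Proof. by move=> [h <-]; exact: h. Qed.

Lemma is_derive_line F x v d u :
  is_derive (u *: v + x) v F d -> is_derive (u : R) 1 (fun u => F (u *: v + x)) d.
Proof.
move=> /cvg_is_derive h; split.
  apply/cvg_ex; exists d; apply: cvg_trans h; apply: near_eq_cvg.
  by apply: nearW => k /=; rewrite scaler1 scalerDl addrA.
apply: cvg_lim => //; apply: cvg_trans h; apply: near_eq_cvg.
by apply: nearW => k /=; rewrite scaler1 scalerDl addrA.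
Qed.

Lemma line_is_derive F x v d :
  is_derive (0 : R) 1 (fun u => F (u *: v + x)) d -> is_derive x v F d.
Proof.
move=> [h hd]; apply: is_derive_cvg; rewrite -hd.
apply: cvg_trans h; apply: near_eq_cvg.
by apply: nearW => k /=; rewrite scaler1 addr0 scale0r add0r.
Qed.

Section under_integral.
Context d (Y : measurableType d) (mu : {measure set Y -> \bar R}) (D : set Y).
Hypothesis mD : measurable D.
Variables (f df : 'rV[R]_m -> Y -> R) (x v : 'rV[R]_m) (e : R) (g : Y -> R).
Hypothesis e0 : 0 < e.
Hypothesis intf : forall u : R, `|u| < e -> mu.-integrable D (EFin \o f (u *: v + x)).
Hypothesis derf : forall (u : R) y, `|u| < e -> D y ->
  is_derive (u *: v + x) v (f ^~ y) (df (u *: v + x) y).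
Hypothesis intg : mu.-integrable D (EFin \o g).
Hypothesis df_le : forall (u : R) y, `|u| < e -> D y -> `|df (u *: v + x) y| <= g y.

(** On the line u -> u v + x this is one-variable differentiation under the integral over ]-e, e[,
    dominated by |g|. *)
Lemma is_derive_under_integral :
  is_derive x v (fun z => \int[mu]_(y in D) f z y) (\int[mu]_(y in D) df x y).
Proof.
have eI (u : R) : `](- e), e[%classic u -> `|u| < e.
  by rewrite /= in_itv/= ltr_norml.
apply: line_is_derive.
have L : forall (u : R) y, `](- e), e[%classic u -> D y ->
    is_derive u 1 (fun u => f (u *: v + x) y) (df (u *: v + x) y).
  by move=> u y /eI ue Dy; apply: (@is_derive_line (f ^~ y)); exact: derf.
have I0 : `](- e), e[%classic (0 : R) by rewrite /= in_itv/= e0 oppr_lt0 e0.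
have /= := @cvg_differentiation_under_integral R d Y mu (fun u y => f (u *: v + x) y) D mD 0
  (- e) e I0 _ _ (fun y => `|g y|) => H.
have E : \int[mu]_(y in D) df x y = \int[mu]_(y in D) partial1of2 (fun (u : R) y => f (u *: v + x) y) 0 y.
  apply: eq_Rintegral => y /set_mem Dy; rewrite partial1of2E.
  by have [_ ->] := L _ _ I0 Dy; rewrite scale0r add0r.
rewrite E; have {}H : h^-1 *: (\int[mu]_(y in D) f ((h + 0) *: v + x) y - \int[mu]_(y in D) f (0 *: v + x) y)
   @[h --> (0:R)^'] --> \int[mu]_(y in D) partial1of2 (fun (u : R) y => f (u *: v + x) y) 0 y.
  apply: H => //.
  - by move=> u /eI; exact: intf.
  - by move=> u y Iu Dy; have [] := L _ _ Iu Dy.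
  - exact: integrable_norm.
  - move=> u y Iu Dy; rewrite partial1of2E; have [_ ->] := L _ _ Iu Dy.
    by apply: le_trans (ler_norm _); apply: df_le => //; exact: eI.
split; first by apply/cvg_ex; eexists; under eq_fun do rewrite scaler1; exact: H.
by apply: cvg_lim; [exact: Rhausdorff|under eq_fun do rewrite scaler1; exact: H].
Qed.

End under_integral.

End directional.

Section families.
Context {R : realType} {m : nat}.
Local Notation C := R[i].
Local Notation Re := (@complex.Re R).
Local Notation Im := (@complex.Im R).

Lemma is_derive_sumr (I : eqType) (r : seq I) (f : I -> 'rV[R]_m -> R) (df : I -> R) x v :
  (forall i, i \in r -> is_derive x v (f i) (df i)) ->
  is_derive x v (fun z => \sum_(i <- r) f i z) (\sum_(i <- r) df i).
Proof.
elim: r => [|i r IH] fE.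
  rewrite big_nil (_ : (fun z => _) = cst 0); first exact: is_derive_cst.
  by apply/funext => z; rewrite big_nil.
rewrite big_cons (_ : (fun z => _) = f i + (fun z => \sum_(j <- r) f j z)); last first.
  by apply/funext => z; rewrite big_cons.
apply: is_deriveD; first by apply: fE; rewrite mem_head.
by apply: IH => j jr; apply: fE; rewrite in_cons jr orbT.
Qed.

(** [P J] is a candidate for the iterated derivative of [P [::]], up to order M. Explicit candidates
    reduce iterated derivatives to single ones. *)
Definition derivative_family (U : set 'rV[R]_m) (M : nat) (P : seq 'I_m -> 'rV[R]_m -> R) :=
  forall J nu x, (size J < M)%N -> U x ->
    is_derive x (delta_mx 0 nu) (P J) (P (nu :: J) x).

Lemma partials_family U M P J x : open U -> derivative_family U M P ->
  (size J <= M)%N -> U x -> partials J (P [::]) x = P J x.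
Proof.
move=> oU fP; elim: J x => [//|j J IH] x /= sJ Ux.
have [_ <-] := fP J j x sJ Ux.
(* The induction hypothesis is an identity on [U] only; openness lets it pass under the
   derivative. *)
apply: near_eq_derive; near=> z; apply: IH; first exact: ltnW.
by near: z; exact: open_nbhs_nbhs.
Unshelve. all: by end_near. Qed.

Variables (N : nat) (a : 'I_m -> 'I_m -> 'M[C]_N).

Lemma mx_partial_wsum U M (P : seq 'I_m -> 'rV[R]_m -> C) (al : C) k K nu x f :
  open U -> derivative_family U M (fun J x => Re (P J x)) ->
  derivative_family U M (fun J x => Im (P J x)) ->
  (size K + k.*2 < M)%N -> U x ->
  (forall z, U z -> f z = al *: wsum a k (fun J => P (K ++ J) z)) ->
  mx_partial nu f x = al *: wsum a k (fun J => P ((nu :: K) ++ J) x).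
Proof.
move=> oU fR fI sK Ux fE.
pose co i j (w : seq 'I_m * 'M[C]_N) : C := al * w.2 i j.
(* Complex coefficients mix real and imaginary parts, while [partial] acts on real functions; hence
   the expansion of both. *)
have E i j (D : seq 'I_m -> C) : (al *: wsum a k D) i j =
    (\sum_(w <- words a k) (Re (co i j w) * Re (D w.1) - Im (co i j w) * Im (D w.1))) +i*
    (\sum_(w <- words a k) (Re (co i j w) * Im (D w.1) + Im (co i j w) * Re (D w.1))).
  rewrite mxE /wsum summxE big_distrr/=.
  elim: (words a k) => [|w r IH]; first by rewrite !big_nil.
  rewrite !big_cons IH mxE mulrCA (mulrC _ (al * _)) -/(co i j w).
  by case: (co i j w) => p q; case: (D w.1) => u v.
have fnear : \forall z \near x, U z by exact: open_nbhs_nbhs.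
apply/matrixP => i j; rewrite mxE E; congr (_ +i* _).
- rewrite /partial (near_eq_derive (g := fun z => \sum_(w <- words a k)
     (Re (co i j w) * Re (P (K ++ w.1) z) - Im (co i j w) * Im (P (K ++ w.1) z)))); last first.
    by near=> z; rewrite fE ?E//; near: z.
  apply: derive_val; apply: is_derive_sumr => w /size_words sw.
  have sKw : (size (K ++ w.1) < M)%N by rewrite size_cat sw.
  have dR := fR _ nu x sKw Ux; have dI := fI _ nu x sKw Ux.
  by apply: is_deriveB; apply: is_deriveZ.
- rewrite /partial (near_eq_derive (g := fun z => \sum_(w <- words a k)
     (Re (co i j w) * Im (P (K ++ w.1) z) + Im (co i j w) * Re (P (K ++ w.1) z)))); last first.
    by near=> z; rewrite fE ?E//; near: z.
  apply: derive_val; apply: is_derive_sumr => w /size_words sw.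
  have sKw : (size (K ++ w.1) < M)%N by rewrite size_cat sw.
  have dR := fR _ nu x sKw Ux; have dI := fI _ nu x sKw Ux.
  by apply: is_deriveD; apply: is_deriveZ.
Unshelve. all: by end_near. Qed.

(** Each F_0 prepends two indices to J and one letter to the words. The formula is carried on the
    whole open set [U], because the next derivative needs it in a neighbourhood; off [U] the
    function [f0] is arbitrary. *)
Lemma iter_F0 U M (P : seq 'I_m -> 'rV[R]_m -> C) (f0 : 'rV[R]_m -> C) (al : R) k x :
  open U -> (forall z, U z -> f0 z = P [::] z) -> derivative_family U M (fun J x => Re (P J x)) ->
  derivative_family U M (fun J x => Im (P J x)) ->
  (k.*2 <= M)%N -> U x ->
  iter k (fun f z => al%:C *: F0 a f z) (fun z => (f0 z)%:M) x =
  ((- al) ^+ k)%:C *: wsum a k (fun J => P J x).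
Proof.
move=> oU f0E fR fI; elim: k x => [|k IH] x kM Ux.
  by rewrite /= expr0 wsum0 scale1r f0E.
rewrite iterS {1}/F0 wsumS scalerN -scaleNr exprS rmorphM/= rmorphN/= -scalerA; congr (_ *: _).
rewrite scaler_sumr; apply: eq_bigr => i _; rewrite scaler_sumr; apply: eq_bigr => j _.
rewrite scalemxAr; congr (_ *m _).
have H1 z : U z -> mx_partial j (iter k (fun f z => al%:C *: F0 a f z) (fun z => (f0 z)%:M)) z =
    ((- al) ^+ k)%:C *: wsum a k (fun J => P ([:: j] ++ J) z).
  move=> Uz; apply: (@mx_partial_wsum U M P _ k [::] j z _ oU fR fI) => //.
    by rewrite (leq_trans _ kM)// doubleS.
  by move=> y Uy; apply: IH => //; apply: leq_trans kM; rewrite leq_double.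
rewrite -[RHS]/(_ *: wsum a k (fun J => P ([:: i; j] ++ J) x)).
apply: (@mx_partial_wsum U M P _ k [:: j] i x _ oU fR fI) => //.
Qed.

End families.

Section remainder_derivatives.
Context {R : realType} {m : nat}.
Local Notation E := (m.-tuple (measurableTypeR R)).
Local Notation lam := (lebesgue_Rn R m).
Implicit Types (J : seq 'I_m) (w : 'rV[R]_m) (t : R) (p : E).
Local Notation e nu := (delta_mx 0 nu : 'rV[R]_m).

Lemma dott_line nu (u : R) w p : dott (u *: e nu + w) p = u * tnth p nu + dott w p.
Proof.
rewrite !dottE (bigD1 nu)//= (bigD1 nu (P := xpredT))//= addrA; congr (_ + _).
  by rewrite !mxE !eqxx mulr1; ring.
by apply: eq_bigr => j /negbTE jn; rewrite !mxE jn mulr0 add0r.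
Qed.

Lemma l1norm_line nu (u : R) w : `|u| <= 1 -> l1norm (u *: e nu + w) <= l1norm w + 1.
Proof.
move=> u1; rewrite /l1norm (bigD1 nu)//= [leRHS]addrC [X in 1 + X](bigD1 nu)//= addrA lerD//.
  by rewrite !mxE !eqxx mulr1 (le_trans (ler_normD _ _))// lerD.
by apply: ler_sum => j /negbTE jn; rewrite !mxE jn mulr0 add0r.
Qed.

Lemma is_derive_dott (f df : R -> R) nu w p : (forall u : R, is_derive u 1 f (df u)) ->
  is_derive w (e nu) (fun w => f (dott w p)) (tnth p nu * df (dott w p)).
Proof.
move=> fd; apply: line_is_derive.
rewrite (_ : (fun u : R => _) = f \o (fun u : R => u * tnth p nu + dott w p)); last first.
  by apply/funext => u /=; rewrite dott_line.
rewrite mulrC.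
have fd0 := fd (0 * tnth p nu + dott w p).
have ld : is_derive (0 : R) 1 (fun u : R => u * tnth p nu + dott w p) (tnth p nu).
  rewrite (_ : (fun u : R => _) = (tnth p nu *: (id : R -> R)) + cst (dott w p)); last first.
    by apply/funext => u; rewrite mulrC.
  apply: (is_derive_eq (is_deriveD (is_deriveZ _ (is_derive_id _ _)) (is_derive_cst _ _ _))).
  by rewrite addr0; exact: mulr1.
rewrite [X in df X](_ : _ = 0 * tnth p nu + dott w p); last by rewrite mul0r add0r.
exact: is_derive1_comp.
Qed.

Lemma is_derive_mon_integral (f df : R -> R) J nu (g h : E -> R) w :
  (forall u : R, is_derive u 1 f (df u)) ->
  (forall u : R, `|u| < 1 -> lam.-integrable setT
     (EFin \o (fun p => mon J p * f (dott (u *: e nu + w) p) * g p))) ->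
  lam.-integrable setT (EFin \o h) ->
  (forall (u : R) p, `|u| < 1 ->
     `|mon (nu :: J) p * df (dott (u *: e nu + w) p) * g p| <= h p) ->
  is_derive w (e nu) (fun w => \int[lam]_p (mon J p * f (dott w p) * g p))
    (\int[lam]_p (mon (nu :: J) p * df (dott w p) * g p)).
Proof.
move=> fd intf inth dle.
apply: (@is_derive_under_integral _ _ _ _ _ setT measurableT
  (fun w p => mon J p * f (dott w p) * g p)
  (fun w p => mon (nu :: J) p * df (dott w p) * g p) w (e nu) 1 h) => //; last by move=> u p u1 _; exact: dle.
move=> u p u1 _.
have D := is_derive_dott nu (u *: e nu + w) p fd.
rewrite (_ : (fun w => _) = (fun w => (mon J p * g p) *: (f (dott w p) : R^o))); last first.
  by apply/funext => z; rewrite -[RHS]/(_ * _); ring.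
apply: (is_derive_eq (is_deriveZ _ D)).
by rewrite -[LHS]/(_ * _) mon_cons; ring.
Qed.

Lemma is_derive_osc J q n t nu w : (size J + q.+1 = n.*2)%N -> 0 < t ->
  is_derive w (e nu) (osc J q.+1 n t) (osc (nu :: J) q n t w).
Proof.
(* The 1 added to [l1norm w] is room for the displacement |u| < 1 along the coordinate line. *)
move=> Jq t0; apply: (is_derive_mon_integral (f := trem q.+1)
  (h := fun p => (l1norm w + 1) ^+ q * expR (- (t * sqt p)))).
- exact: is_derive_trem.
- by move=> u _; apply: integrable_core => //; rewrite Jq ?odd_double.
- rewrite (_ : EFin \o _ = (fun p => ((l1norm w + 1) ^+ q)%:E * (expR (- (t * sqt p)))%:E)%E)//.
  by apply: integrableZl => //; exact: integrable_gauss.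
- move=> u p u1; apply: le_trans (core_le _ _ _ _) _; first by rewrite /= -Jq addSnnS.
  apply: ler_wpM2r; first exact: expR_ge0.
  by apply: lerXn2r; rewrite ?nnegrE ?addr_ge0 ?l1norm_ge0// l1norm_line// ltW.
Qed.

(** Scaling in t|xi|^2: half of the exponent absorbs |xi|^k at the price of t^(-k/2). *)
Lemma sqrt_gauss_le k : exists2 C : R, 0 < C & forall t p, 0 < t ->
  Num.sqrt (sqt p) ^+ k * expR (- (t * sqt p)) <=
  C * t `^ (- (k%:R / 2)) * expR (- (t / 2 * sqt p)).
Proof.
have [C C0 CP] := @powR_expR_bounded R 2^-1 (k%:R / 2) ltac:(by rewrite invr_gt0).
exists C => // t p t0; have s0 := sqt_ge0 p.
have -> : expR (- (t * sqt p)) = expR (- (2^-1 * (t * sqt p))) * expR (- (t / 2 * sqt p)).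
  by rewrite -expRD; congr expR; field.
rewrite mulrA; apply: ler_wpM2r; first exact: expR_ge0.
have tp : 0 < t `^ (k%:R / 2) by rewrite powR_gt0.
rewrite powRN ler_pdivlMr// mulrAC.
apply: le_trans (CP (t * sqt p) _); last by rewrite mulr_ge0// ltW.
apply: ler_wpM2r; first exact: expR_ge0.
rewrite -powR_mulrn ?sqrtr_ge0// -powR12_sqrt// -powRrM mulrC (mulrC 2^-1) -powRM ?(ltW t0)//.
by apply: ge0_ler_powR; rewrite ?nnegrE ?divr_ge0 ?addr_ge0 ?mulr_ge0 ?(ltW t0)// lerDr.
Qed.

Lemma mon_gauss_le J : exists2 C : R, 0 < C & forall t p, 0 < t ->
  `|mon J p| * expR (- (t * sqt p)) <=
  C * t `^ (- ((size J)%:R / 2)) * expR (- (t / 2 * sqt p)).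
Proof.
have [C C0 CP] := sqrt_gauss_le (size J); exists C => // t p t0.
by apply: le_trans (CP _ p t0); apply: ler_wpM2r; [exact: expR_ge0|exact: mon_le].
Qed.

Lemma trem01_le1 q u : (q <= 1)%N -> `|trem q u : R| <= 1.
Proof.
by case: q => [|[|]]// _; [exact: normr_cos|exact: normr_sin].
Qed.

Lemma core0E J q t w p : core J q 0 t w p = mon J p * trem q (dott w p) * expR (- (t * sqt p)).
Proof. by rewrite /core /gw expr0 invr1 mul1r. Qed.

Lemma integrable_core0 J q t w : (q <= 1)%N -> 0 < t ->
  lam.-integrable setT (EFin \o core J q 0 t w).
Proof.
move=> q1 t0; have [C C0 CP] := mon_gauss_le J.
apply: (@integrable_gauss_dom _ _ (t / 2) (C * t `^ (- ((size J)%:R / 2))) 0).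
- by rewrite divr_gt0.
- exact: measurable_core.
- move=> p; rewrite core0E expr0 mul1r; apply: le_trans (CP _ p t0).
  rewrite !normrM (ger0_norm (expR_ge0 _)) -mulrA; apply: ler_wpM2l => //.
  by apply: ler_piMl; rewrite ?expR_ge0 ?trem01_le1.
Qed.

(** With no inverse power there is nothing to balance between J and q: cosine and sine alternate,
    and any number of derivatives may be taken. *)
Lemma is_derive_osc0 J t nu w : 0 < t ->
  is_derive w (e nu) (osc J 0 0 t) (- osc (nu :: J) 1 0 t w) /\
  is_derive w (e nu) (osc J 1 0 t) (osc (nu :: J) 0 0 t w).
Proof.
move=> t0; have [C C0 CP] := mon_gauss_le (nu :: J).
pose h p := C * t `^ (- ((size (nu :: J))%:R / 2)) * expR (- (t / 2 * sqt p)).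
have ih : lam.-integrable setT (EFin \o h).
  rewrite (_ : _ \o _ = (fun p => (C * t `^ (- ((size (nu :: J))%:R / 2)))%:E *
    (expR (- (t / 2 * sqt p)))%:E)%E)//.
  by apply: integrableZl => //; apply: integrable_gauss; rewrite divr_gt0.
have hle (c : R) (p : E) : `|c| <= 1 -> `|mon (nu :: J) p * c * gw 0 t p| <= h p.
  move=> c1; apply: le_trans (CP _ p t0).
  rewrite /gw expr0 invr1 mul1r !normrM (ger0_norm (expR_ge0 _)) -mulrA.
  by apply: ler_wpM2l => //; apply: ler_piMl; rewrite ?expR_ge0.
split.
- rewrite (_ : - _ = \int[lam]_p (mon (nu :: J) p * (- trem 1 (dott w p)) * gw 0 t p)); last first.
    rewrite /osc -mulN1r -RintegralZl//; last exact: integrable_core0.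
    by apply: eq_Rintegral => p _; rewrite /core; ring.
  apply: (is_derive_mon_integral (f := trem 0) (df := fun u => - trem 1 u) _ _ ih).
  + by move=> u _; exact: integrable_core0.
  + by move=> u p _; apply: hle; rewrite normrN trem01_le1.
- apply: (is_derive_mon_integral (f := trem 1) _ _ ih).
  + by move=> u _; exact: integrable_core0.
  + by move=> u p _; apply: hle; rewrite trem01_le1.
Qed.

End remainder_derivatives.

(** * Behaviour near t = 0 *)

Section remainder_bounds.
Context {R : realType} {m : nat}.
Local Notation mu := (@lebesgue_measure R).
Local Notation E := (m.-tuple (measurableTypeR R)).
Local Notation lam := (lebesgue_Rn R m).
Implicit Types (J : seq 'I_m) (w : 'rV[R]_m) (s t : R) (p : E).
Local Notation e nu := (delta_mx 0 nu : 'rV[R]_m).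

(** The signed counterpart of [integral_gw_tail], integrated over xi: k integrations over tails lead
    from the Gaussian integrals with k = 0 to those with |xi|^(-2k). *)
Lemma osc_tail J q k n t w : (size J + q = n.*2)%N -> (k < n)%N -> 0 < t ->
  mu.-integrable `]t, +oo[ (fun s => (osc J q k s w)%:E) /\
  \int[mu]_(s in `]t, +oo[) osc J q k s w = osc J q k.+1 t w.
Proof.
move=> Jq kn t0.
have a0 p : sqt p = 0 -> `|mon J p * trem q (dott w p)| = 0.
  move=> p0; apply/eqP; rewrite -normr_le0 normr_id.
  apply: le_trans (mon_trem_le J q p w) _.
  by rewrite p0 sqrtr0 Jq expr0n double_eq0 (gtn_eqF (leq_ltn_trans (leq0n k) kn)) mulr0.
have tailE := integral_gw_tail k t a0 (fun p => normr_ge0 _).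
have mD : measurable `]t, +oo[%classic by [].
have mtail p : measurable_fun setT (fun s : measurableTypeR R => core J q k s w p).
  by apply: (measurable_slice2 (f := fun z => core J q k z.1 w z.2)); exact: measurable_core2.
have ci : ~~ odd (size J + q) by rewrite Jq odd_double.
have absE s p : (`|core J q k s w p|%:E = (`|mon J p * trem q (dott w p)| * gw k s p)%:E)%E.
  by rewrite /core normrM (ger0_norm (gw_ge0 _ _ _)).
have itail p : mu.-integrable `]t, +oo[ (fun s => (core J q k s w p)%:E).
  apply/integrableP; split.
    by apply/measurable_EFinP; exact: measurable_funTS.
  rewrite (_ : integral _ _ _ = (`|mon J p * trem q (dott w p)| * gw k.+1 t p)%:E) ?ltry//.
  by rewrite -tailE; apply: eq_integral => s _; rewrite /= -absE.
have i3 : lam.-integrable setT (EFin \o core J q k.+1 t w).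
  by apply: integrable_core => //; rewrite Jq leq_double.
have i1 s : `]t, +oo[%classic s -> lam.-integrable setT (fun p => (core J q k s w p)%:E).
  rewrite /= in_itv/= andbT => ts; apply: integrable_core => //; last exact: lt_trans ts.
  by rewrite Jq leq_double ltnW.
have fin : (\int[lam]_p \int[mu]_(s in `]t, +oo[) `|core J q k s w p|%:E < +oo)%E.
  rewrite (_ : integral _ _ _ = (\int[lam]_p `|(core J q k.+1 t w p)%:E|)%E).
    by case/integrableP : i3.
  apply: eq_integral => p _; under eq_integral do rewrite absE.
  by rewrite tailE /= [in RHS]/core [in RHS]normrM (ger0_norm (gw_ge0 _ _ _)).
have [I1 I2] := @fubini_restrict R m `]t, +oo[ (fun z => core J q k z.1 w z.2) mD
  (measurable_core2 J q k w) i1 itail fin.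
split; first exact: I1.
rewrite -I2 /osc; apply: eq_Rintegral => p _ /=.
(* The prefactor does not depend on s, so its sign comes out and the tail formula for nonnegative
   integrands applies. *)
have E1 : \int[mu]_(s in `]t, +oo[) core J q k s w p = Num.sg (mon J p * trem q (dott w p)) *
    \int[mu]_(s in `]t, +oo[) (`|mon J p * trem q (dott w p)| * gw k s p).
  rewrite -RintegralZl//.
    by apply: eq_Rintegral => s _; rewrite mulrA -numEsg.
  have := integrable_norm (itail p).
  by apply: eq_integrable => // s _; rewrite /= -absE.
by rewrite E1 /Rintegral tailE /= mulrA -numEsg.
Qed.

(** Polynomials in the coordinates of [w] and in 1/s. Only their stability under derivatives in [w]
    and a bound by a power of 1 + 1/s matter, and both follow by induction on the construction. *)
Inductive gpoly : (R -> 'rV[R]_m -> R) -> Prop :=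
| gpoly_cst c : gpoly (fun _ _ => c)
| gpoly_coord j : gpoly (fun _ w => w 0 j)
| gpoly_inv : gpoly (fun s _ => s^-1)
| gpoly_add f g : gpoly f -> gpoly g -> gpoly (fun s w => f s w + g s w)
| gpoly_mul f g : gpoly f -> gpoly g -> gpoly (fun s w => f s w * g s w).

Lemma gpoly_derive f nu : gpoly f ->
  exists2 g, gpoly g & forall s w, is_derive w (e nu) (f s) (g s w).
Proof.
elim=> [c|j||f1 f2 _ [g1 G1 D1] _ [g2 G2 D2]|f1 f2 F1 [g1 G1 D1] F2 [g2 G2 D2]].
- exists (fun _ _ => 0); first exact: gpoly_cst.
  by move=> s w; exact: is_derive_cst.
- exists (fun _ _ => (nu == j)%:R); first exact: gpoly_cst.
  move=> s w; apply: is_derive_cvg; apply: cvg_near_cst.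
  near=> h; have h0 : h != 0 by near: h; exact: nbhs_dnbhs_neq.
  by rewrite !mxE eqxx/= addrK eq_sym -[LHS]/(_ * _) mulKf.
- exists (fun _ _ => 0); first exact: gpoly_cst.
  by move=> s w; exact: is_derive_cst.
- exists (fun s w => g1 s w + g2 s w); first exact: gpoly_add.
  by move=> s w; exact: is_deriveD.
- exists (fun s w => f1 s w * g2 s w + f2 s w * g1 s w).
    by apply: gpoly_add; exact: gpoly_mul.
  by move=> s w; exact: is_deriveM.
Unshelve. all: by end_near. Qed.

Lemma coord_le w j : `|w 0 j| <= l1norm w.
Proof. by rewrite /l1norm (bigD1 j)//= lerDl sumr_ge0. Qed.

Lemma gpoly_le f B : 0 <= B -> gpoly f -> exists C k, 0 <= C /\
  forall s w, 0 < s -> l1norm w <= B -> `|f s w| <= C * (1 + s^-1) ^+ k.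
Proof.
move=> B0.
have s1 s : 0 < s -> 1 <= 1 + s^-1 by move=> s0; rewrite lerDl invr_ge0 ltW.
elim=> [c|j||f1 f2 _ [C1 [k1 [C10 H1]]] _ [C2 [k2 [C20 H2]]]
  |f1 f2 _ [C1 [k1 [C10 H1]]] _ [C2 [k2 [C20 H2]]]].
- by exists `|c|, 0%N; split=> // s w _ _; rewrite expr0 mulr1.
- exists B, 0%N; split=> // s w _ wB; rewrite expr0 mulr1.
  exact: le_trans (coord_le _ _) wB.
- exists 1, 1%N; split=> // s w s0 _; rewrite mul1r expr1 ger0_norm ?invr_ge0 ?(ltW s0)//.
  by rewrite lerDr.
- exists (C1 + C2), (k1 + k2)%N; split; first exact: addr_ge0.
  move=> s w s0 wB; rewrite mulrDl (le_trans (ler_normD _ _))// lerD//.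
    apply: le_trans (H1 _ _ s0 wB) _; apply: ler_wpM2l => //.
    by apply: ler_weXn2l; [exact: s1|exact: leq_addr].
  apply: le_trans (H2 _ _ s0 wB) _; apply: ler_wpM2l => //.
  by apply: ler_weXn2l; [exact: s1|exact: leq_addl].
- exists (C1 * C2), (k1 + k2)%N; split; first exact: mulr_ge0.
  move=> s w s0 wB; rewrite normrM exprD mulrACA.
  by apply: ler_pM => //; [exact: H1|exact: H2].
Qed.

Lemma sqnorm_line nu (u : R) w : sqnorm (u *: e nu + w) = sqnorm w + u * (2 * w 0 nu + u).
Proof.
rewrite /sqnorm /dotr (bigD1 nu)//= [in RHS](bigD1 nu)//=.
rewrite (eq_bigr (fun j => w 0 j * w 0 j)); last first.
  by move=> j /negbTE jn; rewrite !mxE jn mulr0 add0r.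
by rewrite !mxE !eqxx mulr1; ring.
Qed.

Lemma is_derive_sqnorm nu w : is_derive w (e nu) (@sqnorm R m) (2 * w 0 nu).
Proof.
apply: is_derive_cvg.
have : 2 * w 0 nu + h @[h --> (0 : R)^'] --> 2 * w 0 nu + 0.
  by apply: cvgD; [exact: cvg_cst|exact: nbhs_dnbhs].
rewrite addr0 => H; apply: cvg_trans H; apply: near_eq_cvg; near=> h.
have h0 : h != 0 by near: h; exact: nbhs_dnbhs_neq.
by rewrite sqnorm_line addrAC subrr add0r -[RHS]/(_ * _) mulKf.
Unshelve. all: by end_near. Qed.

(** The integral of cos(xi.w) e^(-s|xi|^2) over xi. *)
Definition gaussian s w : R := (pi / s) `^ (m%:R / 2) * expR (- (sqnorm w / (4 * s))).

Lemma is_derive_gaussian s nu w :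
  is_derive w (e nu) (gaussian s) (- (2^-1 * (s^-1 * w 0 nu)) * gaussian s w).
Proof.
have D1 := is_derive_sqnorm nu w.
have D2 : is_derive w (e nu) (fun w => (- (4 * s)^-1) *: (sqnorm w : R^o)) (- (4 * s)^-1 *: (2 * w 0 nu)).
  exact: is_deriveZ.
have D3 : is_derive w (e nu) (fun w => expR (- (4 * s)^-1 * sqnorm w))
    (expR (- (4 * s)^-1 * sqnorm w) * (- (4 * s)^-1 * (2 * w 0 nu))).
  apply: line_is_derive.
  have L : is_derive (0 : R) 1 (fun u : R => (- (4 * s)^-1) *: (sqnorm (u *: e nu + w) : R^o))
     (- (4 * s)^-1 *: (2 * w 0 nu)).
    apply: (@is_derive_line _ _ (fun w => (- (4 * s)^-1) *: (sqnorm w : R^o))).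
    by rewrite scale0r add0r.
  have X := is_derive_expR (- (4 * s)^-1 *: (sqnorm ((0 : R) *: e nu + w))).
  have := @is_derive1_comp R expR (fun u : R => (- (4 * s)^-1) *: (sqnorm (u *: e nu + w) : R^o)) _ _ _ X L.
  by rewrite scale0r add0r.
rewrite (_ : gaussian s = (fun w => (pi / s) `^ (m%:R / 2) *: (expR (- (4 * s)^-1 * sqnorm w) : R^o))); last first.
  apply/funext => z; rewrite /gaussian -[RHS]/(_ * _); congr (_ * expR _).
  by rewrite mulNr mulrC.
apply: (is_derive_eq (is_deriveZ _ D3)).
have h : (4 * s)^-1 * 2 = 2^-1 * s^-1 by rewrite invfM mulrAC; congr (_ * _); field.
have h2 : - (4 * s)^-1 * (2 * w 0 nu) = - (2^-1 * (s^-1 * w 0 nu)) by rewrite mulNr; congr (- _); rewrite [LHS]mulrA [RHS]mulrA h.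
rewrite -![_ *: _]/(_ * _) h2; move: (expR _) (_ `^ _) => X Y; ring.
Qed.

Lemma is_derive_unique (F : 'rV[R]_m -> R) x v d d' :
  is_derive x v F d -> is_derive x v F d' -> d = d'.
Proof. by move=> [_ <-] [_ <-]. Qed.

Lemma Phi0 (z : R) : (0 < m)%N -> Phi m 0 z = expR z.
Proof.
move=> m0; rewrite /Phi /expR; congr (limn _); apply/funext => K.
rewrite /series/=; apply: eq_bigr => k _; rewrite subr0 invfM mulrA mulfV ?mul1r.
  by rewrite /exp_coeff mulrC.
by rewrite gt_eqF// Gamma_gt0// ltr_pwDl// divr_gt0// ltr0n.
Qed.

Hypothesis m0 : (0 < m)%N.

(* Without the factor |xi|^-2n the integrals are partial derivatives of a Gaussian. *)
Lemma osc_gpoly J q : (q <= 1)%N ->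
  exists2 f, gpoly f & forall s w, 0 < s -> osc J q 0 s w = f s w * gaussian s w.
Proof.
elim: J q => [|nu J IH] q q1.
  exists (fun _ _ => (q == 0%N)%:R); first exact: gpoly_cst.
  (* Without indices the cosine gives Phi_0, which is the exponential, and the sine integrand is
     odd. *)
  move=> s w s0; case: q q1 => [|[|]]// _.
    have := Phi_osc m0 0 w s0; rewrite double0 expr0 mul1r mul1r => ->.
    rewrite Phi0// /gaussian sub0r powRN powRM ?pi_ge0 ?invr_ge0 ?(ltW s0)//.
    by rewrite -(powR_inv1 (ltW s0)) -powRrM mulN1r powRN.
  rewrite mul0r; apply: Rintegral_odd; first exact: measurable_core.
  move=> p; rewrite !core0E mon_opp dott_opp tremN sqt_opp expr0 expr1; ring.
(* [1 - q] exchanges cosine and sine, as differentiation does. *)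
have [f F fE] := IH (1 - q)%N (leq_subr _ _).
have [f' F' Df] := gpoly_derive nu F.
pose g s w := f' s w + f s w * (- 2^-1 * (s^-1 * w 0 nu)).
have G : gpoly g.
  apply: gpoly_add => //; apply: gpoly_mul => //; apply: gpoly_mul; first exact: gpoly_cst.
  by apply: gpoly_mul; [exact: gpoly_inv|exact: gpoly_coord].
have Dg s w : 0 < s -> is_derive w (e nu) (osc J (1 - q)%N 0 s) (g s w * gaussian s w).
  move=> s0; rewrite (_ : osc _ _ _ _ = f s * gaussian s); last by apply/funext => z; rewrite fE.
  have D1 := Df s w; have D2 := is_derive_gaussian s nu w.
  apply: (is_derive_eq (is_deriveM D1 D2)).
  by rewrite -![_ *: _]/(_ * _) /g; ring.
case: q q1 fE Dg => [|[|]]// _ fE Dg.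
  exists g => // s w s0.
  by apply: is_derive_unique (Dg s w s0); have [] := is_derive_osc0 J nu w s0.
exists (fun s w => -1 * g s w); first by apply: gpoly_mul => //; exact: gpoly_cst.
move=> s w s0; rewrite mulN1r mulNr; apply/eqP; rewrite -eqr_oppLR; apply/eqP.
by apply: is_derive_unique (Dg s w s0); have [] := is_derive_osc0 J nu w s0.
Qed.

(** For |w|^2 >= r the factor e^(-r/(4s)) beats every power of 1/s, so the exponent is free; it will
    be matched with the one valid for large s. *)
Lemma le_osc0_small J q (al r B : R) : (q <= 1)%N -> 0 < r -> 0 <= B -> 0 <= al ->
  exists2 C, 0 <= C & forall s w, 0 < s -> s <= 1 -> r <= sqnorm w -> l1norm w <= B ->
    `|osc J q 0 s w| <= C * s `^ (- al).
Proof.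
move=> q1 r0 B0 al0; have [f F fE] := osc_gpoly J q1.
have [C [k [C0 fC]]] := gpoly_le B0 F.
have r4 : 0 < r / 4 by rewrite divr_gt0.
have [D D0 DP] := @powR_expR_bounded R (r / 4) (k%:R + m%:R / 2) r4.
exists (C * pi `^ (m%:R / 2) * D); first by rewrite !mulr_ge0 ?powR_ge0 ?(ltW D0).
move=> s w s0 s1 rw wB; rewrite fE// normrM.
have i0 : 0 <= s^-1 by rewrite invr_ge0 ltW.
have s1' : 1 <= s `^ (- al).
  by rewrite powRN invr_ge1 ?unitfE ?gt_eqF ?powR_gt0// -(powRr0 s) ger_powR ?s0.
apply: (@le_trans _ _ (C * pi `^ (m%:R / 2) * D)); last first.
  by rewrite ler_peMr// !mulr_ge0 ?powR_ge0 ?(ltW D0).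
have gE : `|gaussian s w| <= pi `^ (m%:R / 2) * ((1 + s^-1) `^ (m%:R / 2) * expR (- (r / 4 * s^-1))).
  rewrite ger0_norm ?mulr_ge0 ?powR_ge0 ?expR_ge0// /gaussian powRM ?pi_ge0// -mulrA.
  apply: ler_wpM2l; first exact: powR_ge0.
  apply: ler_pM; rewrite ?powR_ge0 ?expR_ge0//.
    by apply: ge0_ler_powR; rewrite ?nnegrE ?addr_ge0 ?divr_ge0// lerDr.
  rewrite ler_expR lerN2 invfM mulrA; apply: ler_wpM2r => //.
  by apply: ler_wpM2r.
apply: le_trans (ler_pM (normr_ge0 _) (normr_ge0 _) (fC _ _ s0 wB) gE) _.
rewrite mulrACA; apply: ler_wpM2l; first by rewrite mulr_ge0 ?powR_ge0.
have X0 : 0 < 1 + s^-1 by rewrite ltr_wpDr.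
rewrite mulrA -powR_mulrn ?(ltW X0)// -powRD; last by rewrite (gt_eqF X0) implybT.
exact: DP.
Qed.

(** The exponent is dimensional: |xi|^(2n) contributes s^(-n) and the Gaussian mass s^(-m/2). *)
Lemma le_osc0_power J q n (K B : R) : ~~ odd (size J + q) -> 0 <= K ->
  (forall w p, l1norm w <= B ->
     `|mon J p * trem q (dott w p)| <= K * Num.sqrt (sqt p) ^+ n.*2) ->
  exists2 C, 0 <= C & forall s w, 0 < s -> l1norm w <= B ->
    `|osc J q 0 s w| <= C * s `^ (- (n%:R + m%:R / 2)).
Proof.
move=> Jq K0 mtK; have [C C0 CP] := @sqrt_gauss_le R m n.*2.
exists (K * (C * (2 * pi) `^ (m%:R / 2))); first by rewrite !mulr_ge0 ?powR_ge0 ?(ltW C0).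
move=> s w s0 wB.
have s20 : 0 < s / 2 by rewrite divr_gt0.
have ic : lam.-integrable setT (EFin \o core J q 0 s w) by apply: integrable_core.
pose L := K * (C * s `^ (- (n.*2%:R / 2))).
have ig : lam.-integrable setT (EFin \o (fun p : E => L * expR (- (s / 2 * sqt p)))).
  rewrite (_ : _ \o _ = (fun p => L%:E * (expR (- (s / 2 * sqt p)))%:E)%E)//.
  by apply: integrableZl => //; exact: integrable_gauss.
have le1 : `|osc J q 0 s w| <= \int[lam]_p (L * expR (- (s / 2 * sqt p))).
  apply: le_trans (le_normr_Rintegral _ ic) _ => //.
  apply: le_Rintegral => //; first exact: integrable_norm.
  move=> p _; rewrite core0E normrM (ger0_norm (expR_ge0 _)).
  apply: le_trans (ler_wpM2r (expR_ge0 _) (mtK w p wB)) _.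
  rewrite -[leLHS]mulrA /L -[leRHS]mulrA; apply: ler_wpM2l => //.
  exact: CP.
apply: le_trans le1 _.
rewrite RintegralZl//; last exact: integrable_gauss.
rewrite /Rintegral integral_gauss0//= /L -!mulrA; apply: ler_wpM2l => //.
apply: ler_wpM2l; first exact: ltW.
have -> : n.*2%:R / 2 = n%:R :> R by rewrite -mul2n natrM mulrAC mulfV ?mul1r.
have -> : pi / (s / 2) = 2 * pi * s^-1 by rewrite invf_div mulrA (mulrC pi).
rewrite powRM ?invr_ge0 ?(ltW s0) ?mulr_ge0 ?pi_ge0// mulrCA; apply: ler_wpM2l.
  exact: powR_ge0.
rewrite -(powR_inv1 (ltW s0)) -powRrM mulN1r -powRD; last by rewrite (gt_eqF s0) implybT.
by rewrite opprD.
Qed.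

(** For s >= 1 the exponent n + m/2 may be lowered to n + 1/2, as m >= 1. *)
Lemma le_osc0_large J q n (B : R) : (size J + q = n.*2)%N -> 0 <= B ->
  exists2 C, 0 <= C & forall s w, 1 <= s -> l1norm w <= B ->
    `|osc J q 0 s w| <= C * s `^ (- (n%:R + 2^-1)).
Proof.
move=> Jq B0; have od : ~~ odd (size J + q) by rewrite Jq odd_double.
have [|C C0 H] := le_osc0_power od (exprn_ge0 q B0) (n := n) (B := B).
  move=> w p wB; apply: le_trans (mon_trem_le J q p w) _.
  rewrite Jq; apply: ler_wpM2r; first by rewrite exprn_ge0 ?sqrtr_ge0.
  by apply: lerXn2r; rewrite ?nnegrE ?l1norm_ge0.
exists C => // s w s1 wB; apply: le_trans (H s w (lt_le_trans ltr01 s1) wB) _.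
apply: ler_wpM2l => //; apply: ler_powR => //.
by rewrite lerN2 lerD2l -[leLHS]mul1r ler_wpM2r// ler1n; exact: m0.
Qed.

(** For remainder index at least 2 cosine and sine are no longer bounded, but [trem_le2] saves two
    powers of |xi|. The exponent becomes n - 1 + m/2, which is at most n + 1/2 exactly when m <=
    3. *)
Lemma le_osc0_low J q n (B : R) : (m <= 3)%N -> (size J + q.+2 = n.*2)%N -> 0 <= B ->
  exists2 C, 0 <= C & forall s w, 0 < s -> s <= 1 -> l1norm w <= B ->
    `|osc J q.+2 0 s w| <= C * s `^ (- (n%:R + 2^-1)).
Proof.
move=> m3; case: n => [|n Jq B0]; first by rewrite !addnS.
have od : ~~ odd (size J + q.+2) by rewrite Jq odd_double.
have {}Jq : (size J + q = n.*2)%N by move: Jq; rewrite !addnS doubleS => -[].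
have K0 : 0 <= 2 * B ^+ q by rewrite mulr_ge0 ?exprn_ge0.
have [|C C0 H] := le_osc0_power od K0 (n := n) (B := B).
  move=> w p wB; rewrite normrM -Jq addnC exprD mulrC [leRHS]mulrA.
  apply: ler_pM => //; last exact: mon_le.
  apply: le_trans (trem_le2 _ _) _; rewrite -mulrA -exprMn; apply: ler_wpM2l => //.
  apply: lerXn2r; rewrite ?nnegrE ?mulr_ge0 ?sqrtr_ge0//.
  by apply: le_trans (dott_le _ _) _; apply: ler_wpM2r => //; exact: sqrtr_ge0.
exists C => // s w s0 s1 wB; apply: le_trans (H s w s0 wB) _; apply: ler_wpM2l => //.
apply: ger_powR; first by rewrite s0.
rewrite lerN2 -[n.+1%:R]natr1 -addrA lerD2l.
by rewrite -[1]/(1%:R) (_ : 1%:R + 2^-1 = 3%:R / 2 :> R) ?ler_wpM2r ?ler_nat//; field.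
Qed.

(** One exponent, n + 1/2, serves both small and large s when k = 0. Each tail integration lowers it
    by one, and all of these converge because the exponent exceeds 1 as long as k < n; n of them
    leave s^(-1/2), integrable at 0. *)
Lemma le_osc_near J q n k (r B : R) : (size J + q = n.*2)%N ->
  ((q <= 1) || (m <= 3))%N -> (k <= n)%N ->
  0 < r -> 0 <= B ->
  exists2 C, 0 <= C & forall s w, 0 < s -> r <= sqnorm w -> l1norm w <= B ->
    `|osc J q k s w| <= C * s `^ (- (n%:R - k%:R + 2^-1)).
Proof.
move=> Jq qm kn r0 B0; elim: k kn => [|k IH] kn.
  have [C1 C10 H1] : exists2 C, 0 <= C & forall s w, 0 < s -> s <= 1 -> r <= sqnorm w ->
      l1norm w <= B -> `|osc J q 0 s w| <= C * s `^ (- (n%:R + 2^-1)).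
    have al0 : 0 <= n%:R + 2^-1 :> R by rewrite addr_ge0.
    have [q1|q1] := leqP q 1; first exact: le_osc0_small.
    case: q q1 Jq qm => [|[|q]]// _ Jq qm; have [C C0 H] := le_osc0_low qm Jq B0.
    by exists C => // s w s0 s1 _; exact: H.
  have [C2 C20 H2] := le_osc0_large Jq B0.
  exists (C1 + C2); first exact: addr_ge0.
  move=> s w s0 rw wB; rewrite subr0 mulrDl.
  have [s1|/ltW s1] := leP s 1.
    by apply: le_trans (H1 _ _ s0 s1 rw wB) _; rewrite lerDl mulr_ge0 ?powR_ge0.
  by apply: le_trans (H2 _ _ s1 wB) _; rewrite lerDr mulr_ge0 ?powR_ge0.
have [C C0 H] := IH (ltnW kn).
pose p : R := n%:R - k%:R + 2^-1.
have p1 : 1 < p.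
  rewrite /p -natrB; last exact: ltnW.
  by rewrite (@lt_le_trans _ _ (1 + 2^-1))// ?ltrDl// lerD2r ler1n subn_gt0.
exists (C / (p - 1)); first by rewrite divr_ge0// subr_ge0 ltW.
move=> s w s0 rw wB.
have [It <-] := osc_tail w Jq kn s0.
have tE := integral_powR_tail p1 s0.
have mD : measurable `]s, +oo[%classic by [].
have ip : mu.-integrable `]s, +oo[ (fun t : R => (t `^ (- p))%:E).
  apply/integrableP; split.
    apply/measurable_EFinP; apply: measurable_funTS; exact: measurable_powR.
  under eq_integral => t _ do rewrite /= ger0_norm ?powR_ge0//.
  by rewrite tE ltry.
apply: (@le_trans _ _ (\int[mu]_(t in `]s, +oo[) (C * t `^ (- p)))).
  apply: le_trans (le_normr_Rintegral _ It) _ => //.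
  apply: le_Rintegral => //; first exact: integrable_norm.
    rewrite (_ : EFin \o _ = (fun t : R => C%:E * (t `^ (- p))%:E)%E)//.
    exact: integrableZl.
  move=> t; rewrite /= in_itv/= andbT => st; apply: H => //; exact: lt_trans st.
rewrite RintegralZl// /Rintegral tE /=.
have -> : 1 - p = - (n%:R - k.+1%:R + 2^-1) by rewrite /p -natr1; ring.
by rewrite mulrA mulrAC.
Qed.

End remainder_bounds.

(** * Laplace integrals over t and their derivatives *)

Section laplace_integrals.
Context {R : realType} {m : nat}.
Local Notation leb := (@lebesgue_measure R).
Local Notation E := (m.-tuple (measurableTypeR R)).
Local Notation lam := (lebesgue_Rn R m).
Implicit Types (J : seq 'I_m) (w : 'rV[R]_m) (s t : R) (p : E).
Local Notation e nu := (delta_mx 0 nu : 'rV[R]_m).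

(** Absolute continuity of the integral: the removed piece lives on ]0, x], of measure x. *)
Lemma cvg_Rintegral_at_right (f : R -> R) :
  leb.-integrable `]0, +oo[ (EFin \o f) ->
  \int[leb]_(t in `]x, +oo[) f t @[x --> 0^'+] --> \int[leb]_(t in `]0, +oo[) f t.
Proof.
move=> intf; pose g := f \_ `]0, +oo[.
have intg : leb.-integrable setT (EFin \o g).
  by rewrite -restrict_EFin; apply/integrable_restrict => //=; rewrite setTI.
apply/cvgrPdist_lt => eps eps0.
have [d [d0 gd]] := integral_normr_continuous intg eps0.
near=> x.
have x0 : 0 < x by near: x; exact: nbhs_right_gt.
have xd : x < d by near: x; exact: nbhs_right_lt.
have D1 : `]0, +oo[%classic = `]0, x] `|` `]x, +oo[ :> set R.
  apply/seteqP; split=> y /=; rewrite !in_itv/= !andbT.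
    by move=> y0; have [yx|xy] := leP y x; [left; rewrite y0|right].
  by case=> [/andP[]//|xy]; exact: lt_trans xy.
have dj : [disjoint `]0, x] & `]x, +oo[ : set R].
  apply/disj_setPS => y /=; rewrite !in_itv/= => -[/andP[_ yx]].
  by rewrite andbT ltNge yx.
rewrite D1 Rintegral_setU//; last by rewrite -D1.
have gx : \int[leb]_(y in `]0, x]) `|g y| < eps.
  have lx : (leb (`]0%R, x] : set R) < d%:E)%E.
    by rewrite lebesgue_measure_itv/= lte_fin x0 sube0 lte_fin.
  exact: (gd _ _ lx).
rewrite addrK; apply: le_lt_trans gx.
have -> : \int[leb]_(t in `]0, x]) f t = \int[leb]_(t in `]0, x]) g t.
  apply: eq_Rintegral => t; rewrite inE/= in_itv/= => /andP[t0 _].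
  by rewrite /g patchE mem_set//= in_itv/= t0.
apply: le_normr_Rintegral => //; exact: integrableS intg.
Unshelve. all: by end_near. Qed.

Lemma measurable_osc J q n w :
  measurable_fun setT (fun t : measurableTypeR R => osc J q n t w).
Proof.
pose f (z : measurableTypeR R * E) : \bar R := (core J q n z.1 w z.2)%:E.
have mf : measurable_fun setT f by apply/measurable_EFinP; exact: measurable_core2.
rewrite (_ : (fun t => _) = fine \o (fun t => \int[lam]_p f (t, p))%E)//.
apply: measurableT_comp; first exact: fine_measurable.
(* Measurability of the integral in its parameter comes from Tonelli, applied to the two signed
   parts. *)
have -> : (fun t => \int[lam]_p f (t, p))%E =
    (fun t => \int[lam]_p f^\+ (t, p) - \int[lam]_p f^\- (t, p))%E.
  by apply/funext => t; rewrite [LHS]integralE; congr (_ - _)%E; apply: eq_integral => p _; rewrite ?funeposE ?funenegE.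
have mp := @measurable_fun_fubini_tonelli_F _ _ _ _ _ lam (funepos f) (measurable_funepos mf).
have mn := @measurable_fun_fubini_tonelli_F _ _ _ _ _ lam (funeneg f) (measurable_funeneg mf).
by apply: emeasurable_funB; [apply: mp|apply: mn].
Qed.

(* The regimes in which the Laplace integral over ]del, +oo[ is absolutely convergent,
   locally uniformly on sqnorm w >= r. *)
Definition near_admissible (del r : R) (q : nat) :=
  0 < del \/ m = 1%N \/ (0 < r /\ ((q <= 1) || (m <= 3))%N).

(** Integrability at 0 asks for an exponent below 1; the three regimes give 0, 1/2 and 1/2. *)
Lemma le_osc_admissible J q n (del r B : R) : (0 < m)%N -> (size J + q = n.*2)%N ->
  0 <= del -> 0 <= r -> 0 <= B -> near_admissible del r q ->
  exists C a : R, [/\ 0 <= C, 0 <= a < 1 & forall t w, del < t -> r <= sqnorm w -> l1norm w <= B ->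
    `|osc J q n t w| <= C * t `^ (- a)].
Proof.
move=> m0 Jq del0 r0 B0; have wX w : l1norm w <= B -> l1norm w ^+ q <= B ^+ q.
  by move=> wB; apply: lerXn2r; rewrite ?nnegrE ?l1norm_ge0.
case=> [dp|[m1|[rp qm]]].
- exists (B ^+ q * (pi / del) `^ (m%:R / 2)), 0; split => //.
  + by rewrite mulr_ge0 ?exprn_ge0 ?powR_ge0.
  + by rewrite lexx ltr01.
  + move=> t w dt _ wB; have t0 := lt_trans dp dt; rewrite oppr0 powRr0 mulr1.
    apply: le_trans (le_normr_osc w Jq t0) _; apply: ler_pM.
    * by rewrite exprn_ge0 ?l1norm_ge0.
    * exact: powR_ge0.
    * exact: wX.
    * apply: ge0_ler_powR; rewrite ?nnegrE ?divr_ge0 ?pi_ge0 ?(ltW t0)//.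
      by rewrite ler_wpM2l ?pi_ge0// lef_pV2 ?posrE// ltW.
(* In dimension 1 the Gaussian mass, of order t^(-1/2), is already integrable at 0, on the diagonal
   as well. *)
- exists (B ^+ q * pi `^ 2^-1), 2^-1; split.
  + by rewrite mulr_ge0 ?exprn_ge0 ?powR_ge0.
  + by rewrite invr_ge0 ler0n invf_lt1 ?ltr1n.
  + move=> t w dt _ wB; have t0 : 0 < t by exact: le_lt_trans dt.
    apply: le_trans (le_normr_osc w Jq t0) _.
    have -> : m%:R / 2 = 2^-1 :> R by rewrite m1 mul1r.
    rewrite powRM ?pi_ge0 ?invr_ge0 ?(ltW t0)//.
    rewrite -(powR_inv1 (ltW t0)) -powRrM mulN1r mulrA.
    by apply: ler_wpM2r; [exact: powR_ge0|apply: ler_wpM2r; [exact: powR_ge0|exact: wX]].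
- have [C C0 H] := le_osc_near m0 Jq qm (leqnn n) rp B0.
  exists C, 2^-1; split=> //; first by rewrite invr_ge0 ler0n invf_lt1 ?ltr1n.
  move=> t w dt rw wB; apply: le_trans (H t w _ rw wB) _; first exact: le_lt_trans dt.
  by rewrite subrr add0r.
Qed.

Section weight.
Variables (b : R) (wt : R -> R).
Hypothesis b0 : 0 < b.
Hypothesis mwt : measurable_fun setT wt.
Hypothesis wt_le : forall t, 0 < t -> `|wt t| <= expR (- (b * t)).

(** The weight will be the real or the imaginary part of e^(t lam), with b = - Re lam. *)
Definition lap J q n (mu del : R) w : R :=
  \int[leb]_(t in `]del, +oo[) (wt t * osc J q n (t * mu) w).

(** Up to constants a Gamma integrand with parameter 1 - a > 0. *)
Lemma integrable_weight (C a mu del : R) : 0 <= del -> 0 < mu -> a < 1 ->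
  leb.-integrable `]del, +oo[ (EFin \o (fun t => C * (t * mu) `^ (- a) * expR (- (b * t)))).
Proof.
move=> del0 mu0 a1.
have a1' : 0 < 1 - a by rewrite subr_gt0.
have ig := integrable_gamma b0 a1'.
suff H : leb.-integrable `]0, +oo[ (EFin \o (fun t => C * (t * mu) `^ (- a) * expR (- (b * t)))).
  apply: (integrableS _ _ _ H) => //.
  by move=> t /=; rewrite !in_itv/= !andbT; exact: le_lt_trans.
have mD : measurable (`]0, +oo[%classic : set (measurableTypeR R)) by [].
have := integrableZl mD (C * mu `^ (- a)) ig; apply: eq_integrable => // t.
rewrite inE/= in_itv/= andbT => t0; rewrite -EFinM; congr EFin.
rewrite powRM ?(ltW t0) ?(ltW mu0)//.
have -> : 1 - a - 1 = - a by ring.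
move: (_ `^ _) (_ `^ _) (expR _) => x y z; ring.
Qed.

Lemma lap_dominated J q n (mu del r B : R) : (0 < m)%N -> 0 < mu -> (size J + q = n.*2)%N ->
  0 <= del -> 0 <= r -> 0 <= B -> near_admissible del r q ->
  exists g : R -> R, leb.-integrable `]del, +oo[ (EFin \o g) /\
   forall t w, del < t -> r <= sqnorm w -> l1norm w <= B ->
    `|wt t * osc J q n (t * mu) w| <= g t.
Proof.
move=> m0 mu0 Jq del0 r0 B0 adm.
have dm0 : 0 <= del * mu by rewrite mulr_ge0 ?(ltW mu0).
have adm' : near_admissible (del * mu) r q.
  by case: adm => [d0|[m1|h]]; [left; rewrite mulr_gt0|right; left|right; right].
have [C [a [C0 /andP[a0 a1] H]]] := le_osc_admissible m0 Jq dm0 r0 B0 adm'.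
exists (fun t => C * (t * mu) `^ (- a) * expR (- (b * t))); split.
  exact: integrable_weight.
move=> t w dt rw wB; rewrite normrM mulrC; apply: ler_pM => //.
  by apply: H => //; rewrite ltr_pM2r.
by apply: wt_le; exact: le_lt_trans dt.
Qed.

Lemma measurable_lap J q n mu w D :
  measurable_fun D (fun t : measurableTypeR R => wt t * osc J q n (t * mu) w).
Proof.
apply: measurable_funTS; apply: measurable_funM; first exact: mwt.
apply: (measurableT_comp (measurable_osc J q n w)); exact: measurable_funM.
Qed.

Lemma integrable_lap J q n (mu del : R) w : (0 < m)%N -> 0 < mu -> (size J + q = n.*2)%N ->
  0 <= del -> near_admissible del (sqnorm w) q ->
  leb.-integrable `]del, +oo[ (EFin \o (fun t => wt t * osc J q n (t * mu) w)).
Proof.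
move=> m0 mu0 Jq del0 adm.
have w0 := sqnorm_ge0 w.
have [g [ig H]] := lap_dominated m0 mu0 Jq del0 w0 (l1norm_ge0 w) adm.
apply: (le_integrable _ _ _ ig) => //.
  by apply/measurable_EFinP; exact: measurable_lap.
move=> t; rewrite /= in_itv/= andbT => dt; rewrite lee_fin.
by apply: le_trans (ler_norm _); exact: H.
Qed.

Lemma cvg_lap J q n (mu : R) w : (0 < m)%N -> 0 < mu -> (size J + q = n.*2)%N ->
  near_admissible 0 (sqnorm w) q ->
  lap J q n mu del w @[del --> 0^'+] --> lap J q n mu 0 w.
Proof.
by move=> m0 mu0 Jq adm; apply: cvg_Rintegral_at_right; exact: integrable_lap.
Qed.

Lemma is_derive_lap J q n (mu del : R) nu w : (0 < m)%N -> 0 < mu ->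
  (size J + q.+1 = n.*2)%N -> 0 <= del -> near_admissible del (sqnorm w) q.+1 ->
  is_derive w (e nu) (lap J q.+1 n mu del) (lap (nu :: J) q n mu del w).
Proof.
move=> m0 mu0 Jq del0 adm.
have w0 := sqnorm_ge0 w.
have Jq' : (size (nu :: J) + q = n.*2)%N by rewrite /= addSnnS.
(* The dominating function must serve all points near [w], so half of |w|^2 is kept as a common
   lower bound. *)
pose r := sqnorm w / 2.
have r0 : 0 <= r by rewrite divr_ge0.
have B0 : 0 <= l1norm w + 1 by rewrite addr_ge0 ?l1norm_ge0.
have adm' q' : (q' <= q.+1)%N -> near_admissible del r q'.
  move=> qq; case: adm => [?|[?|[rp qm]]]; [by left|by right; left|right; right].
  by rewrite divr_gt0//; split=> //; case/orP: qm => [q1|->]; rewrite ?orbT// (leq_trans qq).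
have [e0 e00 eP] : exists2 e0, 0 < e0 & forall u : R, `|u| < e0 ->
    r <= sqnorm (u *: e nu + w) /\ l1norm (u *: e nu + w) <= l1norm w + 1.
  have [w00|wn] := eqVneq (sqnorm w) 0.
    exists 1 => // u u1; split; last by apply: l1norm_line; exact: ltW.
    by rewrite /r w00 mul0r sqnorm_ge0.
  have wp : 0 < sqnorm w by rewrite lt_neqAle eq_sym wn.
  (* Along the line |w|^2 changes by u(2 w_nu + u), at most |u| M for |u| < 1, hence by at most r
     when |u| < r / M. *)
  pose M := 2 * l1norm w + 1.
  have M0 : 0 < M by rewrite ltr_wpDl// mulr_ge0 ?l1norm_ge0.
  exists (Num.min 1 (r / M)); first by rewrite lt_min ltr01 divr_gt0// divr_gt0.
  move=> u; rewrite lt_min => /andP[u1 uM]; split; last by apply: l1norm_line; exact: ltW.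
  rewrite sqnorm_line -lerBlDl.
  have -> : r - sqnorm w = - r by rewrite /r; field.
  rewrite lerNl; apply: le_trans (ler_norm _) _; rewrite normrN normrM.
  apply: (@le_trans _ _ (`|u| * M)); last by rewrite -ler_pdivlMr// ltW.
  apply: ler_wpM2l => //; apply: le_trans (ler_normD _ _) _; apply: lerD; last exact: ltW.
  by rewrite normrM ger0_norm// ler_wpM2l// coord_le.
have [g [ig H]] := lap_dominated m0 mu0 Jq' del0 r0 B0 (adm' q (leqnSn q)).
have [g1 [ig1 H1]] := lap_dominated m0 mu0 Jq del0 r0 B0 (adm' q.+1 (leqnn _)).
apply: (@is_derive_under_integral _ _ _ _ leb `]del, +oo[ _
  (fun w t => wt t * osc J q.+1 n (t * mu) w) (fun w t => wt t * osc (nu :: J) q n (t * mu) w)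
  w (e nu) e0 g) => //.
- move=> u ue; have [rw wB] := eP u ue.
  apply: (le_integrable _ _ _ ig1) => //.
    by apply/measurable_EFinP; exact: measurable_lap.
  move=> t; rewrite /= in_itv/= andbT => dt; rewrite lee_fin.
  by apply: le_trans (ler_norm _); exact: H1.
- move=> u t ue; rewrite /= in_itv/= andbT => dt.
  have t0 : 0 < t * mu by rewrite mulr_gt0//; exact: le_lt_trans dt.
  have D := is_derive_osc nu (u *: e nu + w) Jq t0.
  exact: (is_deriveZ (wt t) D).
- move=> u t ue; rewrite /= in_itv/= andbT => dt; have [rw wB] := eP u ue.
  exact: H.
Qed.

End weight.
End laplace_integrals.

(** * The heat kernel *)

Section complex_integrals.
Context d (T : measurableType d) {R : realType} (nu : {measure set T -> \bar R}) (D : set T).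
Hypothesis mD : measurable D.
Local Notation C := R[i].
Local Notation Re := (@complex.Re R).
Local Notation Im := (@complex.Im R).
Implicit Types f g : T -> C.

Definition cintegrable f :=
  nu.-integrable D (EFin \o (Re \o f)) /\ nu.-integrable D (EFin \o (Im \o f)).

Lemma eq_cintegral f g : {in D, f =1 g} -> cintegral nu D f = cintegral nu D g.
Proof.
by move=> fg; rewrite /cintegral; congr (_ +i* _); apply: eq_Rintegral => x xD; rewrite fg.
Qed.

Lemma cintegralD f g : cintegrable f -> cintegrable g ->
  cintegrable (fun x => f x + g x) /\
  cintegral nu D (fun x => f x + g x) = cintegral nu D f + cintegral nu D g.
Proof.
move=> [fR fI] [gR gI].
have ER x : Re (f x + g x) = Re (f x) + Re (g x) by case: (f x) (g x) => ? ? [].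
have EI x : Im (f x + g x) = Im (f x) + Im (g x) by case: (f x) (g x) => ? ? [].
split; first split.
- by apply: eq_integrable (integrableD mD fR gR) => // x _; rewrite /= ER.
- by apply: eq_integrable (integrableD mD fI gI) => // x _; rewrite /= EI.
rewrite /cintegral; congr (_ +i* _).
- by rewrite -RintegralD//; apply: eq_Rintegral => x _; rewrite ER.
- by rewrite -RintegralD//; apply: eq_Rintegral => x _; rewrite EI.
Qed.

Lemma cintegralZ (c : C) f : cintegrable f ->
  cintegrable (fun x => c * f x) /\
  cintegral nu D (fun x => c * f x) = c * cintegral nu D f.
Proof.
case: c => p q [fR fI].
have ER x : Re ((p +i* q) * f x) = p * Re (f x) - q * Im (f x) by case: (f x).
have EI x : Im ((p +i* q) * f x) = p * Im (f x) + q * Re (f x) by case: (f x).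
have i1 := integrableZl mD p fR; have i2 := integrableZl mD q fI.
have i3 := integrableZl mD p fI; have i4 := integrableZl mD q fR.
split; first split.
- by apply: eq_integrable (integrableB mD i1 i2) => // x _; rewrite /= ER.
- by apply: eq_integrable (integrableD mD i3 i4) => // x _; rewrite /= EI.
rewrite /cintegral -[RHS]/((_ - _) +i* (_ + _)); congr (_ +i* _).
- rewrite -!RintegralZl// -RintegralB//.
  by apply: eq_Rintegral => x _; rewrite ER.
- rewrite -!RintegralZl// -RintegralD//.
  by apply: eq_Rintegral => x _; rewrite EI.
Qed.

Lemma cintegral_sum (I : eqType) (r : seq I) (al : I -> C) (f : I -> T -> C) :
  (forall i, i \in r -> cintegrable (f i)) ->
  cintegrable (fun x => \sum_(i <- r) al i * f i x) /\
  cintegral nu D (fun x => \sum_(i <- r) al i * f i x) =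
  \sum_(i <- r) al i * cintegral nu D (f i).
Proof.
elim: r => [|i r IH] fi.
  have E : (fun x => \sum_(i <- [::]) al i * f i x) = cst 0.
    by apply/funext => x; rewrite big_nil.
  rewrite E big_nil; split; first by split; exact: integrable0.
  by rewrite /cintegral /Rintegral !integral0_eq.
have [IH1 IH2] : cintegrable (fun x => \sum_(i <- r) al i * f i x) /\
  cintegral nu D (fun x => \sum_(i <- r) al i * f i x) =
  \sum_(i <- r) al i * cintegral nu D (f i).
  by apply: IH => j jr; apply: fi; rewrite in_cons jr orbT.
have [h1 h2] := cintegralZ (al i) (fi i (mem_head _ _)).
have [h3 h4] := cintegralD h1 IH1.
have E : (fun x => \sum_(j <- i :: r) al j * f j x) =
    (fun x => al i * f i x + \sum_(j <- r) al j * f j x).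
  by apply/funext => x; rewrite big_cons.
by rewrite E big_cons h4 h2 IH2.
Qed.

End complex_integrals.

Section oscillatory_integrals.
Context {R : realType} {m : nat}.
Local Notation C := R[i].
Local Notation Re := (@complex.Re R).
Local Notation Im := (@complex.Im R).
Local Notation E := (m.-tuple (measurableTypeR R)).
Local Notation lam := (lebesgue_Rn R m).
Implicit Types (J : seq 'I_m) (w : 'rV[R]_m) (p : E) (rho : E -> C).

Definition wave w p : C := cos (dott w p) +i* sin (dott w p).

Definition wave_term J k w rho p : C := (mon J p * sqt p ^- k)%:C * wave w p * rho p.

(** Evenness and a Gaussian bound; the two instances are the heat factor e^(-t mu_i|xi|^2) and the
    Laplace integral cut at a positive time. *)
Definition radial_weight (eps K : R) rho :=
  [/\ 0 < eps, measurable_fun setT (Re \o rho), measurable_fun setT (Im \o rho),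
   forall p, rho (tuple_opp p) = rho p &
   forall p, `|Re (rho p)| <= K * expR (- (eps * sqt p)) /\
             `|Im (rho p)| <= K * expR (- (eps * sqt p))].

Lemma mon_sqt_le1 J k p : size J = k.*2 -> `|mon J p * sqt p ^- k| <= 1.
Proof.
move=> Jk; rewrite normrM; apply: le_trans (ler_wpM2r (normr_ge0 _) (mon_le J p)) _.
rewrite Jk -mul2n exprM sqr_sqrtr ?sqt_ge0// ger0_norm ?invr_ge0 ?exprn_ge0 ?sqt_ge0//.
have [->|p0] := eqVneq (sqt p ^+ k) 0; first by rewrite mul0r ler01.
by rewrite mulfV.
Qed.

Lemma mon_sqt_opp J k p : size J = k.*2 ->
  mon J (tuple_opp p) * sqt (tuple_opp p) ^- k = mon J p * sqt p ^- k.
Proof. by move=> Jk; rewrite mon_opp Jk sqt_opp -signr_odd odd_double expr0 mul1r. Qed.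

Lemma measurable_mon_sqt J k : measurable_fun setT (fun p : E => mon J p * sqt p ^- k).
Proof. by apply: measurable_funM; [exact: measurable_mon|exact: measurable_sqtX]. Qed.

Lemma wave_term_integrable J k w (g : R -> R) (r : E -> R) eps K : size J = k.*2 ->
  0 < eps -> measurable_fun setT g -> (forall u, `|g u| <= 1) -> measurable_fun setT r ->
  (forall p, `|r p| <= K * expR (- (eps * sqt p))) ->
  lam.-integrable setT (EFin \o (fun p => mon J p * sqt p ^- k * g (dott w p) * r p)).
Proof.
move=> Jk e0 mg g1 mr rK; apply: (@integrable_gauss_dom _ _ eps K 0) => //.
  apply: measurable_funM => //; apply: measurable_funM; first exact: measurable_mon_sqt.
  by apply: (measurableT_comp mg); exact: measurable_dott.
move=> p; rewrite expr0 mul1r normrM; apply: le_trans (rK p).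
apply: ler_piMl => //; rewrite normrM -[leRHS]mulr1.
by apply: ler_pM => //; exact: mon_sqt_le1.
Qed.

(* The sine half of the plane wave is odd in the momentum and does not contribute. *)
Lemma cintegral_wave_term J k w rho eps K : size J = k.*2 -> radial_weight eps K rho ->
  cintegrable lam setT (wave_term J k w rho) /\
  cintegral lam setT (wave_term J k w rho) =
    (\int[lam]_p (mon J p * sqt p ^- k * cos (dott w p) * Re (rho p))) +i*
    (\int[lam]_p (mon J p * sqt p ^- k * cos (dott w p) * Im (rho p))).
Proof.
move=> Jk [e0 mR mI rN rK].
have rKR p := (rK p).1; have rKI p := (rK p).2.
have mc : measurable_fun setT (@cos R).
  by apply: continuous_measurable_fun; exact: continuous_cos.
have ms : measurable_fun setT (@sin R).
  by apply: continuous_measurable_fun; exact: continuous_sin.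
have cR := wave_term_integrable w Jk e0 mc normr_cos mR rKR.
have cI := wave_term_integrable w Jk e0 mc normr_cos mI rKI.
have sR := wave_term_integrable w Jk e0 ms normr_sin mR rKR.
have sI := wave_term_integrable w Jk e0 ms normr_sin mI rKI.
have ER p : Re (wave_term J k w rho p) =
    mon J p * sqt p ^- k * cos (dott w p) * Re (rho p) -
    mon J p * sqt p ^- k * sin (dott w p) * Im (rho p).
  rewrite /wave_term /wave; case: (rho p) => x y /=.
  by move: (mon J p * _) => M; ring.
have EI p : Im (wave_term J k w rho p) =
    mon J p * sqt p ^- k * cos (dott w p) * Im (rho p) +
    mon J p * sqt p ^- k * sin (dott w p) * Re (rho p).
  rewrite /wave_term /wave; case: (rho p) => x y /=.
  by move: (mon J p * _) => M; ring.
have odd0 (h : C -> R) : lam.-integrable setT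
    (EFin \o (fun p => mon J p * sqt p ^- k * sin (dott w p) * h (rho p))) ->
    \int[lam]_p (mon J p * sqt p ^- k * sin (dott w p) * h (rho p)) = 0.
  move=> /integrableP[/measurable_EFinP mf _]; apply: Rintegral_odd => // p.
  by rewrite mon_sqt_opp// dott_opp sinN rN mulrN mulNr.
split; first split.
- by apply: eq_integrable (integrableB measurableT cR sI) => // p _; rewrite /= ER.
- by apply: eq_integrable (integrableD measurableT cI sR) => // p _; rewrite /= EI.
rewrite /cintegral; congr (_ +i* _).
- under eq_Rintegral do rewrite ER.
  by rewrite RintegralB// (odd0 Im)// subr0.
- under eq_Rintegral do rewrite EI.
  by rewrite RintegralD// (odd0 Re)// addr0.
Qed.

Lemma plane_waveE p w :
  plane_wave (vec_of_tuple p) w = wave w p / ((2 * pi) ^+ m)%:C.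
Proof.
rewrite /plane_wave /cexp; congr (_ / _).
have -> : 'i%C * (dotr (vec_of_tuple p) w)%:C = 0 +i* dott w p :> C.
  by rewrite /dott; simpc.
by rewrite /= expR0 mul1r.
Qed.

Variables (N s : nat) (a : 'I_m -> 'I_m -> 'M[C]_N) (mu : 'rV[R]_s).
Local Notation c := (invmx (Vandermonde s mu)).

(** Both kernels integrate a function of A(xi), that is, scalar functions times spectral
    projections. Expanding the projections into words leaves scalar oscillatory integrals. *)
Lemma mx_integral_sproj w (rho : 'I_s -> E -> C) :
  (forall i (k : nat) J, size J = k.*2 -> cintegrable lam setT (wave_term J k w (rho i))) ->
  mx_integral lam setT (fun p => plane_wave (vec_of_tuple p) w *:
    \sum_i rho i p *: sproj mu (symbol a (vec_of_tuple p)) (sqt p) i) =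
  \sum_i \sum_k (c i k / (2 * pi) ^+ m)%:C *:
    wsum a k (fun J => cintegral lam setT (wave_term J k w (rho i))).
Proof.
move=> rw; apply/matrixP => x y; rewrite mxE.
have words_int (i k : 'I_s) v : v \in words a k -> cintegrable lam setT (wave_term v.1 k w (rho i)).
  by move=> /size_words vk; exact: rw.
pose al (i k : 'I_s) (v : seq 'I_m * 'M[C]_N) : C := (c i k / (2 * pi) ^+ m)%:C * v.2 x y.
have h1 (i k : 'I_s) := cintegral_sum measurableT (al i k) (words_int i k).
have h2 (i : 'I_s) := cintegral_sum measurableT (fun _ => 1)
  (r := index_enum 'I_s) (fun k _ => (h1 i k).1).
have h3 := cintegral_sum measurableT (fun _ => 1) (r := index_enum 'I_s) (fun i _ => (h2 i).1).
rewrite (@eq_cintegral _ _ _ _ _ _ (fun p => \sum_(i < s) 1 * \sum_(k < s) 1 *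
    \sum_(v <- words a k) al i k v * wave_term v.1 k w (rho i) p)); last first.
  move=> p _; rewrite plane_waveE mxE summxE mulr_sumr; apply: eq_bigr => i _.
  rewrite mul1r mxE /sproj summxE !mulr_sumr; apply: eq_bigr => k _.
  rewrite mul1r mxE symbol_expr /wsum summxE !mulr_sumr; apply: eq_bigr => v _.
  rewrite mxE /wave_term /al.
  have -> : (\prod_(j <- v.1) vec_of_tuple p 0 j) = mon v.1 p.
    by apply: eq_bigr => j _; rewrite mxE.
  rewrite !rmorphM/= !fmorphV/=.
  move: (wave w p) (rho i p) (v.2 x y) => W r V; ring.
rewrite h3.2 summxE; apply: eq_bigr => i _; rewrite mul1r (h2 i).2 summxE.
apply: eq_bigr => k _; rewrite mul1r (h1 i k).2 mxE /wsum summxE mulr_sumr.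
by apply: eq_bigr => v _; rewrite mxE /al; ring.
Qed.

End oscillatory_integrals.

Section heat_kernel.
Context {R : realType} {m N s : nat}.
Local Notation C := R[i].
Local Notation Re := (@complex.Re R).
Local Notation Im := (@complex.Im R).
Local Notation E := (m.-tuple (measurableTypeR R)).
Local Notation lam := (lebesgue_Rn R m).
Variables (a : 'I_m -> 'I_m -> 'M[C]_N) (mu : 'rV[R]_s).
Hypothesis m_gt0 : (0 < m)%N.
Hypothesis a_herm : forall j k, a j k \is hermsymmx.
Hypothesis mu_gt0 : forall i, 0 < mu 0 i.
Hypothesis mu_distinct : forall i j, mu 0 i = mu 0 j -> i = j.
Hypothesis A_eigenvalues : forall xi : 'rV[R]_m, xi != 0 -> forall z : C,
  eigenvalue (symbol a xi) z -> exists i, z = (mu 0 i * sqnorm xi)%:C.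
Local Notation c := (invmx (Vandermonde s mu)).

Lemma symbol_herm (xi : 'rV[R]_m) : symbol a xi \is hermsymmx.
Proof.
apply/is_hermitianmxP; rewrite expr0 scale1r /symbol.
apply/matrixP => x y; rewrite !mxE !summxE rmorph_sum; apply: eq_bigr => i _.
rewrite !summxE rmorph_sum; apply: eq_bigr => j _.
rewrite !mxE [RHS]rmorphM; congr (_ * _).
  by apply/eqP; rewrite eq_complex /= oppr0 !eqxx.
by have /is_hermitianmxP := a_herm i j; rewrite expr0 scale1r => /matrixP/(_ x y); rewrite !mxE.
Qed.

Lemma sum_sproj_symbol (xi : 'rV[R]_m) : (0 < N)%N ->
  \sum_i sproj mu (symbol a xi) (sqnorm xi) i = 1%:M /\
  forall i, symbol a xi *m sproj mu (symbol a xi) (sqnorm xi) i =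
    (mu 0 i * sqnorm xi)%:C *: sproj mu (symbol a xi) (sqnorm xi) i.
Proof.
move=> N0.
have H (z : 'rV[R]_m) : z != 0 -> \sum_i sproj mu (symbol a z) (sqnorm z) i = 1%:M /\
  forall i, symbol a z *m sproj mu (symbol a z) (sqnorm z) i =
    (mu 0 i * sqnorm z)%:C *: sproj mu (symbol a z) (sqnorm z) i.
  move=> z0; apply: sum_sproj_herm => //; first exact: symbol_herm.
    by rewrite sqnorm_eq0.
  by move=> v; exact: A_eigenvalues.
have [->|] := eqVneq xi 0; last exact: H.
apply: sum_sproj0 => //.
(* That s > 0 is read off a nonzero vector: an empty sum of projections could not be the identity
   when N > 0. *)
- have z0 : (\row_(j < m) 1 : 'rV[R]_m) != 0.
    apply/eqP => /rowP/(_ (Ordinal m_gt0)); rewrite !mxE; exact/eqP/oner_neq0.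
  have [Hs _] := H _ z0; rewrite lt0n; apply/eqP => s0.
  have : \sum_(i < s) sproj mu (symbol a (\row_(j < m) 1)) (sqnorm (\row_(j < m) (1 : R))) i = 0.
    by apply: big1 => i _; have := ltn_ord i; rewrite [X in (_ < X)%N]s0.
  rewrite Hs => /matrixP/(_ (Ordinal N0) (Ordinal N0)); rewrite !mxE eqxx => /eqP.
  by rewrite oner_eq0.
- by rewrite /symbol big1// => i _; rewrite big1// => j _; rewrite !mxE mulr0 scale0r.
- by apply/eqP; rewrite sqnorm_eq0.
Qed.

Lemma heat_weight (t : R) i : 0 < t ->
  radial_weight (t * mu 0 i) 1 (fun p : E => (expR (- (t * (mu 0 i * sqt p))))%:C).
Proof.
move=> t0; split.
- exact: mulr_gt0.
- rewrite (_ : _ \o _ = (fun p : E => expR (- (t * mu 0 i * sqt p)))); first exact: measurable_gauss.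
  by apply/funext => p /=; rewrite mulrA.
- by rewrite (_ : _ \o _ = cst 0).
- by move=> p; rewrite sqt_opp.
- move=> p /=; rewrite mul1r mulrA ger0_norm ?expR_ge0//; split=> //.
  by rewrite normr0 expR_ge0.
Qed.

Lemma heat_wave_term J k w (t : R) i : size J = k.*2 -> 0 < t ->
  cintegral lam setT (wave_term J k w (fun p : E => (expR (- (t * (mu 0 i * sqt p))))%:C)) =
  (osc J 0 k (t * mu 0 i) w)%:C.
Proof.
move=> Jk t0; have [_ ->] := cintegral_wave_term w Jk (heat_weight i t0).
congr (_ +i* _); last first.
  by rewrite /Rintegral integral0_eq// => p _; rewrite /= mulr0.
apply: eq_Rintegral => p _; rewrite /core /gw /= [t * (_ * _)]mulrA.
by rewrite -[cos _]/(trem 0 _); move: (expR _) (trem _ _) => X Y; ring.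
Qed.

Lemma heat_kernel0E (t : R) (x y : 'rV[R]_m) : 0 < t ->
  heat_kernel0 a t x y = \sum_i \sum_k (c i k / (2 * pi) ^+ m)%:C *:
    wsum a k (fun J => (osc J 0 k (t * mu 0 i) (x - y))%:C).
Proof.
move=> t0; have [N0|N0] := posnP N.
  by apply/matrixP => i j; have := ltn_ord i; rewrite [X in (_ < X)%N]N0.
rewrite /heat_kernel0.
have -> : (fun p : E => plane_wave (vec_of_tuple p) (x - y) *:
      mx_exp (- t%:C *: symbol a (vec_of_tuple p))) =
    (fun p : E => plane_wave (vec_of_tuple p) (x - y) *:
      \sum_i (expR (- (t * (mu 0 i * sqt p))))%:C *: sproj mu (symbol a (vec_of_tuple p)) (sqt p) i).
  apply/funext => p; congr (_ *: _).
  by have [S1 S2] := sum_sproj_symbol (vec_of_tuple p) N0; exact: mx_exp_sproj.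
rewrite (mx_integral_sproj a mu (fun i k J Jk => (cintegral_wave_term (x - y) Jk (heat_weight i t0)).1)).
apply: eq_bigr => i _; apply: eq_bigr => k _; congr (_ *: _).
by apply: eq_wsum => J Jk; exact: heat_wave_term.
Qed.

Lemma powR_four_pi (u : R) : 0 < u ->
  (4 * pi * u) `^ (- (m%:R / 2)) = (pi `^ (m%:R / 2) * u `^ (- (m%:R / 2))) / (2 * pi) ^+ m.
Proof.
move=> u0; have p0 := pi_gt0 R.
have pn : pi != 0 :> R by rewrite gt_eqF.
(* The splitting isolates the (2 pi)^(-m) of the plane wave from the Gaussian constants in
   [Phi_osc]. *)
have -> : 4 * pi * u = (2 * pi) ^+ 2 * (pi^-1 * u).
  by move: pn; move: (pi : R) => q qn; field.
rewrite powRM ?exprn_ge0 ?mulr_ge0 ?invr_ge0 ?(ltW p0) ?(ltW u0)//.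
have i0 : 0 <= pi^-1 :> R by rewrite invr_ge0 ltW.
rewrite (powRM _ i0 (ltW u0)) [RHS]mulrC; congr (_ * (_ * _)).
  rewrite -powR_mulrn ?mulr_ge0 ?(ltW p0)// -powRrM.
  have -> : 2%:R * - (m%:R / 2) = - m%:R :> R by field.
  by rewrite powRN powR_mulrn ?mulr_ge0 ?(ltW p0).
by rewrite -(powR_inv1 (ltW p0)) -powRrM mulrNN mul1r.
Qed.

Section profile.
Variables (k : nat) (tau : R) (y : 'rV[R]_m).
Hypothesis tau0 : 0 < tau.

(** The candidate for the derivative along J of the profile, obtained by solving [Phi_osc] for
    Phi_k. The truncated subtraction is a true one for |J| <= 2k, the only range used. *)
Definition profile_derivative (J : seq 'I_m) (x : 'rV[R]_m) : R :=
  (-1) ^+ k * (pi `^ (m%:R / 2) * tau `^ (k%:R - m%:R / 2))^-1 *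
  osc J (k.*2 - size J) k tau (x - y).

Lemma profileE : profile k tau y = profile_derivative [::].
Proof.
apply/funext => x; rewrite /profile /profile_derivative subn0.
have := Phi_osc m_gt0 k (x - y) tau0 => H.
rewrite -mulrA mulrCA H mulrA mulVf ?mul1r//.
by rewrite mulf_neq0// gt_eqF// powR_gt0// pi_gt0.
Qed.

Lemma is_derive_subr (F : 'rV[R]_m -> R) x v d :
  is_derive (x - y) v F d -> is_derive x v (fun x => F (x - y)) d.
Proof.
move=> /cvg_is_derive h; apply: is_derive_cvg.
by under eq_fun do rewrite -addrA.
Qed.

Lemma profile_family : derivative_family setT k.*2 profile_derivative.
Proof.
move=> J nu x Jk _; rewrite /profile_derivative.
have Jq : (size J + (k.*2 - (size J).+1).+1 = k.*2)%N by rewrite -subSn// subSS subnKC// ltnW.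
have D := is_derive_subr (is_derive_osc nu (x - y) Jq tau0).
have := is_deriveZ ((-1) ^+ k * (pi `^ (m%:R / 2) * tau `^ (k%:R - m%:R / 2))^-1) D.
by rewrite -subSn// subSS.
Qed.

Lemma profile_derivative_perm J J' : perm_eq J J' ->
  profile_derivative J = profile_derivative J'.
Proof.
move=> JJ'; apply/funext => x; rewrite /profile_derivative (perm_size JJ'); congr (_ * _).
by apply: eq_Rintegral => p _; rewrite /core /mon (perm_big _ JJ').
Qed.

Lemma sym_contract_profile x : sym_contract a k (profile k tau y) x =
  wsum a k (fun J => (profile_derivative J x)%:C).
Proof.
rewrite -sum_sym_prod; last by move=> J J' /profile_derivative_perm ->.
apply: eq_bigr => J _; congr (_%:C *: _).
rewrite profileE; apply: (partials_family openT profile_family) => //.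
by rewrite size_map size_enum_ord.
Qed.

Lemma iter_F0_profile (x : 'rV[R]_m) :
  iter k (fun f z => tau%:C *: F0 a f z) (fun z => (profile k tau y z)%:C%:M) x =
  ((- tau) ^+ k)%:C *: wsum a k (fun J => (profile_derivative J x)%:C).
Proof.
rewrite profileE.
apply: (@iter_F0 R m N a setT k.*2 (fun J x => (profile_derivative J x)%:C) _ tau k x openT) => //.
  exact: profile_family.
by move=> J nu z _ _; exact: is_derive_cst.
Qed.

(** After 2k derivatives the remainder index is 0 and the cosine itself is back. The sign in
    (-tau)^k cancels the one from [Phi_osc], and tau^k cancels the power of tau. *)
Lemma profile_derivative_top J x : size J = k.*2 ->
  (4 * pi * tau) `^ (- (m%:R / 2)) * (- tau) ^+ k * profile_derivative J x =
  osc J 0 k tau (x - y) / (2 * pi) ^+ m.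
Proof.
move=> Jk; rewrite /profile_derivative Jk subnn mulrA [RHS]mulrC; congr (_ * _).
rewrite powR_four_pi// powRD ?(gt_eqF tau0) ?implybT// powR_mulrn ?(ltW tau0)// (exprNn tau).
have s1 : (-1) ^+ k * (-1) ^+ k = 1 :> R by rewrite -exprMn mulrNN mulr1 expr1n.
have p0 : pi `^ (m%:R / 2) != 0 :> R by rewrite gt_eqF// powR_gt0// pi_gt0.
have t0 : tau `^ (- (m%:R / 2)) != 0 by rewrite gt_eqF// powR_gt0.
have tk : tau ^+ k != 0 by rewrite expf_neq0// gt_eqF.
move: ((2 * pi) ^- m) (pi `^ _) (tau `^ _) (tau ^+ k) ((-1) ^+ k) s1 p0 t0 tk => X P T K S s1 p0 t0 tk.
rewrite -[RHS]mulr1 -s1; field; rewrite p0 t0 tk//.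
Qed.

End profile.
Lemma heat_kernel0_profile (t : R) (x y : 'rV[R]_m) : 0 < t ->
  heat_kernel0 a t x y =
    \sum_(i < s) \sum_(k < s)
      ((4 * pi * t * mu 0 i) `^ (- (m%:R / 2)) * c i k * (- (t * mu 0 i)) ^+ k)%:C *:
        wsum a k (fun J => (profile_derivative k (t * mu 0 i) y J x)%:C).
Proof.
move=> t0; rewrite heat_kernel0E//; apply: eq_bigr => i _; apply: eq_bigr => k _.
have tm0 : 0 < t * mu 0 i by exact: mulr_gt0.
rewrite -!wsumZ; apply: eq_wsum => J Jk; rewrite -!rmorphM; congr (_%:C).
have := profile_derivative_top y tm0 x Jk.
rewrite -(mulrA (4 * pi) t) => H.
rewrite -[LHS]/(_ * _) mulrAC -mulrA -H; ring.
Qed.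

End heat_kernel.

(** * The resolvent kernel *)

Section damped_trigonometric_integrals.
Context {R : realType}.
Local Notation leb := (@lebesgue_measure R).
Implicit Types (c om del t : R).

Lemma cvg_expRN_bounded (c K : R) (f : R -> R) : 0 < c -> (forall t, `|f t| <= K) ->
  expR (- (c * t)) * f t @[t --> +oo] --> 0.
Proof.
move=> c0 fK.
have e0 : expR (- (c * t)) @[t --> +oo] --> 0.
  have : expR (- t) @[t --> +oo] --> (0 : R).
    by have := @cvgr_expR R; apply: cvg_trans.
  move=> h.
  have l : c * t @[t --> +oo] --> +oo by exact: gt0_cvgMry.
  exact: (cvg_comp _ _ l h).
apply/cvgr0Pnorm_lt => e ep.
have K0 : 0 <= K by exact: le_trans (fK 0).
have eK : 0 < e / (K + 1) by rewrite divr_gt0// ltr_wpDl.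
move/cvgr0Pnorm_lt : e0 => /(_ _ eK) h.
near=> t; rewrite normrM.
have ht : `|expR (- (c * t))| < e / (K + 1) by near: t.
apply: le_lt_trans (_ : _ <= `|expR (- (c * t))| * (K + 1)) _.
  by apply: ler_wpM2l => //; apply: le_trans (fK t) _; rewrite lerDl.
by rewrite -ltr_pdivlMr// ltr_wpDl.
Unshelve. all: by end_near. Qed.

Lemma is_derive_damped c om (p q t : R) :
  is_derive t 1 (fun t => expR (- (c * t)) * (p * cos (om * t) + q * sin (om * t)))
    (expR (- (c * t)) * ((q * om - c * p) * cos (om * t) - (p * om + c * q) * sin (om * t))).
Proof.
have D1 : is_derive t 1 (fun t : R => - (c * t)) (- c).
  rewrite (_ : (fun t : R => _) = (- c) *: (id : R -> R)); last first.
    by apply/funext => u; rewrite -[RHS]/(_ * _) mulNr.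
  by apply: (is_derive_eq (is_deriveZ _ (is_derive_id _ _))); exact: mulr1.
have D2 : is_derive t 1 (fun t : R => om * t) om.
  rewrite (_ : (fun t : R => _) = om *: (id : R -> R))//.
  by apply: (is_derive_eq (is_deriveZ _ (is_derive_id _ _))); exact: mulr1.
have D3 := @is_derive1_comp R expR (fun t : R => - (c * t)) _ _ _ (is_derive_expR _) D1.
have D4 := @is_derive1_comp R (@cos R) (fun t : R => om * t) _ _ _ (is_derive_cos _) D2.
have D5 := @is_derive1_comp R (@sin R) (fun t : R => om * t) _ _ _ (is_derive_sin _) D2.
have D6 := is_deriveD (is_deriveZ p D4) (is_deriveZ q D5).
apply: (is_derive_eq (is_deriveM D3 D6)).
rewrite -[LHS]/(expR (- (c * t)) * (p * (- sin (om * t) * om) + q * (cos (om * t) * om)) +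
  (p * cos (om * t) + q * sin (om * t)) * (expR (- (c * t)) * - c)).
move: (expR _) (cos _) (sin _) => X Y Z; ring.
Qed.

(** With [p] and [q] free, one primitive serves the Laplace integrals of cosine and sine alike. *)
Lemma integral_damped c om (p q del : R) : 0 < c ->
  leb.-integrable `]del, +oo[ (EFin \o (fun t =>
     expR (- (c * t)) * ((q * om - c * p) * cos (om * t) - (p * om + c * q) * sin (om * t)))) /\
  \int[leb]_(t in `]del, +oo[) (expR (- (c * t)) *
     ((q * om - c * p) * cos (om * t) - (p * om + c * q) * sin (om * t))) =
  - (expR (- (c * del)) * (p * cos (om * del) + q * sin (om * del))).
Proof.
move=> c0; have bd (x y t : R) : `|x * cos (om * t) + y * sin (om * t)| <= `|x| + `|y|.
  by rewrite (le_trans (ler_normD _ _))// lerD// normrM ler_piMr ?normr_cos ?normr_sin.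
pose A := q * om - c * p; pose B := - (p * om + c * q).
have fE (t : R) : A * cos (om * t) - (p * om + c * q) * sin (om * t) =
    A * cos (om * t) + B * sin (om * t) by rewrite /B mulNr.
have D (t : R) := is_derive_damped c om p q t.
pose K := `|A| + `|B|.
(* The primitive of the comparison function K e^(-ct) is taken from the same family, at frequency
   0. *)
have DH (t : R) : is_derive t 1 (fun t : R => expR (- (c * t)) * (- (K / c) * cos (0 * t) + 0 * sin (0 * t)))
    (K * expR (- (c * t))).
  apply: (is_derive_eq (is_derive_damped c 0 (- (K / c)) 0 t)).
  by rewrite !mul0r !mulr0 cos0 sin0; field; rewrite gt_eqF.
have Df (t : R) := is_derive_damped c om A B t.
have Dh (t : R) : is_derive t 1 (fun t : R => expR (- (c * t)) * (K * cos (0 * t) + 0 * sin (0 * t)))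
  _ := is_derive_damped c 0 K 0 t.
have hE : (fun t : R => expR (- (c * t)) * (K * cos (0 * t) + 0 * sin (0 * t))) = (fun t => K * expR (- (c * t))).
  by apply/funext => t; rewrite !mul0r cos0 mulr1 addr0 mulrC.
pose f (t : R) := expR (- (c * t)) * (A * cos (om * t) - (p * om + c * q) * sin (om * t)).
have f_le (t : R) : del < t -> `|f t| <= K * expR (- (c * t)).
  move=> _; rewrite /f fE normrM mulrC (ger0_norm (expR_ge0 _)).
  by apply: ler_wpM2r; [exact: expR_ge0|exact: bd].
have f_cont (t : R) : del < t -> {for t, continuous f}.
  move=> _; rewrite (_ : f = (fun t => expR (- (c * t)) * (A * cos (om * t) + B * sin (om * t)))).
    exact: is_derive_continuous (Df t).
  by apply/funext => u; rewrite /f fE.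
have h_cont (t : R) : del < t -> {for t, continuous (fun t : R => K * expR (- (c * t)))}.
  by move=> _; rewrite -hE; exact: is_derive_continuous (Dh t).
have F_del := cvg_at_right_filter (is_derive_continuous (D del)).
have H_del := cvg_at_right_filter (is_derive_continuous (DH del)).
have F_oo := cvg_expRN_bounded c0 (bd p q).
have H_oo : expR (- (c * t)) * (- (K / c) * cos (0 * t) + 0 * sin (0 * t)) @[t --> +oo] --> (0 : R).
  apply: (@cvg_expRN_bounded c `|- (K / c)|) => // t.
  by rewrite !mul0r cos0 mulr1 addr0.
have [I1 I2] := dominated_FTC2_oy f_le f_cont h_cont (fun t _ => D t) (fun t _ => DH t)
  F_del F_oo H_del H_oo.
by split; [exact: I1|rewrite I2 sub0r].
Qed.

End damped_trigonometric_integrals.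

Section complex_laplace.
Context {R : realType}.
Local Notation C := R[i].
Local Notation Re := (@complex.Re R).
Local Notation Im := (@complex.Im R).
Local Notation leb := (@lebesgue_measure R).
Variable lam : C.
Hypothesis lam_lt0 : Re lam < 0.
Local Notation b := (- Re lam).
Local Notation om := (Im lam).

(** [h] is the real or the imaginary part, which splits complex Laplace integrals into two real
    ones. *)
Definition laplace_weight (h : C -> R) (t : R) : R := h (cexp (t%:C * lam)).

Lemma laplace_weight_Re t : laplace_weight Re t = expR (- (b * t)) * cos (om * t).
Proof.
rewrite /laplace_weight /cexp; case: lam => x y /=.
by rewrite !mul0r !subr0 !addr0 mulNr opprK [t * x]mulrC [t * y]mulrC.
Qed.

Lemma laplace_weight_Im t : laplace_weight Im t = expR (- (b * t)) * sin (om * t).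
Proof.
rewrite /laplace_weight /cexp; case: lam => x y /=.
by rewrite !mul0r subr0 !addr0 mulNr opprK [t * x]mulrC [t * y]mulrC.
Qed.

Lemma laplace_weight_Re_le t : `|laplace_weight Re t| <= expR (- (b * t)).
Proof.
by rewrite laplace_weight_Re normrM (ger0_norm (expR_ge0 _)) ler_piMr ?expR_ge0 ?normr_cos.
Qed.

Lemma laplace_weight_Im_le t : `|laplace_weight Im t| <= expR (- (b * t)).
Proof.
by rewrite laplace_weight_Im normrM (ger0_norm (expR_ge0 _)) ler_piMr ?expR_ge0 ?normr_sin.
Qed.

Lemma measurable_expRM (x : R) : measurable_fun setT (fun t : R => expR (- (x * t))).
Proof. by do 2![apply: measurableT_comp => //]; apply: measurable_funM. Qed.

Lemma measurable_expRM_trig (x y : R) (f : R -> R) : continuous f ->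
  measurable_fun setT (fun t : R => expR (- (x * t)) * f (y * t)).
Proof.
move=> cf; apply: measurable_funM; first exact: measurable_expRM.
apply: (@measurableT_comp _ _ _ _ _ _ f); last exact: measurable_funM.
exact: continuous_measurable_fun.
Qed.

Lemma measurable_laplace_weight_Re : measurable_fun setT (laplace_weight Re).
Proof.
rewrite (_ : laplace_weight Re = (fun t => expR (- (b * t)) * cos (om * t))).
  by apply: measurable_expRM_trig; exact: continuous_cos.
by apply/funext => t; exact: laplace_weight_Re.
Qed.

Lemma measurable_laplace_weight_Im : measurable_fun setT (laplace_weight Im).
Proof.
rewrite (_ : laplace_weight Im = (fun t => expR (- (b * t)) * sin (om * t))).
  by apply: measurable_expRM_trig; exact: continuous_sin.
by apply/funext => t; exact: laplace_weight_Im.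
Qed.

(** The integral of e^(t(lam - kap)) over t > del, that is e^(del(lam - kap)) / (kap - lam). *)
Definition laplace_expR (del kap : R) : C :=
  (\int[leb]_(t in `]del, +oo[) (laplace_weight Re t * expR (- (t * kap)))) +i*
  (\int[leb]_(t in `]del, +oo[) (laplace_weight Im t * expR (- (t * kap)))).

Lemma laplace_expR_spec (del kap : R) : 0 <= kap ->
  [/\ leb.-integrable `]del, +oo[ (EFin \o (fun t => laplace_weight Re t * expR (- (t * kap)))),
     leb.-integrable `]del, +oo[ (EFin \o (fun t => laplace_weight Im t * expR (- (t * kap)))) &
     laplace_expR del kap =
     (expR (- ((b + kap) * del)) / ((b + kap) ^+ 2 + om ^+ 2) *
       ((b + kap) * cos (om * del) - om * sin (om * del))) +i*
     (expR (- ((b + kap) * del)) / ((b + kap) ^+ 2 + om ^+ 2) *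
       ((b + kap) * sin (om * del) + om * cos (om * del)))].
Proof.
move=> kap0; set c := b + kap.
have c0 : 0 < c by rewrite ltr_wpDr// oppr_gt0.
pose n2 := c ^+ 2 + om ^+ 2.
have n20 : n2 != 0 by rewrite gt_eqF// ltr_wpDr ?sqr_ge0// exprn_gt0.
(* The coefficients solve q om - c p = 1, p om + c q = 0 for the cosine, and in the next line the
   same system with right-hand sides 0 and -1 for the sine. *)
have [r1 r2] := @integral_damped R c om (- c / n2) (om / n2) del c0.
have [i1 i2] := @integral_damped R c om (- om / n2) (- c / n2) del c0.
have ER t : expR (- (c * t)) * ((om / n2 * om - c * (- c / n2)) * cos (om * t) -
    (- c / n2 * om + c * (om / n2)) * sin (om * t)) = laplace_weight Re t * expR (- (t * kap)).
  rewrite laplace_weight_Re [RHS]mulrAC -expRD.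
  have -> : - (b * t) - t * kap = - (c * t) by rewrite /c; ring.
  congr (_ * _).
  have -> : om / n2 * om - c * (- c / n2) = 1.
    by rewrite -(mulfV n20) {3}/n2; ring.
  have -> : - c / n2 * om + c * (om / n2) = 0 by ring.
  by rewrite mul1r mul0r subr0.
have EI t : expR (- (c * t)) * ((- c / n2 * om - c * (- om / n2)) * cos (om * t) -
    (- om / n2 * om + c * (- c / n2)) * sin (om * t)) = laplace_weight Im t * expR (- (t * kap)).
  rewrite laplace_weight_Im [RHS]mulrAC -expRD.
  have -> : - (b * t) - t * kap = - (c * t) by rewrite /c; ring.
  congr (_ * _).
  have -> : - om / n2 * om + c * (- c / n2) = -1.
    by rewrite -(mulfV n20) {3}/n2; ring.
  have -> : - c / n2 * om - c * (- om / n2) = 0 by ring.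
  by rewrite mul0r add0r mulN1r opprK.
split.
- by apply: eq_integrable r1 => // t _; rewrite /= ER.
- by apply: eq_integrable i1 => // t _; rewrite /= EI.
rewrite /laplace_expR -/n2; congr (_ +i* _).
- under eq_Rintegral do rewrite -ER.
  rewrite r2; move: (expR _) (cos _) (sin _) => X Y Z; ring.
- under eq_Rintegral do rewrite -EI.
  rewrite i2; move: (expR _) (cos _) (sin _) => X Y Z; ring.
Qed.

Lemma laplace_expR_mul (del kap : R) : 0 <= kap ->
  (kap%:C - lam) * laplace_expR del kap = cexp (del%:C * lam) * (expR (- (del * kap)))%:C.
Proof.
move=> kap0; have [_ _ ->] := laplace_expR_spec del kap0.
have c0 : 0 < b + kap by rewrite ltr_wpDr// oppr_gt0.
have n20 : (b + kap) ^+ 2 + om ^+ 2 != 0 by rewrite gt_eqF// ltr_wpDr ?sqr_ge0// exprn_gt0.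
have E1 := laplace_weight_Re del; have E2 := laplace_weight_Im del.
rewrite /laplace_weight in E1 E2; move: E1 E2.
have -> : expR (- ((b + kap) * del)) = expR (- (b * del)) * expR (- (del * kap)).
  by rewrite -expRD; congr expR; ring.
case: (cexp _) => u v /= -> ->.
move: n20 (expR _) (expR _) (cos _) (sin _); case: lam => x y /= n20 X Y co si.
by apply/eqP; rewrite eq_complex /=; apply/andP; split; apply/eqP; field.
Qed.

(** Damping (kap - lam)^(-1) by e^(-del kap) amounts to starting its Laplace integral at del instead
    of 0, up to the factor e^(-del lam), which tends to 1 with del -> 0. *)
Lemma resolvent_scalarE (del kap : R) : 0 <= kap ->
  (expR (- (del * kap)))%:C * (kap%:C - lam)^-1 =
  cexp (- del%:C * lam) * laplace_expR del kap.
Proof.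
move=> kap0.
have k0 : kap%:C - lam != 0.
  apply: contraTneq lam_lt0 => /eqP; rewrite subr_eq0 => /eqP <- /=.
  by rewrite -leNgt.
have ee : cexp (- del%:C * lam) * cexp (del%:C * lam) = 1.
  rewrite /cexp; case: lam => x y /=.
  rewrite !mulNr !mul0r !oppr0 !addr0 cosN sinN expRN.
  apply/eqP; rewrite eq_complex /=; apply/andP; split; apply/eqP.
    have := cos2Dsin2 (del * y); have := expR_gt0 (del * x).
    move: (expR _) (cos _) (sin _) => X Y Z X0 h.
    rewrite -[RHS]h; field; exact: lt0r_neq0.
  move: (expR _) (cos _) (sin _) => X Y Z; ring.
apply: (mulfI k0); rewrite mulrCA mulfV// mulr1 mulrCA laplace_expR_mul// mulrA ee mul1r//.
Qed.

Lemma radial_weight_laplace m (mu del : R) : 0 < mu -> 0 < del ->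
  radial_weight (del * mu) (2 / b)
    (fun p : m.-tuple (measurableTypeR R) => laplace_expR del (mu * sqt p)).
Proof.
move=> mu0 del0; have b0 : 0 < b by rewrite oppr_gt0.
have kp (p : m.-tuple (measurableTypeR R)) : 0 <= mu * sqt p.
  by rewrite mulr_ge0 ?sqt_ge0 ?(ltW mu0).
pose den (kap : R) := expR (- ((b + kap) * del)) / ((b + kap) ^+ 2 + om ^+ 2).
have mden : measurable_fun setT (fun p : m.-tuple (measurableTypeR R) => den (mu * sqt p)).
  have mk : measurable_fun setT (fun p : m.-tuple (measurableTypeR R) => b + mu * sqt p).
    by apply: measurable_funD => //; apply: measurable_funM => //; exact: measurable_sqt.
  apply: measurable_funM.
    by do 2![apply: measurableT_comp => //]; apply: measurable_funM.
  rewrite (_ : (fun p => _) = (fun p => ((b + mu * sqt p) ^+ 2 + om ^+ 2) `^ (- 1))).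
    apply: (@measurableT_comp _ _ _ _ _ _ (fun x : R => x `^ (- 1))); first exact: measurable_powR.
    by apply: measurable_funD => //; exact: measurable_funX.
  by apply/funext => p; rewrite powR_inv1// addr_ge0 ?sqr_ge0.
have mlin (x y : R) : measurable_fun setT
    (fun p : m.-tuple (measurableTypeR R) => den (mu * sqt p) * ((b + mu * sqt p) * x + y)).
  apply: measurable_funM => //; apply: measurable_funD => //; apply: measurable_funM => //.
  by apply: measurable_funD => //; apply: measurable_funM => //; exact: measurable_sqt.
have bound (kap x y : R) : 0 <= kap -> `|x| <= 1 -> `|y| <= 1 ->
    `|den kap * ((b + kap) * x + om * y)| <= 2 / b * expR (- (del * kap)).
  move=> kap0 x1 y1; have c0 : 0 < b + kap by rewrite ltr_wpDr.
  have cb : b <= b + kap by rewrite lerDl.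
  have n20 : 0 < (b + kap) ^+ 2 + om ^+ 2 by rewrite ltr_wpDr ?sqr_ge0// exprn_gt0.
  rewrite /den normrM normrM (ger0_norm (expR_ge0 _)) (ger0_norm (ltW _)) ?invr_gt0//.
  have h1 : `|(b + kap) * x + om * y| <= (b + kap) + `|om|.
    apply: le_trans (ler_normD _ _) _; rewrite !normrM (ger0_norm (ltW c0)).
    by apply: lerD; apply: ler_piMr => //; exact: ltW.
  (* With c = b + kap >= b and o = |om|: (c + o) b <= c^2 + o c <= 2 (c^2 + o^2). *)
  have h2 : ((b + kap) + `|om|) / ((b + kap) ^+ 2 + om ^+ 2) <= 2 / b.
    rewrite ler_pdivrMr// mulrAC ler_pdivlMr// mulrDl mulrDr.
    rewrite -(real_normK (num_real om)).
    have := normr_ge0 om; move: `|om| (b + kap) c0 cb => o c' c0 cb o0.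
    by have := sqr_ge0 (c' - o); nra.
  rewrite [leRHS]mulrC -[leLHS]mulrA; apply: ler_pM.
  - exact: expR_ge0.
  - by rewrite mulr_ge0// invr_ge0 ltW.
  - by rewrite ler_expR lerN2 mulrC ler_wpM2r ?(ltW del0)// lerDr ltW.
  - by apply: le_trans h2; rewrite mulrC ler_wpM2r// invr_ge0 ltW.
split.
- exact: mulr_gt0.
- rewrite (_ : Re \o _ = (fun p => den (mu * sqt p) * ((b + mu * sqt p) * cos (om * del) + - (om * sin (om * del))))) //.
  by apply/funext => p; rewrite -[LHS]/(Re (laplace_expR del (mu * sqt p))); have [_ _ ->] := laplace_expR_spec del (kp p).
- rewrite (_ : Im \o _ = (fun p => den (mu * sqt p) * ((b + mu * sqt p) * sin (om * del) + om * cos (om * del)))) //.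
  by apply/funext => p; rewrite -[LHS]/(Im (laplace_expR del (mu * sqt p))); have [_ _ ->] := laplace_expR_spec del (kp p).
- by move=> p; rewrite sqt_opp.
- move=> p; have [_ _ ->] := laplace_expR_spec del (kp p); rewrite -(mulrA del); split.
    have := @bound (mu * sqt p) (cos (om * del)) (- sin (om * del)) (kp p) (normr_cos _).
    by rewrite normrN mulrN; apply; exact: normr_sin.
  exact: (bound (mu * sqt p) (sin (om * del)) (cos (om * del)) (kp p) (normr_sin _) (normr_cos _)).
Qed.

End complex_laplace.

Section laplace_fubini.
Context {R : realType} {m : nat}.
Local Notation leb := (@lebesgue_measure R).
Local Notation E := (m.-tuple (measurableTypeR R)).
Local Notation lam := (lebesgue_Rn R m).
Variables (b : R) (wt : R -> R).
Hypothesis b0 : 0 < b.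
Hypothesis mwt : measurable_fun setT wt.
Hypothesis wt_le : forall t, `|wt t| <= expR (- (b * t)).

(** For t > del the integrand is at most e^(-bt) e^(-del mu|xi|^2), a product integrable in both
    variables; the positive cut is what makes Fubini legitimate. *)
Lemma lap_fubini (J : seq 'I_m) k (mu del : R) w : 0 < mu -> 0 < del -> size J = k.*2 ->
  (forall kap : R, 0 <= kap ->
     leb.-integrable `]del, +oo[ (EFin \o (fun t => wt t * expR (- (t * kap))))) ->
  \int[lam]_p (mon J p * sqt p ^- k * cos (dott w p) *
     \int[leb]_(t in `]del, +oo[) (wt t * expR (- (t * (mu * sqt p))))) =
  lap wt J 0 k mu del w.
Proof.
move=> mu0 del0 Jk iw.
have mD : measurable (`]del, +oo[%classic : set (measurableTypeR R)) by [].
have kp (p : E) : 0 <= mu * sqt p by rewrite mulr_ge0 ?sqt_ge0 ?(ltW mu0).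
pose F (z : measurableTypeR R * E) : R := wt z.1 * core J 0 k (z.1 * mu) w z.2.
have mF : measurable_fun setT F.
  apply: measurable_funM; first by apply: (measurableT_comp mwt); exact: measurable_fst.
  apply: (@measurableT_comp _ _ _ _ _ _ (fun z => core J 0 k z.1 w z.2) _
    (fun z : measurableTypeR R * E => (z.1 * mu, z.2))); first exact: measurable_core2.
  apply/measurable_fun_pairP; split; last exact: measurable_snd.
  by apply: measurable_funM => //; exact: measurable_fst.
have FE t p : F (t, p) = mon J p * sqt p ^- k * cos (dott w p) * (wt t * expR (- (t * (mu * sqt p)))).
  rewrite /F /= /core /gw mulrA -[cos _]/(trem 0 _).
  by rewrite -(mulrA t mu); move: (expR _) (trem _ _) => X Y; ring.
have Jq : (size J + 0 = k.*2)%N by rewrite addn0.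
have i1 t : `]del, +oo[%classic t -> lam.-integrable setT (fun p => (F (t, p))%:E).
  rewrite /= in_itv/= andbT => dt.
  have t0 : 0 < t * mu by rewrite mulr_gt0// (lt_trans del0).
  have ic : lam.-integrable setT (EFin \o core J 0 k (t * mu) w).
    by apply: integrable_core => //; rewrite Jq ?odd_double.
  exact: (integrableZl measurableT (wt t) ic).
have i2 p : leb.-integrable `]del, +oo[ (fun t => (F (t, p))%:E).
  have := integrableZl mD (mon J p * sqt p ^- k * cos (dott w p)) (iw _ (kp p)).
  by apply: eq_integrable => // t _; rewrite /= FE.
have F_le t p : del < t -> `|F (t, p)| <= expR (- (b * t)) * expR (- (del * mu * sqt p)).
  move=> dt; rewrite normrM; apply: ler_pM => //.
  apply: le_trans (core_le _ _ _ Jq) _; rewrite expr0 mul1r ler_expR lerN2.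
  by apply: ler_wpM2r; [exact: sqt_ge0|rewrite ler_wpM2r ?(ltW mu0)// ltW].
have fin : (\int[lam]_p \int[leb]_(t in `]del, +oo[) `|F (t, p)|%:E < +oo)%E.
  pose f z : \bar R := `|F z|%:E.
  have mf : measurable_fun setT f.
    by apply/measurable_EFinP; apply: measurableT_comp.
  have f0 z : (0 <= f z)%E by rewrite lee_fin.
  rewrite (@ge0_fubini_restrict R m `]del, +oo[ f mD mf f0).
  have G0 : 0 < del * mu by exact: mulr_gt0.
  pose G := (pi / (del * mu)) `^ (m%:R / 2).
  have inner t : del < t -> (\int[lam]_p f (t, p) <= (G * expR (- (t * b)))%:E)%E.
    move=> dt; apply: (@le_trans _ _
      (\int[lam]_p ((expR (- (b * t)))%:E * (expR (- (del * mu * sqt p)))%:E))%E).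
      apply: ge0_le_integral => //.
      - apply: (measurableT_comp mf); exact: pair1_measurable.
      - apply/measurable_EFinP; apply: measurable_funM => //; exact: measurable_gauss.
      - by move=> p _; rewrite -EFinM lee_fin; exact: F_le.
    rewrite ge0_integralZl//; last by apply/measurable_EFinP; exact: measurable_gauss.
    by rewrite integral_gauss0// -EFinM lee_fin mulrC (mulrC b).
  apply: (@le_lt_trans _ _ (\int[leb]_(t in `]del, +oo[) (G%:E * (expR (- (t * b)))%:E))%E).
    apply: ge0_le_integral => //.
    - by move=> t _; apply: integral_ge0.
    - apply: measurable_funTS; exact: (@measurable_fun_fubini_tonelli_F _ _ _ _ _ lam f).
    - apply/measurable_EFinP; apply: measurable_funTS; apply: measurable_funM => //.
      by do 2![apply: measurableT_comp => //]; apply: measurable_funM.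
    - by move=> t; rewrite /= in_itv/= andbT => dt; rewrite -EFinM; exact: inner.
  rewrite ge0_integralZl//.
  - by rewrite integral_expR_tail// -EFinM ltry.
  - apply/measurable_EFinP; apply: measurable_funTS.
    by do 2![apply: measurableT_comp => //]; apply: measurable_funM.
  - by rewrite lee_fin powR_ge0.
have [I1 I2] := fubini_restrict mD mF i1 i2 fin.
have -> : lap wt J 0 k mu del w = \int[leb]_(t in `]del, +oo[) \int[lam]_p F (t, p).
  apply: eq_Rintegral => t; rewrite inE/= in_itv/= andbT => dt.
  have t0 : 0 < t * mu by rewrite mulr_gt0// (lt_trans del0).
  rewrite /osc -RintegralZl//.
  by apply: integrable_core => //; rewrite Jq ?odd_double.
rewrite -I2; apply: eq_Rintegral => p _.
rewrite -RintegralZl//; last exact: iw.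
by apply: eq_Rintegral => t _; rewrite FE.
Qed.

End laplace_fubini.

Section complex_limits.
Context {R : realType} {T : Type} (F : set_system T) {FF : Filter F}.
Local Notation C := R[i].
Local Notation Re := (@complex.Re R).
Local Notation Im := (@complex.Im R).
Implicit Types (f g : T -> C) (l : C).

Definition ccvg f l := (Re (f x) @[x --> F] --> Re l) /\ (Im (f x) @[x --> F] --> Im l).

Lemma ccvg_cst l : ccvg (fun _ => l) l.
Proof. by split; exact: cvg_cst. Qed.

Lemma ccvgD f g l l' : ccvg f l -> ccvg g l' -> ccvg (fun x => f x + g x) (l + l').
Proof.
move=> [f1 f2] [g1 g2].
have rE (u v : C) : Re (u + v) = Re u + Re v by case: u v => ? ? [].
have iE (u v : C) : Im (u + v) = Im u + Im v by case: u v => ? ? [].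
split; first by rewrite rE; under eq_fun do rewrite rE; exact: cvgD.
by rewrite iE; under eq_fun do rewrite iE; exact: cvgD.
Qed.

Lemma ccvgM f g l l' : ccvg f l -> ccvg g l' -> ccvg (fun x => f x * g x) (l * l').
Proof.
move=> [f1 f2] [g1 g2].
have rE (u v : C) : Re (u * v) = Re u * Re v - Im u * Im v by case: u v => ? ? [].
have iE (u v : C) : Im (u * v) = Re u * Im v + Im u * Re v by case: u v => ? ? [].
split.
  by rewrite rE; under eq_fun do rewrite rE; apply: cvgB; exact: cvgM.
by rewrite iE; under eq_fun do rewrite iE; apply: cvgD; exact: cvgM.
Qed.

Lemma ccvg_sum (I : eqType) (r : seq I) (f : I -> T -> C) (l : I -> C) :
  (forall i, i \in r -> ccvg (f i) (l i)) ->
  ccvg (fun x => \sum_(i <- r) f i x) (\sum_(i <- r) l i).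
Proof.
elim: r => [|i r IH] fl.
  by rewrite big_nil; under eq_fun do rewrite big_nil; exact: ccvg_cst.
rewrite big_cons (_ : (fun x => _) = (fun x => f i x + \sum_(j <- r) f j x)); last first.
  by apply/funext => x; rewrite big_cons.
apply: ccvgD; first by apply: fl; rewrite mem_head.
by apply: IH => j jr; apply: fl; rewrite in_cons jr orbT.
Qed.

Context {m N : nat} (a : 'I_m -> 'I_m -> 'M[C]_N).

Lemma mx_cvg_wsum k (al : C) (D : seq 'I_m -> T -> C) (l : seq 'I_m -> C) :
  (forall J, size J = k.*2 -> ccvg (D J) (l J)) ->
  mx_cvg F (fun x => al *: wsum a k (fun J => D J x)) (al *: wsum a k l).
Proof.
move=> Dl i j; suff : ccvg (fun x => \sum_(w <- words a k) (al * w.2 i j) * D w.1 x)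
    (\sum_(w <- words a k) (al * w.2 i j) * l w.1).
  have E (d : seq 'I_m -> C) : \sum_(w <- words a k) (al * w.2 i j) * d w.1 =
      (al *: wsum a k d) i j.
    rewrite mxE /wsum summxE mulr_sumr; apply: eq_bigr => w _.
    by rewrite mxE -mulrA [w.2 i j * _]mulrC.
  rewrite E (_ : (fun x => _) = (fun x => (al *: wsum a k (fun J => D J x)) i j))//.
  by apply/funext => x; exact: (E (fun J => D J x)).
apply: ccvg_sum => w /size_words wk; apply: ccvgM; first exact: ccvg_cst.
exact: Dl.
Qed.

Lemma mx_cvg_sum (I : finType) (f : I -> T -> 'M[C]_N) (l : I -> 'M[C]_N) :
  (forall i, mx_cvg F (f i) (l i)) ->
  mx_cvg F (fun x => \sum_i f i x) (\sum_i l i).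
Proof.
move=> fl x y; have : ccvg (fun t => \sum_i f i t x y) (\sum_i l i x y).
  by apply: ccvg_sum => i _; exact: fl.
rewrite -summxE (_ : (fun t => _) = (fun t => (\sum_i f i t) x y))//.
by apply/funext => t; rewrite summxE.
Qed.

Lemma near_mx_cvg (f g : T -> 'M[C]_N) L : (\forall x \near F, f x = g x) ->
  mx_cvg F f L -> mx_cvg F g L.
Proof.
move=> fg fL i j; have [f1 f2] := fL i j; split.
  by apply: cvg_trans f1; apply: near_eq_cvg; apply: filterS fg => x ->.
by apply: cvg_trans f2; apply: near_eq_cvg; apply: filterS fg => x ->.
Qed.

End complex_limits.

Lemma cvg_divr_at_right (R : realType) (mu : R) : 0 < mu ->
  x / mu @[x --> (0 : R)^'+] --> (0 : R)^'+.
Proof.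
move=> mu0 P [e e0 eP]; exists (e * mu); first exact: mulr_gt0.
move=> x; rewrite /= sub0r normrN => xe x0; apply: eP; last by rewrite divr_gt0.
by rewrite /= sub0r normrN normrM normfV (gtr0_norm mu0) ltr_pdivrMr.
Qed.

Section resolvent_kernel.
Context {R : realType} {m N s : nat}.
Local Notation C := R[i].
Local Notation Re := (@complex.Re R).
Local Notation Im := (@complex.Im R).
Local Notation E := (m.-tuple (measurableTypeR R)).
Local Notation leb := (lebesgue_Rn R m).
Variables (a : 'I_m -> 'I_m -> 'M[C]_N) (mu : 'rV[R]_s).
Hypothesis m_gt0 : (0 < m)%N.
Hypothesis a_herm : forall j k, a j k \is hermsymmx.
Hypothesis mu_gt0 : forall i, 0 < mu 0 i.
Hypothesis mu_distinct : forall i j, mu 0 i = mu 0 j -> i = j.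
Hypothesis A_eigenvalues : forall xi : 'rV[R]_m, xi != 0 -> forall z : C,
  eigenvalue (symbol a xi) z -> exists i, z = (mu 0 i * sqnorm xi)%:C.
Local Notation c := (invmx (Vandermonde s mu)).
Variable lam : C.
Hypothesis lam_lt0 : Re lam < 0.
Local Notation wR := (laplace_weight lam Re).
Local Notation wI := (laplace_weight lam Im).

Let b0 : 0 < - Re lam. Proof. by rewrite oppr_gt0. Qed.

Definition complex_lap (J : seq 'I_m) q k (nu del : R) w : C :=
  lap wR J q k nu del w +i* lap wI J q k nu del w.

Lemma cintegral_resolvent J k w (nu del : R) : 0 < nu -> 0 < del -> size J = k.*2 ->
  cintegrable leb setT (wave_term J k w (fun p => laplace_expR lam del (nu * sqt p))) /\
  cintegral leb setT (wave_term J k w (fun p => laplace_expR lam del (nu * sqt p))) =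
  complex_lap J 0 k nu del w.
Proof.
move=> nu0 del0 Jk.
have rw := radial_weight_laplace lam_lt0 m nu0 del0.
have [I1 ->] := cintegral_wave_term w Jk rw; split=> //.
rewrite /complex_lap; congr (_ +i* _).
- rewrite -(@lap_fubini _ _ (- Re lam) wR b0)//.
  + exact: measurable_laplace_weight_Re.
  + exact: laplace_weight_Re_le.
  + by move=> kap k0; have [] := laplace_expR_spec lam_lt0 del k0.
- rewrite -(@lap_fubini _ _ (- Re lam) wI b0)//.
  + exact: measurable_laplace_weight_Im.
  + exact: laplace_weight_Im_le.
  + by move=> kap k0; have [] := laplace_expR_spec lam_lt0 del k0.
Qed.

Lemma resolvent0_dampedE (x y : 'rV[R]_m) (eps : R) : 0 < eps ->
  resolvent0_damped a lam x y eps =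
  \sum_i \sum_k (c i k / (2 * pi) ^+ m)%:C *: wsum a k (fun J =>
    cexp (- (eps / mu 0 i)%:C * lam) * complex_lap J 0 k (mu 0 i) (eps / mu 0 i) (x - y)).
Proof.
move=> eps0; have [N0|N0] := posnP N.
  by apply/matrixP => i j; have := ltn_ord i; rewrite [X in (_ < X)%N]N0.
have del0 i : 0 < eps / mu 0 i by rewrite divr_gt0.
(* The cut depends on i so that (eps / mu_i) mu_i |xi|^2 = eps |xi|^2, a damping common to all
   eigenvalues. *)
pose rho i (p : E) := cexp (- (eps / mu 0 i)%:C * lam) *
  laplace_expR lam (eps / mu 0 i) (mu 0 i * sqt p).
have wE i J k : wave_term J k (x - y) (rho i) = (fun p => cexp (- (eps / mu 0 i)%:C * lam) *
    wave_term J k (x - y) (fun p => laplace_expR lam (eps / mu 0 i) (mu 0 i * sqt p)) p).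
  by apply/funext => p; rewrite /wave_term /rho mulrCA.
have wint i (k : nat) J : size J = k.*2 ->
    cintegrable leb setT (wave_term J k (x - y) (rho i)) /\
    cintegral leb setT (wave_term J k (x - y) (rho i)) =
    cexp (- (eps / mu 0 i)%:C * lam) * complex_lap J 0 k (mu 0 i) (eps / mu 0 i) (x - y).
  move=> Jk; have [h1 h2] := cintegral_resolvent (x - y) (mu_gt0 i) (del0 i) Jk.
  by have := cintegralZ measurableT (cexp (- (eps / mu 0 i)%:C * lam)) h1; rewrite wE h2.
rewrite /resolvent0_damped.
have -> : (fun p : E => (plane_wave (vec_of_tuple p) (x - y) *
      (expR (- (eps * sqnorm (vec_of_tuple p))))%:C) *: invmx (symbol a (vec_of_tuple p) - lam%:M)) =
    (fun p : E => plane_wave (vec_of_tuple p) (x - y) *: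
      \sum_i rho i p *: sproj mu (symbol a (vec_of_tuple p)) (sqt p) i).
  apply/funext => p; rewrite -scalerA; congr (_ *: _).
  have [S1 S2] := sum_sproj_symbol m_gt0 a_herm mu_distinct A_eigenvalues (vec_of_tuple p) N0.
  have kp i : 0 <= mu 0 i * sqt p by rewrite mulr_ge0 ?sqt_ge0 ?(ltW (mu_gt0 i)).
  rewrite (invmx_sproj S1 S2 (lam := lam)); last first.
    move=> i; apply: contraTneq lam_lt0 => /eqP; rewrite subr_eq0 => /eqP <- /=.
    by rewrite -leNgt kp.
  rewrite scaler_sumr; apply: eq_bigr => i _; rewrite scalerA; congr (_ *: _).
  rewrite /rho -resolvent_scalarE//; congr (_%:C * _).
  by rewrite mulrA divfK ?gt_eqF.
rewrite (mx_integral_sproj a mu (fun i k J Jk => (wint i k J Jk).1)).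
apply: eq_bigr => i _; apply: eq_bigr => k _; congr (_ *: _).
by apply: eq_wsum => J Jk; exact: (wint i k J Jk).2.
Qed.

Section differentiation.
Variables (k : nat) (nu del : R) (y : 'rV[R]_m).
Hypotheses (nu0 : 0 < nu) (del0 : 0 <= del).

(** What remains when [profileE] is inserted at tau = t nu: the weight t^(-m/2+k) cancels the power
    of t there. *)
Definition laplace_const : R := (-1) ^+ k * (pi `^ (- (m%:R / 2)) * nu `^ (m%:R / 2 - k%:R)).

Definition laplace_derivative (J : seq 'I_m) (x : 'rV[R]_m) : C :=
  laplace_const%:C * complex_lap J (k.*2 - size J) k nu del (x - y).

Lemma laplace_const_mul (A B : R) : laplace_const%:C * (A +i* B) = (laplace_const * A) +i* (laplace_const * B).
Proof. by apply/eqP; rewrite eq_complex /= !mul0r subr0 addr0 !eqxx. Qed.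

Lemma laplace_profileE (x : 'rV[R]_m) :
  near_admissible (m := m) del (sqnorm (x - y)) k.*2 ->
  laplace_profile k nu lam y del x = laplace_derivative [::] x.
Proof.
move=> adm; rewrite /laplace_derivative subn0.
have E (t : R) : del < t -> t `^ (- (m%:R / 2) + k%:R) * profile k (t * nu) y x =
    laplace_const * osc [::] k.*2 k (t * nu) (x - y).
  move=> dt; have t0 : 0 < t by exact: le_lt_trans dt.
  rewrite (profileE m_gt0 k y (mulr_gt0 t0 nu0)) /profile_derivative subn0 !mulrA; congr (_ * _).
  rewrite /laplace_const powRM ?(ltW t0) ?(ltW nu0)//.
  have -> : - (m%:R / 2) + k%:R = k%:R - m%:R / 2 :> R by ring.
  have -> : m%:R / 2 - k%:R = - (k%:R - m%:R / 2) :> R by ring.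
  rewrite !powRN.
  have p1 : pi `^ (m%:R / 2) != 0 :> R by rewrite gt_eqF// powR_gt0// pi_gt0.
  have p2 : t `^ (k%:R - m%:R / 2) != 0 by rewrite gt_eqF// powR_gt0.
  have p3 : nu `^ (k%:R - m%:R / 2) != 0 by rewrite gt_eqF// powR_gt0.
  move: (_ `^ _) (_ `^ _) (_ `^ _) (_ ^+ _) p1 p2 p3 => P Q S T p1 p2 p3.
  by field; rewrite p1 p2 p3.
have iR := integrable_lap b0 (measurable_laplace_weight_Re lam)
  (fun t _ => laplace_weight_Re_le lam t) (J := [::]) m_gt0 nu0 (add0n _) del0 adm.
have iI := integrable_lap b0 (measurable_laplace_weight_Im lam)
  (fun t _ => laplace_weight_Im_le lam t) (J := [::]) m_gt0 nu0 (add0n _) del0 adm.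
have reM (z : C) (r : R) : Re (z * r%:C) = Re z * r by case: z => u v /=; rewrite mulr0 subr0.
have imM (z : C) (r : R) : Im (z * r%:C) = Im z * r by case: z => u v /=; rewrite mulr0 add0r.
have inD (t : R) : t \in `]del, +oo[%classic -> del < t by rewrite inE/= in_itv/= andbT.
rewrite laplace_const_mul /laplace_profile /cintegral; congr (_ +i* _).
- rewrite /lap -RintegralZl//; apply: eq_Rintegral => t /inD dt.
  by rewrite reM E// -[Re _]/(wR t) mulrCA.
- rewrite /lap -RintegralZl//; apply: eq_Rintegral => t /inD dt.
  by rewrite imM E// -[Im _]/(wI t) mulrCA.
Qed.

Lemma near_admissible_le r q q' : (q' <= q)%N ->
  near_admissible (m := m) del r q -> near_admissible (m := m) del r q'.
Proof.
move=> qq [h|[h|[r0 qm]]]; [by left|by right; left|right; right; split=> //].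
by case/orP: qm => [q1|->]; rewrite ?orbT// (leq_trans qq).
Qed.

(** Iterated derivatives need their formulas on an open set. Only the off-diagonal regime depends on
    the point, through the continuous function [sqnorm]. *)
Lemma open_admissible q : open [set z : 'rV[R]_m | near_admissible (m := m) del (sqnorm (z - y)) q].
Proof.
have [h|h] := pselect (0 < del \/ m = 1%N).
  rewrite (_ : [set z | _] = setT); first exact: openT.
  by apply/seteqP; split=> z //= _; case: h; [left|right; left].
have [qm|qm] := boolP ((q <= 1) || (m <= 3))%N; last first.
  rewrite (_ : [set z | _] = set0); first exact: open0.
  apply/seteqP; split=> z //= [z0|[m1|[_ qm']]].
  - by apply: h; left.
  - by apply: h; right.
  - by rewrite qm' in qm.
rewrite (_ : [set z | _] = [set z | 0 < sqnorm (z - y)]); last first.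
  apply/seteqP; split=> z /=; last by move=> z0; right; right.
  by case=> [z0|[m1|[]//]]; exfalso; apply: h; [left|right].
have cont : continuous (fun z : 'rV[R]_m => sqnorm (z - y)).
  move=> z; rewrite /sqnorm /dotr.
  apply: (@cvg_sumr R _ (nbhs z) _ _ (index_enum 'I_m) (fun j (z : 'rV[R]_m) => (z - y) 0 j * (z - y) 0 j)
     (fun j => (z - y) 0 j * (z - y) 0 j)) => j.
  have cj : (v - y) 0 j @[v --> z] --> (z - y) 0 j.
    have vE (v : 'rV[R]_m) : (v - y) 0 j = v 0 j + - y 0 j by rewrite !mxE.
    have cz := @coord_continuous R 1 m 0 j z.
    rewrite vE; under eq_fun do rewrite vE.
    exact: (cvgD cz (cvg_cst _)).
  exact: cvgM.
rewrite (_ : [set z | _] = (fun z : 'rV[R]_m => sqnorm (z - y)) @^-1` [set u | 0 < u])//.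
by apply: open_comp => [z _|]; [exact: cont|exact: open_gt].
Qed.

Lemma laplace_derivative_family :
  derivative_family [set z | near_admissible (m := m) del (sqnorm (z - y)) k.*2] k.*2
    (fun J x => Re (laplace_derivative J x)) /\
  derivative_family [set z | near_admissible (m := m) del (sqnorm (z - y)) k.*2] k.*2
    (fun J x => Im (laplace_derivative J x)).
Proof.
have Jq (J : seq 'I_m) : (size J < k.*2)%N -> (size J + (k.*2 - (size J).+1).+1 = k.*2)%N.
  by move=> Jk; rewrite -subSn// subSS subnKC// ltnW.
have jq (J : seq 'I_m) : (size J < k.*2)%N -> ((k.*2 - (size J).+1).+1 <= k.*2)%N.
  by move=> Jk; rewrite -subSn// subSS leq_subr.
have reE J : (fun x => Re (laplace_derivative J x)) =
    laplace_const \*: (fun x => lap wR J (k.*2 - size J) k nu del (x - y)).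
  by apply/funext => x; rewrite /laplace_derivative laplace_const_mul.
have imE J : (fun x => Im (laplace_derivative J x)) =
    laplace_const \*: (fun x => lap wI J (k.*2 - size J) k nu del (x - y)).
  by apply/funext => x; rewrite /laplace_derivative laplace_const_mul.
split=> J j x Jk adm.
- have D := is_derive_subr (is_derive_lap b0 (measurable_laplace_weight_Re lam)
    (fun t _ => laplace_weight_Re_le lam t) j m_gt0 nu0 (Jq J Jk) del0
    (near_admissible_le (jq J Jk) adm)).
  rewrite reE; have := is_deriveZ laplace_const D.
  by rewrite -subSn// subSS /laplace_derivative laplace_const_mul.
- have D := is_derive_subr (is_derive_lap b0 (measurable_laplace_weight_Im lam)
    (fun t _ => laplace_weight_Im_le lam t) j m_gt0 nu0 (Jq J Jk) del0
    (near_admissible_le (jq J Jk) adm)).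
  rewrite imE; have := is_deriveZ laplace_const D.
  by rewrite -subSn// subSS /laplace_derivative laplace_const_mul.
Qed.

(** Serves both clauses of [is_F0_laplace]: a positive cut is always admissible, and at del = 0 off
    the diagonal the index 2k is admissible for k = 0 or m <= 3. *)
Lemma F0_laplaceE (x : 'rV[R]_m) : near_admissible (m := m) del (sqnorm (x - y)) k.*2 ->
  F0_laplace a k nu lam y x del =
  (pi `^ (- (m%:R / 2)) * nu `^ (m%:R / 2))%:C *: wsum a k (fun J => complex_lap J 0 k nu del (x - y)).
Proof.
move=> adm; have [fR fI] := laplace_derivative_family.
rewrite /F0_laplace (@iter_F0 R m N a _ k.*2 laplace_derivative _ nu k x
  (@open_admissible k.*2) laplace_profileE fR fI (leqnn _) adm).
rewrite -!wsumZ; apply: eq_wsum => J Jk.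
rewrite /laplace_derivative Jk subnn mulrA -rmorphM; congr (_%:C * _).
rewrite /laplace_const (exprNn nu).
have s1 : (-1) ^+ k * (-1) ^+ k = 1 :> R by rewrite -exprMn mulrNN mulr1 expr1n.
have -> : nu `^ (m%:R / 2) = nu ^+ k * nu `^ (m%:R / 2 - k%:R).
  rewrite -powR_mulrn ?(ltW nu0)// -powRD; last by rewrite (gt_eqF nu0) implybT.
  by congr (_ `^ _); ring.
move: (nu ^+ k) ((-1) ^+ k) s1 (_ `^ _) (_ `^ _) => X S s1 P Q.
rewrite -[RHS]mul1r -s1; ring.
Qed.

End differentiation.

Lemma ccvg_cexp (nu : R) : 0 < nu -> ccvg (0 : R)^'+ (fun eps => cexp (- (eps / nu)%:C * lam)) 1.
Proof.
move=> nu0.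
have E (eps : R) : - (eps / nu)%:C = (- (eps / nu))%:C :> C by rewrite rmorphN.
have lim : - (eps / nu) @[eps --> (0 : R)^'+] --> (0 : R).
  rewrite -[X in _ --> X]oppr0; apply: cvgN.
  by apply: cvg_trans (cvg_divr_at_right nu0) _; exact: cvg_within.
(* The real and imaginary parts of e^(t lam) are the damped cosine, (p, q) = (1, 0), and the damped
   sine, (p, q) = (0, 1). *)
have cont (p q : R) := is_derive_continuous (is_derive_damped (- Re lam) (Im lam) p q 0).
split.
- under eq_fun do rewrite E -[Re _]/(wR _) laplace_weight_Re.
  have := cvg_comp _ _ lim (cont 1 0).
  rewrite !mulr0 oppr0 expR0 cos0 sin0 mulr0 addr0 !mul1r => h.
  apply: cvg_trans h; apply: near_eq_cvg; apply: nearW => x /=.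
  by rewrite mul1r mul0r addr0.
- under eq_fun do rewrite E -[Im _]/(wI _) laplace_weight_Im.
  have := cvg_comp _ _ lim (cont 0 1).
  rewrite !(mulr0, oppr0, expR0, cos0, sin0, mul0r, addr0) => h.
  apply: cvg_trans h; apply: near_eq_cvg; apply: nearW => x /=.
  by rewrite mul1r mul0r add0r.
Qed.

Variables x y : 'rV[R]_m.
Hypothesis x_neq_y : (1 < m)%N -> x != y.

Lemma near_admissible0 : m = 1%N \/ 0 < sqnorm (x - y).
Proof.
have [m1|m1] := ltnP 1 m; last by left; apply/eqP; rewrite eqn_leq m1.
by right; rewrite lt_neqAle sqnorm_ge0 andbT eq_sym sqnorm_eq0 subr_eq0 x_neq_y.
Qed.

(** All 2k derivatives are spent and the remainder index is 0, so the Laplace integral converges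
    absolutely at t = 0 in every dimension off the diagonal, and on it for m = 1. This is why the
    limit comes after F_0^k. *)
Lemma ccvg_complex_lap (J : seq 'I_m) k (nu : R) : size J = k.*2 -> 0 < nu ->
  ccvg (0 : R)^'+ (fun del => complex_lap J 0 k nu del (x - y)) (complex_lap J 0 k nu 0 (x - y)).
Proof.
move=> Jk nu0; have Jq : (size J + 0 = k.*2)%N by rewrite addn0.
have adm : near_admissible (m := m) 0 (sqnorm (x - y)) 0.
  by right; case: near_admissible0 => [|h]; [left|right].
split.
- by apply: (cvg_lap b0 (measurable_laplace_weight_Re lam) (fun t _ => laplace_weight_Re_le lam t)).
- by apply: (cvg_lap b0 (measurable_laplace_weight_Im lam) (fun t _ => laplace_weight_Im_le lam t)).
Qed.

Definition resolvent_limit (nu : R) k : 'M[C]_N :=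
  (pi `^ (- (m%:R / 2)) * nu `^ (m%:R / 2))%:C *: wsum a k (fun J => complex_lap J 0 k nu 0 (x - y)).

Lemma is_F0_laplace_limit (nu : R) k : 0 < nu ->
  is_F0_laplace a k nu lam y x (resolvent_limit nu k).
Proof.
move=> nu0; split.
  apply: (near_mx_cvg (f := fun del => (pi `^ (- (m%:R / 2)) * nu `^ (m%:R / 2))%:C *:
      wsum a k (fun J => complex_lap J 0 k nu del (x - y)))).
    near=> del; have del0 : 0 < del by near: del; exact: nbhs_right_gt.
    by rewrite F0_laplaceE ?ltW//; left.
  by apply: mx_cvg_wsum => J Jk; exact: ccvg_complex_lap.
move=> mk; rewrite F0_laplaceE//.
right; case: near_admissible0 => [|h]; [by left|right; split=> //].
by case/orP: mk => [->|/eqP ->]; rewrite ?orbT.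
Unshelve. all: by end_near. Qed.

Lemma is_resolvent_kernel0_limit :
  is_resolvent_kernel0 a lam x y (\sum_(i < s) \sum_(k < s)
    ((4 * pi * mu 0 i) `^ (- (m%:R / 2)) * c i k)%:C *: resolvent_limit (mu 0 i) k).
Proof.
rewrite /is_resolvent_kernel0.
apply: (near_mx_cvg (f := fun eps => \sum_i \sum_k (c i k / (2 * pi) ^+ m)%:C *: wsum a k (fun J =>
    cexp (- (eps / mu 0 i)%:C * lam) * complex_lap J 0 k (mu 0 i) (eps / mu 0 i) (x - y)))).
  near=> eps; have eps0 : 0 < eps by near: eps; exact: nbhs_right_gt.
  by rewrite resolvent0_dampedE.
suff H (i k : 'I_s) : mx_cvg (0 : R)^'+ (fun eps => (c i k / (2 * pi) ^+ m)%:C *: wsum a k (fun J =>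
      cexp (- (eps / mu 0 i)%:C * lam) * complex_lap J 0 k (mu 0 i) (eps / mu 0 i) (x - y)))
    (((4 * pi * mu 0 i) `^ (- (m%:R / 2)) * c i k)%:C *: resolvent_limit (mu 0 i) k).
  exact: (mx_cvg_sum (fun i => mx_cvg_sum (H i))).
(* The factor 1 inserted in the words is the limit of the prefactor e^(-(eps/mu_i) lam), which gives
   the limit the product shape of the damped integrals. *)
have -> : ((4 * pi * mu 0 i) `^ (- (m%:R / 2)) * c i k)%:C *: resolvent_limit (mu 0 i) k =
    (c i k / (2 * pi) ^+ m)%:C *: wsum a k (fun J => 1 * complex_lap J 0 k (mu 0 i) 0 (x - y)).
  rewrite /resolvent_limit scalerA -rmorphM; congr (_%:C *: _).
    rewrite powR_four_pi// !powRN.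
    have p1 : pi `^ (m%:R / 2) != 0 :> R by rewrite gt_eqF// powR_gt0// pi_gt0.
    have p2 : mu 0 i `^ (m%:R / 2) != 0 by rewrite gt_eqF// powR_gt0.
    move: ((2 * pi) ^- m) (pi `^ _) (mu 0 i `^ _) (c i k) p1 p2 => X P Q cc p1 p2.
    by field; rewrite p1 p2.
  by apply: eq_wsum => J _; rewrite mul1r.
apply: mx_cvg_wsum => J Jk; apply: ccvgM; first exact: ccvg_cexp.
have [h1 h2] := ccvg_complex_lap Jk (mu_gt0 i).
by split; [exact: (cvg_comp _ _ (cvg_divr_at_right (mu_gt0 i)) h1)|
  exact: (cvg_comp _ _ (cvg_divr_at_right (mu_gt0 i)) h2)].
Unshelve. all: by end_near. Qed.

End resolvent_kernel.

Theorem mainTheorem2 (R : realType) (m N s : nat)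
  (a : 'I_m -> 'I_m -> 'M[R[i]]_N) (mu : 'rV[R]_s)
  (m_gt0 : (0 < m)%N)
  (a_sym : forall j k, a j k = a k j)
  (a_herm : forall j k, a j k \is hermsymmx)
  (A_posdef : forall xi : 'rV[R]_m, xi != 0 -> posdefmx (symbol a xi))
  (mu_gt0 : forall i, 0 < mu 0 i)
  (mu_distinct : forall i j, mu 0 i = mu 0 j -> i = j)
  (A_eigenvalues : forall xi : 'rV[R]_m, xi != 0 -> forall z : R[i],
     eigenvalue (symbol a xi) z <-> exists i, z = (mu 0 i * sqnorm xi)%:C) :
  let c : 'M[R]_s := invmx (Vandermonde s mu) in
  (forall (t : R) (x y : 'rV[R]_m), 0 < t ->
     heat_kernel0 a t x y =
       \sum_(i < s) \sum_(k < s)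
         ((4 * pi * t * mu 0 i) `^ (- (m%:R / 2)) * c i k
            * (- (t * mu 0 i)) ^+ k)%:C
           *: sym_contract a k (profile k (t * mu 0 i) y) x
     /\
     heat_kernel0 a t x y =
       \sum_(i < s) \sum_(k < s)
         ((4 * pi * t * mu 0 i) `^ (- (m%:R / 2)) * c i k)%:C
           *: iter k (fun f z => (t * mu 0 i)%:C *: F0 a f z)
                (fun z => (profile k (t * mu 0 i) y z)%:C%:M) x)
  /\
  (forall (lam : R[i]) (x y : 'rV[R]_m), complex.Re lam < 0 ->
     ((1 < m)%N -> x != y) ->
     exists L : 'I_s -> 'I_s -> 'M[R[i]]_N,
       (forall i k : 'I_s, is_F0_laplace a k (mu 0 i) lam y x (L i k)) /\
       is_resolvent_kernel0 a lam x y
         (\sum_(i < s) \sum_(k < s)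
            ((4 * pi * mu 0 i) `^ (- (m%:R / 2)) * c i k)%:C *: L i k)).
Proof.
move=> c; have eig (xi : 'rV[R]_m) : xi != 0 -> forall z : R[i],
    eigenvalue (symbol a xi) z -> exists i, z = (mu 0 i * sqnorm xi)%:C.
  by move=> xi0 z; move/(A_eigenvalues _ xi0 z).
split=> [t x y t0|lam x y lam0 xy].
  rewrite (heat_kernel0_profile m_gt0 a_herm mu_gt0 mu_distinct eig x y t0).
  split; apply: eq_bigr => i _; apply: eq_bigr => k _; have tm0 := mulr_gt0 t0 (mu_gt0 i).
    by rewrite (sym_contract_profile a m_gt0 k y tm0).
  by rewrite (iter_F0_profile a m_gt0 k y tm0) scalerA -rmorphM.
exists (fun i k => resolvent_limit a lam x y (mu 0 i) k); split=> [i k|].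
  exact: is_F0_laplace_limit.
exact: is_resolvent_kernel0_limit.
Qed.
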